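(* Let $d\ge 3$, $T>0$ and $(u,f)\in\mathcal N(Q_T)$. Then the following two conditions are equivalent. (1) The energy is continuous: $u\in C([0,T];L^2(\mathbb T^d))$. (2) $(u,f)$ satisfies the energy equality on $[0,T]$, i.e. for all $t_0,t_1\in[0,T]$, $$\tfrac12\|u(t_1)\|_2^2-\tfrac12\|u(t_0)\|_2^2+\int_{t_0}^{t_1}\|\nabla u(t)\|_2^2\,dt=\int_{t_0}^{t_1}\langle u,f\rangle\,dt .$$ If one of the conditions holds, then the anomalous dissipation and the anomalous work are equal: $\overline\Pi=\overline{\mathbf\Phi}$.
   Context: $\mathbb T^d$ is the $d$-dimensional ($2\pi$-periodic) torus, $Q_T=\mathbb T^d\times(0,T)$, $\langle\cdot,\cdot\rangle$ is the $L^2(\mathbb T^d)$ inner product, $\|\cdot\|_2$ is the $L^2(\mathbb T^d)$ norm. The forced Navier-Stokes equations (NSE) are $\partial_t u-\Delta u+\operatorname{div}(u\otimes u)+\nabla p=f$, $\operatorname{div}u=0$, with velocity $u$, pressure $p$, force $f$. $\mathcal L(0,T)$ is the set of $g\in L^1_{loc}(0,T)$ such that $\lim_{a\to0^+,\,b\to T^-}\int_a^b g\,dt$ exists (as a finite limit); integrals of such $g$ up to the endpoints are understood as these limits. Class $\mathcal N(Q_T)$ (smooth solutions with finite energy input): pairs $(u,f)$ such that (i) $u\in C^\infty(Q_T)\cap L^\infty(0,T;L^2(\mathbb T^d))$ and $f\in C^\infty(Q_T)$; (ii) $u,f$ satisfy the NSE (with some pressure $p$) at every point of $Q_T$; (iii)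 $\langle u,f\rangle\in\mathcal L(0,T)$; (iv) the limits of $f(t)$ exist in $\mathcal D'(\mathbb T^d)$ as $t\to0^+$ and $t\to T^-$. For $(u,f)\in\mathcal N(Q_T)$ the weak $L^2$ limits of $u(t)$ as $t\to0^+$ and $t\to T^-$ exist, and $u(0)$, $u(T)$ always denote these weak limits. Littlewood-Paley cutoff: fix a radially non-increasing $\chi\in C_c^\infty(\mathbb R^d)$ with $\chi(\xi)=1$ for $|\xi|\le 1/2$ and $\chi(\xi)=0$ for $|\xi|\ge1$; $u_{\le q}$ is the Fourier multiplier with symbol $\chi(2^{-(q+1)}\xi)$ applied to $u$. Anomalous dissipation and anomalous work (at time $T$): $$\overline\Pi=\limsup_{q\to\infty}\Big|\int_{T/2}^T\langle(u\cdot\nabla u)_{\le q},u_{\le q}\rangle\,dt\Big|,\qquad \overline{\mathbf\Phi}=\limsup_{q\to\infty}\Big|\int_{T/2}^T\big(\langle u_{\le q},f_{\le q}\rangle-\langle u,f\rangle\big)\,dt\Big| .$$ *)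

(* Defs.v *)
From HB Require Import structures.
From mathcomp Require Import all_boot all_order all_algebra.
From mathcomp Require Import complex.
From mathcomp Require Import all_classical all_reals all_analysis.

Set Implicit Arguments.
Unset Strict Implicit.
Unset Printing Implicit Defensive.

Import Order.TTheory GRing.Theory Num.Theory.
Import numFieldNormedType.Exports.

Local Open Scope classical_set_scope.
Local Open Scope ring_scope.

(* The n-fold product of a finite measure m, as a measure on n.-tuple X. *)
Section power_measure.
Context d (X : measurableType d) (R : realType).
Variable m : {finite_measure set X -> \bar R}.

Definition tcons n (x : X * n.-tuple X) : n.+1.-tuple X := [tuple of x.1 :: x.2].

Lemma measurable_tcons n : measurable_fun [set: X * n.-tuple X] (@tcons n).
Proof. exact: measurable_cons measurable_fst measurable_snd. Qed.

Section successor.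
Variables (n : nat) (nu : {finite_measure set (n.-tuple X) -> \bar R}).

Definition cons_measure : set (n.+1.-tuple X) -> \bar R :=
  pushforward (m \x nu)%E (@tcons n).

Let cons_measure0 : cons_measure set0 = 0%E.
Proof. by rewrite /cons_measure /pushforward preimage_set0 measure0. Qed.

Let cons_measure_ge0 A : (0 <= cons_measure A)%E.
Proof. by rewrite /cons_measure /pushforward measure_ge0. Qed.

Let cons_measure_sigma_additive : semi_sigma_additive cons_measure.
Proof.
move=> F mF tF mUF; rewrite /cons_measure /pushforward preimage_bigcup.
have mtF k : measurable (@tcons n @^-1` F k).
  by rewrite -[X in measurable X]setTI; exact: measurable_tcons.
apply: measure_semi_sigma_additive => //.
- apply/trivIsetP => /= i j _ _ ij; rewrite -preimage_setI.
  by move/trivIsetP : tF => /(_ _ _ _ _ ij) ->//; rewrite preimage_set0.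
- exact: bigcupT_measurable.
Qed.

HB.instance Definition _ := isMeasure.Build _ _ _ cons_measure
  cons_measure0 cons_measure_ge0 cons_measure_sigma_additive.

Let cons_measure_fin : fin_num_fun cons_measure.
Proof.
apply: lty_fin_num_fun.
rewrite /= /cons_measure /pushforward preimage_setT -setXTT product_measure1E//.
by rewrite lte_mul_pinfty// ?fin_num_measure// ltey_eq fin_num_measure.
Qed.

HB.instance Definition _ :=
  Measure_isFinite.Build _ _ _ cons_measure cons_measure_fin.

End successor.

Fixpoint power_measure n : {finite_measure set (n.-tuple X) -> \bar R} :=
  if n is n'.+1 then cons_measure (power_measure n')
  else \d_([tuple] : 0.-tuple X).

End power_measure.

(* A function on T^d is a function on R^d that is 2pi-periodic in each
   coordinate; integration over T^d is integration over the box [0, 2pi]^d.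
   Vectors have type 'rV[R]_d, and measurability is that of d.-tuple R. *)
Section torus.
Context {R : realType}.
Local Notation mu := (@lebesgue_measure R).

Lemma lebesgue_period_lty : (mu `[0%R, (2 * pi)%R]%classic < +oo)%E.
Proof. by rewrite lebesgue_measure_itv/=; case: ifP => _; exact: ltry. Qed.

Definition period_measure : {finite_measure set (measurableTypeR R) -> \bar R} :=
  mfrestr (T := measurableTypeR R) (measurable_itv `[0, 2 * pi]) lebesgue_period_lty.

Definition torus_measure (d : nat) :
  {finite_measure set (d.-tuple (measurableTypeR R)) -> \bar R} :=
  power_measure period_measure d.

Definition row_of_tuple d (x : d.-tuple (measurableTypeR R)) : 'rV[R]_d := \row_i tnth x i.

Definition torus_int d (g : 'rV[R]_d -> R) : R :=
  \int[torus_measure d]_x g (row_of_tuple x).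

Definition space_periodic d (W : Type) (g : 'rV[R]_d -> W) :=
  forall x i, g (x + (2 * pi) *: delta_mx 0 i) = g x.

Definition inner d (v w : 'rV[R]_d -> 'rV[R]_d) : R :=
  torus_int (fun x => \sum_i v x 0 i * w x 0 i).

Definition L2norm d (v : 'rV[R]_d -> 'rV[R]_d) : R := Num.sqrt (inner v v).

Definition inL2 d (v : 'rV[R]_d -> 'rV[R]_d) :=
  space_periodic v /\
  forall i, (fun x => v (row_of_tuple x) 0 i) \in Lfun (torus_measure d) 2%:E.

End torus.

Section smooth.
Context {R : realType} {V W : normedModType R}.

(* For finite-dimensional V and open D this is the usual class C^k(D): all
   iterated directional derivatives of order at most k exist and are
   continuous. *)
Fixpoint Ck (k : nat) (D : set V) (g : V -> W) : Prop :=
  (forall x, D x -> {for x, continuous g}) /\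
  if k is k'.+1 then
    forall v, (forall x, D x -> derivable g x v) /\ Ck k' D ('D_v g)
  else True.

Definition smooth (D : set V) (g : V -> W) := forall k, Ck k D g.

End smooth.

Section vector_calculus.
Context {R : realType} {d : nat}.
Implicit Types (p : 'rV[R]_d -> R) (v : 'rV[R]_d -> 'rV[R]_d).

Definition partial (W : normedModType R) (i : 'I_d) (g : 'rV[R]_d -> W) :=
  'D_(delta_mx 0 i) g.

Definition gradient p x : 'rV[R]_d := \row_i partial i p x.

Definition divergence v x : R := \sum_i partial i (fun y => v y 0 i) x.

Definition laplacian v x : 'rV[R]_d := \sum_i partial i (partial i v) x.

(* div (v (x) v) *)
Definition div_tensor v x : 'rV[R]_d :=
  \row_i \sum_j partial j (fun y => v y 0 i * v y 0 j) x.

(* (v . grad) v *)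
Definition advection v x : 'rV[R]_d := \sum_j v x 0 j *: partial j v x.

Definition grad_norm_sq v : R :=
  torus_int (fun x => \sum_i \sum_j (partial j v x 0 i) ^+ 2).

End vector_calculus.

Section distributions.
Context {R : realType} {d : nat}.
Implicit Types (phi v : 'rV[R]_d -> 'rV[R]_d).

Definition test_field phi := space_periodic phi /\ smooth setT phi.

Definition partials (a : seq 'I_d) phi := foldr (@partial R d _) phi a.

(* Vector-valued distributions on T^d; the second clause is continuity with
   respect to the C^N seminorms, the least admissible B being the C^N norm. *)
Definition is_distribution (L : ('rV[R]_d -> 'rV[R]_d) -> R) :=
  (forall c phi psi, test_field phi -> test_field psi ->
     L (fun x => c *: phi x + psi x) = c * L phi + L psi) /\
  exists (N : nat) (C : R), forall phi B, test_field phi ->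
    (forall a x, (size a <= N)%N -> `|partials a phi x| <= B) ->
    `|L phi| <= C * B.

Definition has_distr_limit (F : set_system R)
    (g : R -> 'rV[R]_d -> 'rV[R]_d) :=
  exists L, is_distribution L /\
    forall phi, test_field phi -> inner (g t) phi @[t --> F] --> L phi.

End distributions.

Section time.
Context {R : realType}.
Local Notation mu := (@lebesgue_measure R).
Implicit Types (g : R -> R) (a b : R).

Definition int_between g (ab : R * R) : R := \int[mu]_(t in `[ab.1, ab.2]) g t.

Definition in_calL T g :=
  locally_integrable `]0, T[%classic g /\
  exists l : R, int_between g ab @[ab --> filter_prod 0^'+ T^'-] --> l.

(* int_a^b g for a <= b, as the limit of int_a'^b' g when a' -> a+, b' -> b- *)
Definition improper_int g a b : R :=
  lim (int_between g ab @[ab --> filter_prod a^'+ b^'-]).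

(* int_a^b = - int_b^a when b < a *)
Definition oriented (I : R -> R -> \bar R) a b : \bar R :=
  if a <= b then I a b else (- I b a)%E.

End time.

Section navier_stokes.
Context {R : realType} {d : nat}.
Local Notation mu := (@lebesgue_measure R).
Local Notation field := ('rV[R]_d -> 'rV[R]_d).
Implicit Types (T : R) (u f : R -> field).

Definition cylinder T : set (R * 'rV[R]_d) := [set z | 0 < z.1 < T].

Definition NSE T u f (p : R -> 'rV[R]_d -> R) :=
  forall (t : R) x, 0 < t < T ->
    derive1 (fun s => u s x) t - laplacian (u t) x + div_tensor (u t) x
      + gradient (p t) x = f t x
    /\ divergence (u t) x = 0.

(* Values outside the open time interval ]0, T[ are irrelevant. *)
Record class_N T u f : Prop := {
  N_u_periodic : forall t : R, 0 < t < T -> space_periodic (u t) ;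
  N_u_smooth : smooth (cylinder T) (fun z => u z.1 z.2) ;
  N_u_bounded : exists M : R,
    {ae mu, forall t : R, 0 < t < T -> L2norm (u t) <= M} ;
  N_f_periodic : forall t : R, 0 < t < T -> space_periodic (f t) ;
  N_f_smooth : smooth (cylinder T) (fun z => f z.1 z.2) ;
  N_nse : exists p : R -> 'rV[R]_d -> R,
    [/\ forall t : R, 0 < t < T -> space_periodic (p t),
        smooth (cylinder T) (fun z => p z.1 z.2) &
        NSE T u f p] ;
  N_work : in_calL T (fun t => inner (u t) (f t)) ;
  N_f_start : has_distr_limit 0^'+ f ;
  N_f_end : has_distr_limit T^'- f }.

Definition weakly_cvg (F : set_system R) u (v : field) :=
  inL2 v /\
  forall w, inL2 w -> inner (u t) w @[t --> F] --> inner v w.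

Definition weak_lim (F : set_system R) u : field :=
  xget (fun=> 0) [set v | weakly_cvg F u v].

(* u on [0, T], u(0) and u(T) being the weak limits *)
Definition closed_traj T u (t : R) : field :=
  if t == 0 then weak_lim 0^'+ u
  else if t == T then weak_lim T^'- u
  else u t.

Definition energy_continuous T u :=
  let U := closed_traj T u in
  (forall t : R, 0 <= t <= T -> inL2 (U t)) /\
  forall t : R, 0 <= t <= T ->
    L2norm (U s \- U t) @[s --> within `[0, T]%classic (nbhs t)] --> (0 : R).

(* The dissipation may be +oo a priori, whence the equality in \bar R. *)
Definition energy_equality T u f :=
  let U := closed_traj T u in
  forall t0 t1 : R, 0 <= t0 <= T -> 0 <= t1 <= T ->
    ((2^-1 * L2norm (U t1) ^+ 2 - 2^-1 * L2norm (U t0) ^+ 2)%:E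
      + oriented (fun a b => \int[mu]_(t in `]a, b[) (grad_norm_sq (u t))%:E) t0 t1
    = oriented (fun a b =>
        (improper_int (fun t => inner (u t) (f t)) a b)%:E) t0 t1)%E.

End navier_stokes.

Section littlewood_paley.
Context {R : realType} {d : nat}.
Local Notation field := ('rV[R]_d -> 'rV[R]_d).
Implicit Types (chi g : 'rV[R]_d -> R) (k : 'rV[int]_d) (x : 'rV[R]_d).

(* The norm of 'rV[R]_d is the sup norm. *)
Definition euclidean_norm x : R := Num.sqrt (\sum_i x 0 i ^+ 2).

Definition lp_cutoff chi :=
  [/\ smooth setT chi,
      forall xi eta, euclidean_norm xi <= euclidean_norm eta ->
        chi eta <= chi xi,
      forall xi, euclidean_norm xi <= 2^-1 -> chi xi = 1 &
      forall xi, 1 <= euclidean_norm xi -> chi xi = 0].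

Definition frequency k : 'rV[R]_d := map_mx intr k.

Definition phase k x : R := \sum_i frequency k 0 i * x 0 i.

Definition expi (r : R) : R[i] := Complex (cos r) (sin r).

(* (2pi)^-d int g(x) e^(-i k.x) dx *)
Definition fourier_coef g k : R[i] :=
  (((2 * pi) ^- d)%:C * Complex (torus_int (fun x => g x * cos (phase k x)))
                               (- torus_int (fun x => g x * sin (phase k x))))%C.

(* The sum is finite because chi has compact support, and real because chi is
   radial, hence even; fsbigop sums over the support of the summand. *)
Definition lp_scalar chi (q : nat) g x : R :=
  complex.Re (\sum_(k \in [set: 'rV[int]_d])
    (chi (2 ^- q.+1 *: frequency k))%:C * fourier_coef g k * expi (phase k x))%C.

Definition lp chi (q : nat) (v : field) : field :=
  fun x => \row_i lp_scalar chi q (fun y => v y 0 i) x.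

Definition anomalous_dissipation chi (T : R) (u : R -> field) : \bar R :=
  limn_esup (fun q => `| improper_int (fun t =>
    inner (lp chi q (advection (u t))) (lp chi q (u t))) (T / 2) T |%:E).

Definition anomalous_work chi (T : R) (u f : R -> field) : \bar R :=
  limn_esup (fun q => `| improper_int (fun t =>
    inner (lp chi q (u t)) (lp chi q (f t)) - inner (u t) (f t)) (T / 2) T |%:E).

End littlewood_paley.

(* Main.v *)
From HB Require Import structures.
Require Import Defs.
From mathcomp Require Import all_boot all_order all_algebra.
From mathcomp Require Import complex ring lra.
From mathcomp Require Import all_classical all_reals all_analysis.
From mathcomp Require Import measurable_realfun.

Set Implicit Arguments.
Unset Strict Implicit.
Unset Printing Implicit Defensive.

Import Order.TTheory GRing.Theory Num.Theory.
Import numFieldNormedType.Exports.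

Local Open Scope classical_set_scope.
Local Open Scope ring_scope.

(** On ]0, T[ everything is smooth, so testing the equations with u gives the
    exact energy balance on every compact subinterval: transport and pressure
    drop out by integration by parts on the torus, and the dissipation over
    [s, t] equals the work over [s, t] minus the increment of the energy
    ([energy_increment]). Both conditions of the theorem are statements about
    what happens at the two end points, and each is equivalent to a third one,
    [energy_endpoints]: the energy |u(t)|^2 / 2 converges to |u(0)|^2 / 2 and
    |u(T)|^2 / 2 at the end points.

    If the energy has these limits, then so has the dissipation, because the
    work has limits by definition of the class; monotone convergence gives the
    energy equality ([endpoints_energy_equality]). Conversely the energy
    equality forces the dissipation to be integrable up to the end points, and
    letting the interval shrink to an end point gives the limits of the energy
    ([energy_equality_endpoints]). Strong continuity trivially implies
    convergence of the norms, and convergence of the norms upgrades weak to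
    strong convergence; where there is no weak limit, the convention for
    [weak_lim] makes the limit 0, and then convergence of the norms is already
    strong convergence ([weak_lim_strong_cvg]).

    For the last claim, the Littlewood-Paley projection is a Fourier multiplier
    with a symbol in [0, 1], and the form <P g, P h> has the same algebraic
    properties as the L2 product, in particular partial derivatives are skew for
    it. Hence the energy balance is proved once, for an abstract [energy_form],
    and applies to u and to its truncation; for the truncation the transport
    term survives and is the flux. Subtracting the two balances
    ([flux_work_identity]) shows that the flux minus the defect of the work is
    the energy lost by truncation at the end points plus the dissipation lost
    by truncation. Both tend to 0: the loss of a fixed continuous field tends to
    0 because trigonometric polynomials are dense ([trig_approx],
    [tail_cvg0]); the dissipation is integrable up to T, which gives dominated
    convergence in time; and near T the field is close in L2 to a fixed
    u(b), b < T ([final_loss_cvg0]). So the two limits superior agree.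

    Density is obtained from the products of factors (1 + cos z_i) / 2, whose
    first moments are computed by an integration by parts ([kernel_moment]). *)

(** * Continuous periodic functions and their integral over the torus *)

Section rows.
Context {R : realType}.

Lemma cvg_row d (F : set_system nat) (FF : Filter F) (h : nat -> 'rV[R]_d) (x : 'rV[R]_d) :
  (forall i, h n 0 i @[n --> F] --> x 0 i) -> h n @[n --> F] --> x.
Proof.
move=> hx; apply/cvgrPdist_lt => e e0.
have : forall i, \forall n \near F, `|x 0 i - h n 0 i| < e.
  by move=> i; move/cvgrPdist_lt : (hx i); exact.
move=> /filter_forall; apply: filterS => n H.
rewrite /Num.norm/= mx_normrE; apply: bigmax_lt => //= -[i j] _.
by rewrite !mxE/= ord1; exact: H.
Qed.

(** The measurable sets of tuples are generated by the coordinates, not by the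
    open sets; [g] is the pointwise limit of its values at the grid points below
    its argument, and these step functions take countably many values, each on a
    box. *)
Lemma measurable_continuous_row d (g : 'rV[R]_d -> R) : continuous g ->
  measurable_fun [set: d.-tuple (measurableTypeR R)] (g \o @row_of_tuple R d).
Proof.
move=> cg.
pose lo (n : nat) (k : 'rV[int]_d) : 'rV[R]_d := \row_i ((k 0 i)%:~R / n.+1%:R).
pose fl (n : nat) (x : d.-tuple (measurableTypeR R)) : 'rV[int]_d :=
  \row_i Num.floor (n.+1%:R * (tnth x i : R)).
apply: (@measurable_fun_cvg _ _ _ _ (fun n x => g (lo n (fl n x)))).
  move=> n _ Y mY; rewrite setTI.
  have -> : (fun x => g (lo n (fl n x))) @^-1` Y =
      \bigcup_(k : 'rV[int]_d) ([set x | fl n x = k] `&` [set x | Y (g (lo n k))]).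
    apply/seteqP; split => [x /= Yx|x [k _] [/= <-]//].
    by exists (fl n x).
  apply: countable_bigcupT_measurable; first exact: countableP.
  move=> k; apply: measurableI; last first.
    have [p|p] := pselect (Y (g (lo n k))).
      by rewrite (_ : [set _ | _] = setT)//; apply/seteqP; split.
    by rewrite (_ : [set _ | _] = set0)//; apply/seteqP; split.
  rewrite (_ : [set x | _] = \bigcap_(i in [set: 'I_d])
     ((fun x : d.-tuple (measurableTypeR R) => tnth x i) @^-1`
       `[((k 0 i)%:~R / n.+1%:R : R), ((k 0 i + 1)%:~R / n.+1%:R)[%classic)).
    apply: fin_bigcap_measurable; first exact: finite_finset.
    move=> i _; rewrite -[X in measurable X]setTI.
    apply: (measurable_tnth i) => //; exact: measurable_itv.
  have E (i : 'I_d) (x : d.-tuple (measurableTypeR R)) :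
      ((tnth x i : R) \in `[((k 0 i)%:~R / n.+1%:R : R), ((k 0 i + 1)%:~R / n.+1%:R)[) =
      (Num.floor (n.+1%:R * (tnth x i : R)) == k 0 i).
    by rewrite in_itv/= ler_pdivrMr// ltr_pdivlMr// floor_eq mulrC.
  apply/seteqP; split => [x /= xk i _|x xk].
    by rewrite /= E -xk mxE.
  by apply/rowP => i; rewrite mxE; apply/eqP; rewrite -E; exact: xk.
move=> x _; apply: (@cvg_comp _ _ _ (fun n => lo n (fl n x)) g); last exact: cg.
apply: cvg_row => i.
apply/cvgrPdist_lt => e e0; near=> n.
have n0 : 0 < n.+1%:R :> R by [].
rewrite !mxE ger0_norm; last first.
  by rewrite subr_ge0 ler_pdivrMr// mulrC floor_le.
have [_] := andP (floor_itv (n.+1%:R * (tnth x i : R))).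
rewrite intrD mulrC -ltr_pdivlMr// mulrDl => H.
rewrite ltrBlDl (lt_trans H)// ltrD2l mul1r.
by near: n; exact: (near_infty_natSinv_lt (PosNum e0)).
Unshelve. all: by end_near. Qed.
End rows.

Section continuous_periodic.
Context {R : realType}.

Definition cperiodic d (g : 'rV[R]_d -> R) := continuous g /\ space_periodic g.

Lemma periodicZ d W (g : 'rV[R]_d -> W) i (k : int) x :
  space_periodic g -> g (x + (2 * pi * k%:~R) *: delta_mx 0 i) = g x.
Proof.
move=> pg.
have pn (n : nat) y : g (y + (2 * pi * n%:R) *: delta_mx 0 i) = g y.
  elim: n y => [|n IH] y; first by rewrite mulr0 scale0r addr0.
  by rewrite -[n.+1%:R]natr1 mulrDr mulr1 scalerDl addrA pg.
case: k => n; first exact: pn.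
by rewrite NegzE mulrNz mulrN scaleNr -(pn n.+1 (x - _)) subrK.
Qed.

(** The same [y] serves all periodic functions at once, so that several of them
    can be moved to the compact box together. *)
Lemma periodic_box d (x : 'rV[R]_d) : exists2 y : 'rV[R]_d,
  (forall i, 0 <= y 0 i <= 2 * pi) &
  forall W (g : 'rV[R]_d -> W), space_periodic g -> g x = g y.
Proof.
have pi2 : 0 < 2 * pi :> R by rewrite mulr_gt0// pi_gt0.
pose k i := Num.floor (x 0 i / (2 * pi)).
pose sh (s : seq 'I_d) := \sum_(i <- s) (2 * pi * (- k i)%:~R) *: delta_mx 0 i : 'rV[R]_d.
have shE i : sh (index_enum 'I_d) 0 i = - (2 * pi * (k i)%:~R).
  rewrite summxE (bigD1 i)//= big1 => [|j ji]; last first.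
    by rewrite !mxE eqxx [i == j]eq_sym (negbTE ji) mulr0.
  by rewrite !mxE !eqxx mulr1 addr0 mulrNz mulrN.
have [X eX] : {X | X = sh (index_enum 'I_d)} by eexists.
exists (x + X) => [i|W g pg].
  rewrite mxE eX shE; have := floor_itv (x 0 i / (2 * pi)); rewrite -/(k i).
  rewrite ler_pdivlMr// ltr_pdivrMr// intrD => /andP[h1 h2].
  by apply/andP; split; lra.
suff : forall s, g (x + sh s) = g x by rewrite eX => ->.
elim=> [|i s IH]; first by rewrite /sh big_nil addr0.
by rewrite -IH /sh big_cons addrCA addrC periodicZ.
Qed.

Lemma box_compact d (a b : R) : compact [set y : 'rV[R]_d | forall i, a <= y 0 i <= b].
Proof.
rewrite (_ : [set _ | _] = [set v : 'rV[R]_d | forall i, `[a, b]%classic (v ord0 i)]).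
  by apply: (@rV_compact R d (fun=> `[a, b]%classic)) => i; exact: segment_compact.
by apply/seteqP; split => x /= H i; have := H i; rewrite in_itv.
Qed.

Lemma cperiodic_bounded d (g : 'rV[R]_d -> R) : cperiodic g ->
  exists2 M : R, 0 < M & forall x, `|g x| <= M.
Proof.
move=> [cg pg].
have /compact_bounded[M [_ HM]] :=
  continuous_compact (continuous_subspaceT cg) (@box_compact d 0 (2 * pi)).
exists (`|M| + 1) => [|x]; first by rewrite ltr_pwDr.
have [y yb ->//] := periodic_box x.
apply: (HM (`|M| + 1) _ (g y)); last by exists y.
by rewrite (le_lt_trans (ler_norm _))// ltrDl.
Qed.

Lemma bounded_torus_integrable d (g : 'rV[R]_d -> R) M :
  continuous g -> (forall x, `|g x| <= M) ->
  (torus_measure d).-integrable setT (EFin \o (g \o @row_of_tuple R d)).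
Proof.
move=> cg gM; apply: measurable_bounded_integrable => //.
- by rewrite ltey_eq fin_num_measure.
- exact: measurable_continuous_row.
by exists M; split; [exact: num_real|move=> r Mr x _; exact: le_trans (gM _) (ltW Mr)].
Qed.

Lemma cperiodic_integrable d (g : 'rV[R]_d -> R) : cperiodic g ->
  (torus_measure d).-integrable setT (EFin \o (g \o @row_of_tuple R d)).
Proof.
move=> cg; have [M _ gM] := cperiodic_bounded cg.
exact: bounded_torus_integrable (proj1 cg) gM.
Qed.

Lemma cperiodic_cst d (c : R) : cperiodic (fun _ : 'rV[R]_d => c).
Proof. by split=> [|x i]; [exact: cst_continuous|]. Qed.

Lemma cperiodicD d (g h : 'rV[R]_d -> R) : cperiodic g -> cperiodic h -> cperiodic (fun x => g x + h x).
Proof.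
move=> [cg pg] [ch ph]; split=> [x|x i]; first exact: cvgD (cg x) (ch x).
by rewrite pg ph.
Qed.

Lemma cperiodicM d (g h : 'rV[R]_d -> R) : cperiodic g -> cperiodic h -> cperiodic (fun x => g x * h x).
Proof.
move=> [cg pg] [ch ph]; split=> [x|x i]; first exact: cvgM (cg x) (ch x).
by rewrite pg ph.
Qed.

Lemma cperiodicZ d a (g : 'rV[R]_d -> R) : cperiodic g -> cperiodic (fun x => a * g x).
Proof. by move=> cg; apply: cperiodicM => //; exact: cperiodic_cst. Qed.

Lemma cperiodicN d (g : 'rV[R]_d -> R) : cperiodic g -> cperiodic (fun x => - g x).
Proof. by move=> /(cperiodicZ (-1)); under eq_fun do rewrite mulN1r. Qed.

Lemma cperiodicB d (g h : 'rV[R]_d -> R) : cperiodic g -> cperiodic h -> cperiodic (fun x => g x - h x).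
Proof. by move=> cg /cperiodicN; exact: cperiodicD. Qed.

Lemma eq_cperiodic d (g h : 'rV[R]_d -> R) : h =1 g -> cperiodic h -> cperiodic g.
Proof. by move=> /funext->. Qed.

Lemma cperiodic_sum d I (r : seq I) (P : pred I) (g : I -> 'rV[R]_d -> R) :
  (forall i, P i -> cperiodic (g i)) -> cperiodic (fun x => \sum_(i <- r | P i) g i x).
Proof.
move=> cg; elim: r => [|i r IH].
  by apply: (@eq_cperiodic _ _ (fun=> 0)) => [x|]; [rewrite big_nil|exact: cperiodic_cst].
apply: (@eq_cperiodic _ _ (fun x => if P i then g i x + \sum_(i <- r | P i) g i x
    else \sum_(i <- r | P i) g i x)) => [x|]; first by rewrite big_cons.
by case: (P i) (cg i) => // cgi; apply: cperiodicD => //; exact: cgi.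
Qed.

Lemma torus_intD d (g h : 'rV[R]_d -> R) : cperiodic g -> cperiodic h ->
  torus_int (fun x => g x + h x) = torus_int g + torus_int h.
Proof. by move=> cg ch; exact: RintegralD (cperiodic_integrable cg) (cperiodic_integrable ch). Qed.

Lemma torus_intB d (g h : 'rV[R]_d -> R) : cperiodic g -> cperiodic h ->
  torus_int (fun x => g x - h x) = torus_int g - torus_int h.
Proof. by move=> cg ch; exact: RintegralB (cperiodic_integrable cg) (cperiodic_integrable ch). Qed.

Lemma torus_intZ d a (g : 'rV[R]_d -> R) : cperiodic g ->
  torus_int (fun x => a * g x) = a * torus_int g.
Proof. by move=> cg; exact: RintegralZl (cperiodic_integrable cg). Qed.

Lemma torus_intN d (g : 'rV[R]_d -> R) : cperiodic g ->
  torus_int (fun x => - g x) = - torus_int g.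
Proof.
by move=> cg; rewrite -mulN1r -torus_intZ//; congr torus_int; apply/funext => x; rewrite mulN1r.
Qed.

Lemma torus_int0 d : torus_int (fun _ : 'rV[R]_d => 0) = 0.
Proof. by rewrite /torus_int Rintegral_cst// mul0r. Qed.

Lemma eq_torus_int d (g h : 'rV[R]_d -> R) : g =1 h -> torus_int g = torus_int h.
Proof. by move=> /funext->. Qed.

Lemma torus_int_sum d I (r : seq I) (P : pred I) (g : I -> 'rV[R]_d -> R) :
  (forall i, P i -> cperiodic (g i)) ->
  torus_int (fun x => \sum_(i <- r | P i) g i x) = \sum_(i <- r | P i) torus_int (g i).
Proof.
move=> cg; elim: r => [|i r IH].
  by rewrite big_nil -[RHS](torus_int0 d); apply: eq_torus_int => x; rewrite big_nil.
rewrite big_cons (@eq_torus_int _ _ (fun x => if P i then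
    g i x + \sum_(i <- r | P i) g i x else \sum_(i <- r | P i) g i x)) => [|x].
  case: (P i) (cg i) => // cgi; rewrite torus_intD ?IH//; first exact: cgi.
  exact: cperiodic_sum.
by rewrite big_cons.
Qed.

Lemma torus_int_ge0 d (g : 'rV[R]_d -> R) : (forall x, 0 <= g x) -> 0 <= torus_int g.
Proof. by move=> g0; apply: Rintegral_ge0 => x _; exact: g0. Qed.

Lemma le_torus_int d (g h : 'rV[R]_d -> R) : cperiodic g -> cperiodic h ->
  (forall x, g x <= h x) -> torus_int g <= torus_int h.
Proof.
move=> cg ch gh; rewrite -subr_ge0 -torus_intB//; apply: torus_int_ge0 => x.
by rewrite subr_ge0.
Qed.

End continuous_periodic.

(** * Iterated integrals and integration by parts on the torus *)

Section iterated.
Context {R : realType}.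
Local Notation mu := (@lebesgue_measure R).
Local Notation pm := (@period_measure R).

Lemma pi2_gt0 : 0 < 2 * pi :> R.
Proof. by rewrite mulr_gt0// pi_gt0. Qed.

Lemma bounded_period_integrable (g : R -> R) (M : R) : continuous g ->
  (forall x, `|g x| <= M) -> pm.-integrable setT (EFin \o g).
Proof.
move=> cg gM; apply: measurable_bounded_integrable => //.
- by rewrite ltey_eq fin_num_measure.
- exact: continuous_measurable_fun.
by exists M; split; [exact: num_real|move=> r Mr x _; exact: le_trans (gM x) (ltW Mr)].
Qed.

Lemma Rintegral_period (g : R -> R) (M : R) : continuous g -> (forall x, `|g x| <= M) ->
  \int[pm]_x g x = \int[mu]_(x in `[0, 2 * pi]) g x.
Proof.
move=> cg gM; rewrite /Rintegral.
rewrite (@negligible_integral _ _ _ pm setT (~` `[0, 2 * pi]%classic)) //=.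
- rewrite setDE setTI setCK; congr fine; apply: eq_measure_integral => /= A mA AI.
  by rewrite /period_measure /mfrestr /mrestr setIidl.
- by apply: measurableC; exact: measurable_itv.
- exact: bounded_period_integrable gM.
- by rewrite /period_measure /mfrestr /mrestr setICl measure0.
Qed.

Lemma period_int_derive (g : R -> R) (M : R) : (forall x, derivable g x 1) ->
  continuous (derive1 g) -> (forall x, `|derive1 g x| <= M) -> g (2 * pi) = g 0 ->
  \int[pm]_x (derive1 g x) = 0.
Proof.
move=> dg cg gM g0; rewrite (Rintegral_period cg gM) /Rintegral.
have FTC := @continuous_FTC2 R (derive1 g) g 0 (2 * pi) pi2_gt0.
apply: (@etrans _ _ (fine ((g (2 * pi))%:E - (g 0)%:E)%E)); last first.
  by rewrite g0 -EFinB subrr.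
congr fine; apply: FTC.
- exact: continuous_subspaceT.
- have cc x : {for x, continuous g} by apply/differentiable_continuous/derivable1_diffP.
  split => [x _//||]; [apply: cvg_at_right_filter; exact: cc|apply: cvg_at_left_filter; exact: cc].
- by [].
Qed.

Definition consrow d (x : R) (y : 'rV[R]_d) : 'rV[R]_d.+1 := row_mx (const_mx x : 'rV_1) y.

Lemma consrow0 d x (y : 'rV[R]_d) : consrow x y 0 ord0 = x.
Proof.
rewrite /consrow (_ : ord0 = lshift d (ord0 : 'I_1)); last exact: val_inj.
by rewrite (@row_mxEl _ 1 1 d) mxE.
Qed.

Lemma consrowS d x (y : 'rV[R]_d) i : consrow x y 0 (lift ord0 i) = y 0 i.
Proof.
rewrite /consrow (_ : lift ord0 i = rshift 1 i); last exact: val_inj.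
by rewrite (@row_mxEr _ 1 1 d).
Qed.

Lemma row_of_tuple_tcons d x (t : d.-tuple (measurableTypeR R)) :
  row_of_tuple (tcons (x, t)) = consrow x (row_of_tuple t).
Proof.
apply/rowP => i; rewrite mxE; case: (unliftP ord0 i) => [j ->|->].
  by rewrite consrowS mxE /tcons/= tnthS.
by rewrite consrow0 /tcons tnth0.
Qed.

Lemma consrowD d (x x' : R) (y y' : 'rV[R]_d) : consrow (x + x') (y + y') = consrow x y + consrow x' y'.
Proof.
apply/rowP => i; rewrite [RHS]mxE; case: (unliftP ord0 i) => [j ->|->].
  by rewrite !consrowS mxE.
by rewrite !consrow0.
Qed.

Lemma consrowZ d a (x : R) (y : 'rV[R]_d) : consrow (a * x) (a *: y) = a *: consrow x y.
Proof.
apply/rowP => i; rewrite [RHS]mxE; case: (unliftP ord0 i) => [j ->|->].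
  by rewrite !consrowS mxE.
by rewrite !consrow0.
Qed.

Lemma consrow_delta0 d : delta_mx 0 ord0 = consrow 1 (0 : 'rV[R]_d).
Proof.
apply/rowP => i; rewrite mxE eqxx/=; case: (unliftP ord0 i) => [j ->|->].
  by rewrite consrowS mxE.
by rewrite consrow0.
Qed.

Lemma consrow_deltaS d (j : 'I_d) : delta_mx 0 (lift ord0 j) = consrow 0 (delta_mx 0 j : 'rV[R]_d).
Proof.
apply/rowP => i; rewrite mxE eqxx/=; case: (unliftP ord0 i) => [k ->|->].
  by rewrite consrowS mxE eqxx (inj_eq lift_inj).
by rewrite consrow0.
Qed.

Lemma continuous_consrow d : continuous (fun p : R * 'rV[R]_d => consrow p.1 p.2).
Proof.
move=> p; apply/cvgrPdist_lt => e e0; near=> q.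
rewrite /Num.norm/= mx_normrE; apply: bigmax_lt => //= -[i j] _; rewrite !ord1/=.
have : ball p e q by near: q; apply: (nbhsx_ballx p e e0).
move=> [] /=; rewrite -ball_normE/= => b1.
rewrite -ball_normE/= => b2.
rewrite -scaleN1r -consrowZ -consrowD mulN1r scaleN1r.
case: (unliftP ord0 j) => [k ->|->]; rewrite ?consrowS ?consrow0//.
apply: le_lt_trans b2.
rewrite [leRHS]/Num.norm/= mx_normrE.
exact: le_trans (le_bigmax _ _ (0, k)).
Unshelve. all: by end_near. Qed.

Lemma continuous_consrowr (T : topologicalType) d (g : 'rV[R]_d.+1 -> T) x :
  continuous g -> continuous (g \o consrow x).
Proof.
move=> cg y; apply: continuous_comp; last exact: cg.
apply: (@continuous_comp _ _ _ (fun y => (x, y)) (fun p => consrow p.1 p.2)).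
  exact: (cvg_pair (@cvg_cst _ x _ (nbhs y) _) (@cvg_id _ (nbhs y))).
exact: continuous_consrow.
Qed.

Lemma continuous_consrowl (T : topologicalType) d (g : 'rV[R]_d.+1 -> T) (y : 'rV[R]_d) :
  continuous g -> continuous (g \o (fun x => consrow x y)).
Proof.
move=> cg x; apply: continuous_comp; last exact: cg.
apply: (@continuous_comp _ _ _ (fun x : R => (x, y)) (fun p => consrow p.1 p.2)).
  exact: (cvg_pair (@cvg_id _ (nbhs x)) (@cvg_cst _ y _ (nbhs x) _)).
exact: continuous_consrow.
Qed.

Let consrow_comp_integrable d (g : 'rV[R]_d.+1 -> R) (M : R) :
  continuous g -> (forall x, `|g x| <= M) ->
  (pm \x torus_measure d)%E.-integrable setT
    (EFin \o (g \o @row_of_tuple R d.+1) \o @tcons _ (measurableTypeR R) d).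
Proof.
move=> cg gM; apply: measurable_bounded_integrable => //.
- rewrite -setXTT [ltLHS](@product_measure1E _ _ _ _ _ pm)//.
  by rewrite lte_mul_pinfty// ?fin_num_measure// ltey_eq fin_num_measure.
- apply: measurableT_comp; first exact: measurable_continuous_row.
  exact: measurable_tcons.
by exists M; split; [exact: num_real|move=> r Mr x _; exact: le_trans (gM _) (ltW Mr)].
Qed.

Lemma torus_int_prod d (g : 'rV[R]_d.+1 -> R) (M : R) :
  continuous g -> (forall x, `|g x| <= M) ->
  torus_int g = fine (\int[pm \x torus_measure d]_p
    (g (consrow (p.1 : R) (row_of_tuple p.2)))%:E)%E.
Proof.
move=> cg gM; rewrite /torus_int /Rintegral; congr fine.
rewrite (@integral_pushforward _ _ _ _ _ _ (@measurable_tcons _ _ d)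
  (pm \x torus_measure d)%E setT (EFin \o (g \o @row_of_tuple R d.+1)))//.
- by rewrite preimage_setT; apply: eq_integral => -[x t] _ /=; rewrite row_of_tuple_tcons.
- by apply/measurable_EFinP; exact: measurable_continuous_row.
- by rewrite preimage_setT; exact: consrow_comp_integrable gM.
Qed.

Lemma consrow_integrable d (g : 'rV[R]_d.+1 -> R) (M : R) :
  continuous g -> (forall x, `|g x| <= M) ->
  (pm \x torus_measure d)%E.-integrable setT
    (fun p => (g (consrow (p.1 : R) (row_of_tuple p.2)))%:E).
Proof.
move=> cg gM; apply: eq_integrable (consrow_comp_integrable cg gM) => // -[x t] _ /=.
by rewrite row_of_tuple_tcons.
Qed.

Lemma torus_int_consl d (g : 'rV[R]_d.+1 -> R) (M : R) :
  continuous g -> (forall x, `|g x| <= M) ->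
  torus_int g = \int[pm]_x torus_int (fun y => g (consrow x y)).
Proof.
move=> cg gM; rewrite (torus_int_prod cg gM).
rewrite -(integral12_prod_meas1 (consrow_integrable cg gM)) /Rintegral; congr fine.
apply: eq_integral => x _; rewrite /fubini_F/= fineK//.
apply: integrable_fin_num => //.
by apply: (@bounded_torus_integrable _ _ (g \o consrow x) M) => [|y];
  [exact: continuous_consrowr|exact: gM].
Qed.

Lemma torus_int_consr d (g : 'rV[R]_d.+1 -> R) (M : R) :
  continuous g -> (forall x, `|g x| <= M) ->
  torus_int g = torus_int (fun y => \int[pm]_x g (consrow x y)).
Proof.
move=> cg gM; rewrite (torus_int_prod cg gM).
rewrite -(integral21_prod_meas1 (consrow_integrable cg gM)) /torus_int /Rintegral; congr fine.
apply: eq_integral => x _; rewrite /fubini_G/= fineK//.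
apply: integrable_fin_num => //.
apply: (@bounded_period_integrable (g \o (fun y => consrow y (row_of_tuple x))) M) => [|y];
  last exact: gM.
exact: continuous_consrowl.
Qed.

(** A directional derivative depends only on the increments along the
    direction. This is how derivatives pass to slices, to translates and to the
    two factors of space-time. *)
Lemma eq_derive_at (V V' W : normedModType R) (g : V -> W) (h : V' -> W) v x w y :
  (forall t : R, g (t *: v + x) - g x = h (t *: w + y) - h y) ->
  'D_v g x = 'D_w h y.
Proof.
move=> gh; rewrite /derive.
by have -> : (fun t : R => t^-1 *: ((g \o shift x) (t *: v) - g x)) =
  (fun t : R => t^-1 *: ((h \o shift y) (t *: w) - h y)) by apply/funext => t /=; rewrite gh.
Qed.

Lemma eq_derivable_at (V V' W : normedModType R) (g : V -> W) (h : V' -> W) v x w y :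
  (forall t : R, g (t *: v + x) - g x = h (t *: w + y) - h y) ->
  derivable g x v -> derivable h y w.
Proof.
move=> gh; rewrite /derivable.
by have -> : (fun t : R => t^-1 *: ((g \o shift x) (t *: v) - g x)) =
  (fun t : R => t^-1 *: ((h \o shift y) (t *: w) - h y)) by apply/funext => t /=; rewrite gh.
Qed.

Lemma periodic_derive d (W : normedModType R) (g : 'rV[R]_d -> W) v :
  space_periodic g -> space_periodic ('D_v g).
Proof.
by move=> pg x i; apply: eq_derive_at => t; rewrite addrA !pg.
Qed.

(** By induction on the dimension: Fubini isolates the coordinate of
    differentiation, and over one period the integral of a derivative is the
    difference of two equal values. *)
Lemma torus_int_partial d (g : 'rV[R]_d -> R) i : space_periodic g ->
  (forall x, derivable g x (delta_mx 0 i)) -> continuous (partial i g) ->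
  torus_int (partial i g) = 0.
Proof.
elim: d g i => [|d IH] g i; first by case: i.
move=> pg dg cg.
have [M M0 gM] : exists2 M : R, 0 < M & forall x, `|partial i g x| <= M.
  apply: cperiodic_bounded; split=> //; exact: periodic_derive.
case: (unliftP ord0 i) => [j ij|ij]; last first.
  rewrite (torus_int_consr cg gM) (@eq_torus_int _ _ _ (fun=> 0)) ?torus_int0// => y.
  pose h x := g (consrow x y).
  have hE x t : h (t *: 1 + x) = g (t *: delta_mx 0 ord0 + consrow x y).
    by rewrite /h consrow_delta0 -consrowZ scaler0 -consrowD add0r.
  have dh x : derivable h x 1.
    by apply: eq_derivable_at (dg (consrow x y)) => t; rewrite hE -ij.
  have h'E x : derive1 h x = partial i g (consrow x y).
    by rewrite derive1E /partial ij; apply: eq_derive_at => t; rewrite hE.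
  apply: (@etrans _ _ (\int[pm]_x (derive1 h x))).
    by apply: eq_Rintegral => x _; rewrite h'E.
  apply: (@period_int_derive h M) => [x|||].
  - exact: dh.
  - rewrite (_ : derive1 h = partial i g \o (fun x => consrow x y)); last exact/funext.
    exact: continuous_consrowl.
  - by move=> x; rewrite h'E.
  - by rewrite /h -[RHS](pg _ ord0) consrow_delta0 -consrowZ -consrowD !(mulr1, scaler0, add0r, addr0).
rewrite (torus_int_consl cg gM).
rewrite (@eq_Rintegral _ _ _ _ _ (fun=> 0)) ?Rintegral_cst ?mul0r// => x _.
have hE y z t : g (consrow x (t *: z + y)) = g (t *: consrow 0 z + consrow x y).
  by rewrite -consrowZ mulr0 -consrowD add0r.
have h'E y : partial j (g \o consrow x) y = partial i g (consrow x y).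
  by rewrite /partial ij consrow_deltaS; apply: eq_derive_at => t /=; rewrite hE.
apply: (@etrans _ _ (torus_int (partial j (g \o consrow x)))).
  by apply: eq_torus_int => y; rewrite h'E.
apply: IH.
- by move=> y k /=; rewrite -[RHS](pg _ (lift ord0 k)) consrow_deltaS -consrowZ -consrowD mulr0 addr0.
- move=> y; apply: eq_derivable_at (dg (consrow x y)) => t /=; rewrite hE ij.
  by rewrite consrow_deltaS.
- rewrite (_ : partial j (g \o consrow x) = partial i g \o consrow x); last exact/funext.
  exact: continuous_consrowr.
Qed.

End iterated.

(** * Torus integrals depending on time *)

Section time_dependence.
Context {R : realType}.
Implicit Types (T t : R).

(** Joint continuity gives bounds that are uniform in space on compact time
    intervals, which is what differentiation under the integral asks for. *)
Definition cperiodic_on d T (G : R -> 'rV[R]_d -> R) :=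
  (forall t, 0 < t < T -> space_periodic (G t)) /\
  (forall z : R * 'rV[R]_d, 0 < z.1 < T -> {for z, continuous (fun z => G z.1 z.2)}).

Lemma cperiodic_on_slice d T (G : R -> 'rV[R]_d -> R) t : cperiodic_on T G -> 0 < t < T ->
  cperiodic (G t).
Proof.
move=> [pG cG] tT; split; last exact: pG.
move=> x; apply: (@continuous_comp _ _ _ (fun y => (t, y)) (fun z => G z.1 z.2)).
  exact: (cvg_pair (@cvg_cst _ t _ (nbhs x) _) (@cvg_id _ (nbhs x))).
exact: cG.
Qed.

Lemma cperiodic_on_time d T (G : R -> 'rV[R]_d -> R) t x : cperiodic_on T G -> 0 < t < T ->
  {for t, continuous (fun s => G s x)}.
Proof.
move=> [pG cG] tT; apply: (@continuous_comp _ _ _ (fun s : R => (s, x)) (fun z => G z.1 z.2)).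
  exact: (cvg_pair (@cvg_id _ (nbhs t)) (@cvg_cst _ x _ (nbhs t) _)).
exact: cG.
Qed.

Lemma cperiodic_on_bounded d T (G : R -> 'rV[R]_d -> R) a b : cperiodic_on T G -> 0 < a -> b < T ->
  exists2 M : R, 0 < M & forall s x, a <= s <= b -> `|G s x| <= M.
Proof.
move=> [pG cG] a0 bT.
pose K := `[a, b]%classic `*` [set y : 'rV[R]_d | forall i, 0 <= y 0 i <= 2 * pi].
have cK : {within K, continuous (fun z => G z.1 z.2)}.
  apply: continuous_in_subspaceT => z /set_mem[/=]; rewrite in_itv/= => /andP[az zb] _.
  by apply: cG; rewrite (lt_le_trans a0)//= (le_lt_trans zb).
have /compact_bounded[M [_ HM]] := continuous_compact cK
  (compact_setX (@segment_compact _ a b) (@box_compact R d 0 (2 * pi))).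
exists (`|M| + 1) => [|s x sab]; first by rewrite ltr_pwDr.
have sT : 0 < s < T by case/andP: sab => ? ?; rewrite (lt_le_trans a0)//= (le_lt_trans _ bT).
have [y yb /(_ _ (G s))->] := periodic_box x; last exact: pG.
apply: (HM (`|M| + 1) _ (G s y)); first by rewrite (le_lt_trans (ler_norm _))// ltrDl.
by exists (s, y).
Qed.

Let sub_interval T t : 0 < t < T -> exists a b, [/\ 0 < a, b < T, a < t & t < b].
Proof.
by move=> /andP[t0 tT]; exists (t / 2), ((t + T) / 2); split; lra.
Qed.

Lemma torus_int_time_continuous d T (G : R -> 'rV[R]_d -> R) t : cperiodic_on T G -> 0 < t < T ->
  {for t, continuous (fun s => torus_int (G s))}.
Proof.
move=> tG tT; have [a [b [a0 bT ta tb]]] := sub_interval tT.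
have [M M0 GM] := cperiodic_on_bounded tG a0 bT.
have sub s : s \in `]a, b[ -> 0 < s < T.
  by rewrite in_itv/= => /andP[as_ sb]; rewrite (lt_trans a0)//= (lt_trans sb).
apply: (@continuity_under_integral _ _ _ (torus_measure d)
  (fun s x => G s (row_of_tuple x)) setT measurableT a b _ _ (fun=> M)).
- by move=> s /sub sT; exact: cperiodic_integrable (cperiodic_on_slice tG sT).
- by apply/aeW => y _ s; rewrite inE/= => /sub sT; exact: cperiodic_on_time tG sT.
- exact: (@cperiodic_integrable R d (fun=> M) (cperiodic_cst _ _)).
- move=> s; rewrite /= in_itv/= => /andP[as_ sb]; apply/aeW => y _.
  by apply: GM; rewrite !ltW.
- by rewrite inE/= in_itv/= ta.
Qed.

Lemma torus_int_time_derive d T (G G' : R -> 'rV[R]_d -> R) t :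
  cperiodic_on T G -> cperiodic_on T G' ->
  (forall s x, 0 < s < T -> is_derive s 1 (fun r => G r x) (G' s x)) -> 0 < t < T ->
  is_derive t 1 (fun s => torus_int (G s)) (torus_int (G' t)).
Proof.
move=> tG tG' dG tT; have [a [b [a0 bT ta tb]]] := sub_interval tT.
have [M M0 GM] := cperiodic_on_bounded tG' a0 bT.
have sub s : s \in `]a, b[ -> 0 < s < T.
  by rewrite in_itv/= => /andP[as_ sb]; rewrite (lt_trans a0)//= (lt_trans sb).
have tab : `]a, b[%classic t by rewrite /= in_itv/= ta.
have H1 s : `]a, b[%classic s ->
    (torus_measure d).-integrable setT (EFin \o (fun x => G s (row_of_tuple x))).
  by move=> /sub sT; exact: cperiodic_integrable (cperiodic_on_slice tG sT).
have H2 s (x : d.-tuple (measurableTypeR R)) : `]a, b[%classic s -> setT x ->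
    derivable (fun r => G r (row_of_tuple x)) s 1.
  by move=> /sub sT _; exact: (@ex_derive _ _ _ _ _ _ _ (dG s (row_of_tuple x) sT)).
have H3 (x : d.-tuple (measurableTypeR R)) : 0 <= (fun=> M) x by exact: ltW.
have H4 : (torus_measure d).-integrable setT (EFin \o (fun=> M)).
  exact: (@cperiodic_integrable R d (fun=> M) (cperiodic_cst _ _)).
have H5 s (x : d.-tuple (measurableTypeR R)) : `]a, b[%classic s -> setT x ->
    `|partial1of2 (fun s x => G s (row_of_tuple x)) s x| <= (fun=> M) x.
  move=> sab _; have sT := sub _ sab.
  rewrite partial1of2E (@derive_val _ _ _ _ _ _ _ (dG s (row_of_tuple x) sT)).
  by apply: GM; move: sab; rewrite /= in_itv/= => /andP[/ltW-> /ltW->].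
have D := derivable_under_integral measurableT tab H1 H2 H3 H4 H5.
have D' := differentiation_under_integral measurableT tab H1 H2 H3 H4 H5.
apply: DeriveDef; first exact: D.
rewrite -derive1E [LHS]D'.
apply: eq_Rintegral => x _.
by rewrite /= partial1of2E (@derive_val _ _ _ _ _ _ _ (dG t (row_of_tuple x) tT)).
Qed.

Lemma cperiodic_onD d T (G H : R -> 'rV[R]_d -> R) :
  cperiodic_on T G -> cperiodic_on T H -> cperiodic_on T (fun t x => G t x + H t x).
Proof.
move=> [pG cG] [pH cH]; split=> [t tT x i|z zT]; first by rewrite pG ?pH.
exact: cvgD (cG z zT) (cH z zT).
Qed.

Lemma cperiodic_onM d T (G H : R -> 'rV[R]_d -> R) :
  cperiodic_on T G -> cperiodic_on T H -> cperiodic_on T (fun t x => G t x * H t x).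
Proof.
move=> [pG cG] [pH cH]; split=> [t tT x i|z zT]; first by rewrite pG ?pH.
exact: cvgM (cG z zT) (cH z zT).
Qed.

Lemma cperiodic_on_cst d T (g : 'rV[R]_d -> R) : cperiodic g -> cperiodic_on T (fun=> g).
Proof.
move=> [cg pg]; split=> // z zT.
by apply: (@continuous_comp _ _ _ snd g); [exact: cvg_snd|exact: cg].
Qed.

Lemma eq_cperiodic_on d T (G H : R -> 'rV[R]_d -> R) :
  (forall t x, H t x = G t x) -> cperiodic_on T H -> cperiodic_on T G.
Proof. by move=> HG; have -> : G = H by apply/funext => t; apply/funext. Qed.

Lemma cperiodic_on_sum d T I (r : seq I) (G : I -> R -> 'rV[R]_d -> R) :
  (forall i, cperiodic_on T (G i)) -> cperiodic_on T (fun t x => \sum_(i <- r) G i t x).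
Proof.
move=> cG; elim: r => [|i r IH].
  apply: (@eq_cperiodic_on _ _ _ (fun _ _ => 0)) => [t x|]; first by rewrite big_nil.
  exact: cperiodic_on_cst (cperiodic_cst _ _).
apply: (@eq_cperiodic_on _ _ _ (fun t x => G i t x + \sum_(i <- r) G i t x)) => [t x|].
  by rewrite big_cons.
exact: cperiodic_onD.
Qed.

End time_dependence.

(** * Trigonometric functions on the torus *)

Lemma cvg_sumr (R : realType) (X : Type) (F : set_system X) {FF : Filter F} I (r : seq I)
    (f : I -> X -> R) (l : I -> R) :
  (forall i, f i x @[x --> F] --> l i) ->
  \sum_(i <- r) f i x @[x --> F] --> \sum_(i <- r) l i.
Proof.
move=> fl; elim: r => [|i r IH].
  rewrite big_nil (_ : (fun x => \sum_(i <- [::]) f i x) = cst 0); first exact: cvg_cst.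
  by apply/funext => x; rewrite big_nil.
rewrite big_cons (_ : (fun x => \sum_(i <- i :: r) f i x) =
  (fun x => f i x + \sum_(i <- r) f i x)); first exact: cvgD.
by apply/funext => x; rewrite big_cons.
Qed.

Section modes.
Context {R : realType} {d : nat}.
Implicit Types (g h : 'rV[R]_d -> R) (k l : 'rV[int]_d) (x : 'rV[R]_d) (i : 'I_d).

Definition cosk k x := cos (phase k x).
Definition sink k x := sin (phase k x).

Lemma phaseD k x y : phase k (x + y) = phase k x + phase k y.
Proof. by rewrite /phase -big_split; apply: eq_bigr => i _; rewrite [(x + y) 0 i]mxE mulrDr. Qed.

Lemma phaseZ k a x : phase k (a *: x) = a * phase k x.
Proof. by rewrite /phase mulr_sumr; apply: eq_bigr => i _; rewrite [(a *: x) 0 i]mxE mulrCA. Qed.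

Lemma phaseDk k l x : phase (k + l) x = phase k x + phase l x.
Proof. by rewrite /phase -big_split; apply: eq_bigr => i _; rewrite !mxE intrD mulrDl. Qed.

Lemma phaseNk k x : phase (- k) x = - phase k x.
Proof. by rewrite /phase -sumrN; apply: eq_bigr => i _; rewrite !mxE intrN mulNr. Qed.

Lemma phase0k x : phase 0 x = 0.
Proof. by rewrite /phase big1// => i _; rewrite !mxE mul0r. Qed.

Lemma phase_delta k i : phase k (delta_mx 0 i : 'rV[R]_d) = (k 0 i)%:~R.
Proof.
rewrite /phase (bigD1 i)//= big1 => [|j ji]; last first.
  by rewrite !mxE eqxx (negbTE ji) mulr0.
by rewrite !mxE !eqxx mulr1 addr0.
Qed.

Lemma phase_deltak i x : phase (delta_mx 0 i) x = x 0 i.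
Proof.
rewrite /phase (bigD1 i)//= big1 => [|j ji]; last first.
  by rewrite !mxE eqxx (negbTE ji) mul0r.
by rewrite !mxE !eqxx mul1r addr0.
Qed.

Lemma continuous_phase k : continuous (phase k : 'rV[R]_d -> R).
Proof.
move=> x; apply: (@cvg_sumr R _ (nbhs x) (nbhs_filter x) _ _
  (fun i (y : 'rV[R]_d) => frequency k 0 i * y 0 i)) => i.
by apply: cvgM; [exact: cvg_cst|exact: coord_continuous].
Qed.

Lemma sincosD2piz (r : R) (n : int) :
  sin (r + 2 * pi * n%:~R) = sin r /\ cos (r + 2 * pi * n%:~R) = cos r.
Proof.
have E (m : nat) (s : R) : s + 2 * pi * m%:R = s + (pi *+ 2) *+ m.
  by rewrite mulr_natl mulr_natr.
case: n => m.
  by rewrite -pmulrn E (periodicn (@sinD2pi R)) (periodicn (@cosD2pi R)).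
rewrite NegzE mulrNz -pmulrn mulrN.
by split; [rewrite -[in RHS](subrK (2 * pi * m.+1%:R) r) E (periodicn (@sinD2pi R))
  |rewrite -[in RHS](subrK (2 * pi * m.+1%:R) r) E (periodicn (@cosD2pi R))].
Qed.

Lemma cperiodic_cosk k : cperiodic (cosk k).
Proof.
split=> [x|x i].
  by apply: (@continuous_comp _ _ _ (phase k) cos); [exact: continuous_phase|exact: continuous_cos].
by rewrite /cosk phaseD phaseZ phase_delta (sincosD2piz _ _).2.
Qed.

Lemma cperiodic_sink k : cperiodic (sink k).
Proof.
split=> [x|x i].
  by apply: (@continuous_comp _ _ _ (phase k) sin); [exact: continuous_phase|exact: continuous_sin].
by rewrite /sink phaseD phaseZ phase_delta (sincosD2piz _ _).1.
Qed.

(** Reduces derivatives of explicit functions of several variables to the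
    inference of one-variable derivatives. *)
Lemma is_derive_line (W : normedModType R) (g : 'rV[R]_d -> W) x v dg :
  is_derive (0 : R) 1 (fun t : R => g (x + t *: v)) dg -> is_derive x v g dg.
Proof.
move=> H.
have E (t : R) : g (x + (t *: (1 : R) + 0) *: v) - g (x + 0 *: v) = g (t *: v + x) - g x.
  have -> : t *: (1 : R) + 0 = t by rewrite addr0; exact: mulr1.
  by rewrite scale0r addr0 (addrC x).
have E1 := @eq_derive_at R _ _ W (fun t : R => g (x + t *: v)) g 1 0 v x E.
have E2 := @eq_derivable_at R _ _ W (fun t : R => g (x + t *: v)) g 1 0 v x E.
apply: DeriveDef; first by apply: E2; exact: ex_derive.
by rewrite -E1; exact: derive_val.
Qed.

Lemma is_derive_cosk k x i :
  is_derive x (delta_mx 0 i) (cosk k) (- ((k 0 i)%:~R * sink k x)).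
Proof.
apply: is_derive_line; rewrite /cosk.
have -> : (fun t : R => cos (phase k (x + t *: delta_mx 0 i))) =
    (fun t => cos (phase k x + t * (k 0 i)%:~R)).
  by apply/funext => t; rewrite phaseD phaseZ phase_delta.
apply: is_derive_eq.
by rewrite /sink !(mul0r, addr0, scaler0, add0r) /GRing.scale/= mul1r mulr1 mulNr mulrC.
Qed.

Lemma is_derive_sink k x i :
  is_derive x (delta_mx 0 i) (sink k) ((k 0 i)%:~R * cosk k x).
Proof.
apply: is_derive_line; rewrite /sink.
have -> : (fun t : R => sin (phase k (x + t *: delta_mx 0 i))) =
    (fun t => sin (phase k x + t * (k 0 i)%:~R)).
  by apply/funext => t; rewrite phaseD phaseZ phase_delta.
apply: is_derive_eq.
by rewrite /cosk !(mul0r, addr0, scaler0, add0r) /GRing.scale/= mul1r mulr1 mulrC.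
Qed.

End modes.

(** * Partial derivatives and Fourier coefficients *)

Section coefficients.
Context {R : realType} {d : nat}.
Implicit Types (g h : 'rV[R]_d -> R) (k l : 'rV[int]_d) (x : 'rV[R]_d) (i : 'I_d).

(** The derivative is carried along as a function, so that sums, products and
    integration by parts compose without further regularity conditions. *)
Definition pderiv i g g' :=
  [/\ cperiodic g, cperiodic g' & forall x, is_derive x (delta_mx 0 i) g (g' x)].

Lemma pderiv_cosk k i : pderiv i (cosk k) (fun x => - ((k 0 i)%:~R * sink k x)).
Proof.
by split; [exact: cperiodic_cosk|exact/cperiodicN/cperiodicZ/cperiodic_sink|move=> x;
  exact: is_derive_cosk].
Qed.

Lemma pderiv_sink k i : pderiv i (sink k) (fun x => (k 0 i)%:~R * cosk k x).
Proof.
by split; [exact: cperiodic_sink|exact/cperiodicZ/cperiodic_cosk|move=> x; exact: is_derive_sink].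
Qed.

Lemma pderivM i g g' h h' : pderiv i g g' -> pderiv i h h' ->
  pderiv i (fun x => g x * h x) (fun x => g' x * h x + g x * h' x).
Proof.
move=> [cg cg' dg] [ch ch' dh]; split; [exact: cperiodicM|by apply: cperiodicD;
  apply: cperiodicM|move=> x].
have := is_deriveM (dg x) (dh x).
by move=> /is_derive_eq; apply; rewrite addrC; congr (_ + _); rewrite /GRing.scale/= mulrC.
Qed.

Lemma pderivD i g g' h h' : pderiv i g g' -> pderiv i h h' ->
  pderiv i (fun x => g x + h x) (fun x => g' x + h' x).
Proof.
move=> [cg cg' dg] [ch ch' dh]; split; [exact: cperiodicD|exact: cperiodicD|move=> x].
exact: is_deriveD (dg x) (dh x).
Qed.

Lemma torus_int_pderiv i g g' : pderiv i g g' -> torus_int g' = 0.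
Proof.
move=> [cg cg' dg]; have E : partial i g = g'.
  by apply/funext => x; rewrite /partial; exact: (@derive_val _ _ _ _ _ _ _ (dg x)).
rewrite -E; apply: torus_int_partial; first exact: (proj2 cg).
  by move=> x; exact: (@ex_derive _ _ _ _ _ _ _ (dg x)).
by rewrite E; exact: (proj1 cg').
Qed.

Lemma torus_int_ibp i g g' h h' : pderiv i g g' -> pderiv i h h' ->
  torus_int (fun x => g' x * h x) = - torus_int (fun x => g x * h' x).
Proof.
move=> Dg Dh; have := torus_int_pderiv (pderivM Dg Dh).
case: Dg Dh => cg cg' _ [ch ch' _].
by rewrite torus_intD; [move/eqP; rewrite addr_eq0 => /eqP|exact: cperiodicM..].
Qed.

Definition Ccoef g k := torus_int (fun x => g x * cosk k x).
Definition Scoef g k := torus_int (fun x => g x * sink k x).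

Lemma Ccoef_pderiv i g g' k : pderiv i g g' -> Ccoef g' k = (k 0 i)%:~R * Scoef g k.
Proof.
move=> Dg; rewrite /Ccoef (torus_int_ibp Dg (pderiv_cosk k i)).
case: Dg => cg _ _; rewrite /Scoef -torus_intZ -?torus_intN; last 2 first.
- by apply: cperiodicM => //; exact/cperiodicN/cperiodicZ/cperiodic_sink.
- by apply: cperiodicM => //; exact: cperiodic_sink.
by apply: eq_torus_int => x; rewrite mulrN opprK mulrCA.
Qed.

Lemma Scoef_pderiv i g g' k : pderiv i g g' -> Scoef g' k = - ((k 0 i)%:~R * Ccoef g k).
Proof.
move=> Dg; rewrite /Scoef (torus_int_ibp Dg (pderiv_sink k i)).
case: Dg => cg _ _; rewrite /Ccoef -torus_intZ; last by apply: cperiodicM => //; exact: cperiodic_cosk.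
by congr (- _); apply: eq_torus_int => x; rewrite mulrCA.
Qed.

(** The integrand is a derivative in any direction in which [k] does not vanish. *)
Lemma torus_int_cosk k : k != 0 -> torus_int (@cosk R d k) = 0.
Proof.
move=> /rV0Pn[i ki].
have := torus_int_pderiv (pderiv_sink k i); rewrite torus_intZ; last exact: cperiodic_cosk.
by move/eqP; rewrite mulf_eq0 intr_eq0 (negbTE ki)/= => /eqP.
Qed.

Lemma torus_int_sink k : torus_int (@sink R d k) = 0.
Proof.
have [->|/rV0Pn[i ki]] := eqVneq k 0.
  by rewrite -(torus_int0 d); apply: eq_torus_int => x; rewrite /sink phase0k sin0.
have := torus_int_pderiv (pderiv_cosk k i); rewrite torus_intN ?torus_intZ.
- by move/eqP; rewrite oppr_eq0 mulf_eq0 intr_eq0 (negbTE ki)/= => /eqP.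
- exact: cperiodic_sink.
- exact/cperiodicZ/cperiodic_sink.
Qed.

End coefficients.

Section volume.
Context {R : realType}.

Definition vol d : R := (2 * pi) ^+ d.

Lemma vol_gt0 d : 0 < vol d.
Proof. by rewrite exprn_gt0// pi2_gt0. Qed.

Lemma torus_int_cst d (c : R) : torus_int (fun _ : 'rV[R]_d => c) = c * vol d.
Proof.
elim: d => [|d IH].
  rewrite /torus_int Rintegral_cst//= /vol expr0.
  by rewrite /dirac indicE mem_set.
rewrite (@torus_int_consl _ _ _ `|c|)//; last exact: cst_continuous.
rewrite (@eq_Rintegral _ _ _ _ _ (fun=> c * vol d)) => [|x _]; last exact: IH.
rewrite Rintegral_cst// /vol exprS -mulrA; congr (_ * _); rewrite mulrC; congr (_ * _).
apply: (@etrans _ _ (fine (lebesgue_measure ([set: R] `&` `[0, 2 * pi]%classic)))) => //.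
rewrite setTI lebesgue_measure_itv/= lte_fin pi2_gt0.
by rewrite oppr0 addr0.
Qed.

End volume.

(** * Energy forms *)

Section forms.
Context {R : realType} {d : nat}.
Implicit Types (g h : 'rV[R]_d -> R) (k l : 'rV[int]_d) (B : ('rV[R]_d -> R) -> ('rV[R]_d -> R) -> R).

(** What an energy balance uses of a bilinear form. The L2 product and its
    Littlewood-Paley truncations share these properties, so that the balance is
    derived once for all of them. *)
Record energy_form B : Prop := EnergyForm {
  ef_sym : forall g h, B g h = B h g ;
  ef_lin : forall a g g' h, cperiodic g -> cperiodic g' -> cperiodic h ->
    B (fun x => a * g x + g' x) h = a * B g h + B g' h ;
  ef_skew : forall i g g' h h', pderiv i g g' -> pderiv i h h' -> B g' h = - B g h' ;
  ef_deriv : forall T (G G' : R -> 'rV[R]_d -> R) t, cperiodic_on T G -> cperiodic_on T G' ->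
    (forall s x, 0 < s < T -> is_derive s 1 (fun r => G r x) (G' s x)) -> 0 < t < T ->
    is_derive t 1 (fun s => B (G s) (G s)) (2 * B (G' t) (G t)) ;
  ef_cont : forall T (G H : R -> 'rV[R]_d -> R) t, cperiodic_on T G -> cperiodic_on T H -> 0 < t < T ->
    {for t, continuous (fun s => B (G s) (H s))} }.

Definition L2form g h := torus_int (fun x => g x * h x).

(** Up to a constant factor, the real part of the k-th Fourier coefficient of g
    times the conjugate of that of h. *)
Definition mode_form k g h := Ccoef g k * Ccoef h k + Scoef g k * Scoef h k.

Lemma L2form_energy_form : energy_form L2form.
Proof.
split=> [g h|a g g' h cg cg' ch|i g g' h h'|T G G' t tG tG' dG tT|T G H t tG tH tT].
- by apply: eq_torus_int => x; rewrite mulrC.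
- have c1 := cperiodicM cg ch; have c2 := cperiodicM cg' ch.
  rewrite /L2form -torus_intZ// -torus_intD//; last exact: cperiodicZ.
  by apply: eq_torus_int => x; rewrite mulrDl mulrA.
- exact: torus_int_ibp.
- have := @torus_int_time_derive R d T (fun t x => G t x * G t x)
    (fun t x => 2 * (G' t x * G t x)) t (cperiodic_onM tG tG)
    (cperiodic_onM (cperiodic_on_cst T (cperiodic_cst d 2)) (cperiodic_onM tG' tG)) _ tT.
  rewrite torus_intZ; last by apply: cperiodicM; exact: cperiodic_on_slice tT.
  apply => s x sT; have := is_deriveM (dG s x sT) (dG s x sT).
  by move=> /is_derive_eq; apply; rewrite /GRing.scale/= mulrC -mulr2n mulr_natl.
- exact: torus_int_time_continuous (cperiodic_onM tG tH) tT.
Qed.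

Lemma Ccoef_lin a g g' k : cperiodic g -> cperiodic g' ->
  Ccoef (fun x => a * g x + g' x) k = a * Ccoef g k + Ccoef g' k.
Proof. by move=> cg cg'; apply: (ef_lin L2form_energy_form) => //; exact: cperiodic_cosk. Qed.

Lemma Scoef_lin a g g' k : cperiodic g -> cperiodic g' ->
  Scoef (fun x => a * g x + g' x) k = a * Scoef g k + Scoef g' k.
Proof. by move=> cg cg'; apply: (ef_lin L2form_energy_form) => //; exact: cperiodic_sink. Qed.

Lemma mode_form_energy_form k : energy_form (mode_form k).
Proof.
have dcoef (w : 'rV[R]_d -> R) T (G G' : R -> 'rV[R]_d -> R) t : cperiodic w -> cperiodic_on T G ->
  cperiodic_on T G' ->
    (forall s x, 0 < s < T -> is_derive s 1 (fun r => G r x) (G' s x)) -> 0 < t < T ->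
    is_derive t 1 (fun s => L2form (G s) w) (L2form (G' t) w).
  move=> cw tG tG' dG tT.
  apply: (@torus_int_time_derive R d T (fun t x => G t x * w x) (fun t x => G' t x * w x)) => //.
  - exact: cperiodic_onM (cperiodic_on_cst T cw).
  - exact: cperiodic_onM (cperiodic_on_cst T cw).
  - move=> s x sT; have := is_deriveM (dG s x sT) (is_derive_cst (w x) s 1).
    by move=> /is_derive_eq; apply; rewrite scaler0 add0r /GRing.scale/= mulrC.
have ccoef (w : 'rV[R]_d -> R) T (G : R -> 'rV[R]_d -> R) t : cperiodic w -> cperiodic_on T G ->
  0 < t < T ->
    {for t, continuous (fun s => L2form (G s) w)}.
  by move=> cw tG; apply: torus_int_time_continuous; exact: cperiodic_onM tG (cperiodic_on_cst T cw).
split=> [g h|a g g' h cg cg' ch|i g g' h h'|T G G' t tG tG' dG tT|T G H t tG tH tT].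
- by rewrite /mode_form; congr (_ + _); rewrite mulrC.
- by rewrite /mode_form Ccoef_lin// Scoef_lin//; ring.
- move=> Dg Dh; rewrite /mode_form (Ccoef_pderiv _ Dg) (Scoef_pderiv _ Dg).
  by rewrite (Ccoef_pderiv _ Dh) (Scoef_pderiv _ Dh); ring.
- have D1 := dcoef _ T G G' t (cperiodic_cosk k) tG tG' dG tT.
  have D2 := dcoef _ T G G' t (cperiodic_sink k) tG tG' dG tT.
  have := is_deriveD (is_deriveM D1 D1) (is_deriveM D2 D2).
  by move=> /is_derive_eq; apply; rewrite /GRing.scale/= /mode_form /Ccoef /Scoef /L2form; ring.
- apply: cvgD; apply: cvgM.
  + exact: ccoef (cperiodic_cosk k) tG tT.
  + exact: ccoef (cperiodic_cosk k) tH tT.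
  + exact: ccoef (cperiodic_sink k) tG tT.
  + exact: ccoef (cperiodic_sink k) tH tT.
Qed.

Lemma sum_energy_form I (s : seq I) (c : I -> R) (B : I -> _) :
  (forall i, energy_form (B i)) -> energy_form (fun g h => \sum_(i <- s) c i * B i g h).
Proof.
move=> EB; split=> [g h|a g g' h cg cg' ch|j g g' h h' Dg Dh|T G G' t tG tG' dG tT|T G H t tG tH tT].
- by apply: eq_bigr => i _; rewrite (ef_sym (EB i)).
- rewrite mulr_sumr -big_split/=; apply: eq_bigr => i _.
  by rewrite (ef_lin (EB i))//; ring.
- by rewrite -sumrN; apply: eq_bigr => i _; rewrite (ef_skew (EB i) Dg Dh) mulrN.
- elim: s => [|i s IH].
    rewrite big_nil mulr0 (_ : (fun _ => _) = cst 0); last by apply/funext => r; rewrite big_nil.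
    exact: is_derive_cst.
  have := is_deriveD (is_deriveZ (c i) (ef_deriv (EB i) tG tG' dG tT)) IH.
  rewrite (_ : (fun r => \sum_(j <- i :: s) c j * B j (G r) (G r)) =
    (fun r => c i *: B i (G r) (G r)) + (fun r => \sum_(j <- s) c j * B j (G r) (G r))).
    by move=> /is_derive_eq; apply; rewrite big_cons mulrDr /GRing.scale/=; congr (_ + _);
      rewrite mulrCA.
  by apply/funext => r; rewrite big_cons.
- apply: cvg_sumr => i; apply: cvgM; first exact: cvg_cst.
  exact: (ef_cont (EB i) tG tH tT).
Qed.

End forms.

(** * Fourier truncation and Bessel's inequality *)

Section truncation.
Context {R : realType} {d : nat}.
Implicit Types (g h : 'rV[R]_d -> R) (k l : 'rV[int]_d).

Lemma cosk_mul k l (x : 'rV[R]_d) :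
  cosk k x * cosk l x = 2^-1 * cosk (k - l) x + 2^-1 * cosk (k + l) x.
Proof. by rewrite /cosk !phaseDk phaseNk cosB cosD; field. Qed.

Lemma sink_mul k l (x : 'rV[R]_d) :
  sink k x * sink l x = 2^-1 * cosk (k - l) x - 2^-1 * cosk (k + l) x.
Proof. by rewrite /cosk /sink !phaseDk phaseNk cosB cosD; field. Qed.

Lemma sink_cosk k l (x : 'rV[R]_d) :
  sink k x * cosk l x = 2^-1 * sink (k - l) x + 2^-1 * sink (k + l) x.
Proof. by rewrite /cosk /sink !phaseDk phaseNk sinB sinD; field. Qed.

Lemma torus_int_coskE k : torus_int (@cosk R d k) = vol d * (k == 0)%:R.
Proof.
have [->|k0] := eqVneq k 0; last by rewrite torus_int_cosk// mulr0.
rewrite mulr1 -[RHS]mul1r -torus_int_cst; apply: eq_torus_int => x.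
by rewrite /cosk phase0k cos0.
Qed.

Lemma Ccoef_cosk k l :
  Ccoef (@cosk R d k) l = vol d / 2 * ((k == l)%:R + (k == - l)%:R).
Proof.
rewrite /Ccoef (eq_torus_int (cosk_mul k l)) torus_intD; try exact/cperiodicZ/cperiodic_cosk.
rewrite !torus_intZ; try exact: cperiodic_cosk.
by rewrite !torus_int_coskE subr_eq0 addr_eq0; field.
Qed.

Lemma Scoef_sink k l :
  Scoef (@sink R d k) l = vol d / 2 * ((k == l)%:R - (k == - l)%:R).
Proof.
rewrite /Scoef (eq_torus_int (sink_mul k l)) torus_intB; try exact/cperiodicZ/cperiodic_cosk.
rewrite !torus_intZ; try exact: cperiodic_cosk.
by rewrite !torus_int_coskE subr_eq0 addr_eq0; field.
Qed.

Lemma Ccoef_sink k l : Ccoef (@sink R d k) l = 0.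
Proof.
rewrite /Ccoef (eq_torus_int (sink_cosk k l)) torus_intD; try exact/cperiodicZ/cperiodic_sink.
by rewrite !torus_intZ; try exact: cperiodic_sink; rewrite !torus_int_sink !mulr0 addr0.
Qed.

Lemma Scoef_cosk k l : Scoef (@cosk R d k) l = 0.
Proof.
by rewrite -(Ccoef_sink l k); apply: eq_torus_int => x; rewrite mulrC.
Qed.

Lemma sum_eq_delta (s : seq 'rV[int]_d) (F : 'rV[int]_d -> R) l :
  uniq s -> (l \notin s -> F l = 0) -> \sum_(k <- s) F k * (k == l)%:R = F l.
Proof.
move=> us Fl; have [ls|ls] := boolP (l \in s); last first.
  rewrite (Fl ls) big_seq big1// => k ks; case: eqP => [kl|_]; last by rewrite mulr0.
  by rewrite -kl ks in ls.
rewrite (bigD1_seq l)//= eqxx mulr1 big1 ?addr0// => k kl.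
by rewrite (negbTE kl) mulr0.
Qed.

Definition mode g k (x : 'rV[R]_d) := Ccoef g k * cosk k x + Scoef g k * sink k x.

(** The Fourier multiplier with symbol [m], for [m] supported in the list [s];
    the summand is the real part of the term of the complex series. *)
Definition trunc (m : 'rV[int]_d -> R) (s : seq 'rV[int]_d) g (x : 'rV[R]_d) :=
  \sum_(k <- s) m k / vol d * mode g k x.

(** The L2 product of two truncations, by Parseval ([L2form_trunc_trunc]); hence
    the square of the symbol. *)
Definition truncform (m : 'rV[int]_d -> R) (s : seq 'rV[int]_d) g h :=
  \sum_(k <- s) m k ^+ 2 / vol d * mode_form k g h.

Lemma cperiodic_mode g k : cperiodic (mode g k).
Proof. by apply: cperiodicD; apply: cperiodicZ; [exact: cperiodic_cosk|exact: cperiodic_sink]. Qed.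

Lemma cperiodic_trunc m s g : cperiodic (trunc m s g).
Proof. by apply: cperiodic_sum => k _; apply: cperiodicZ; exact: cperiodic_mode. Qed.

Lemma truncform_energy_form m s : energy_form (truncform m s).
Proof. exact: sum_energy_form mode_form_energy_form. Qed.

Lemma L2form_mode g h k : cperiodic h -> L2form h (mode g k) = mode_form k g h.
Proof.
move=> ch; have cc := cperiodicM ch (cperiodic_cosk k); have cs := cperiodicM ch (cperiodic_sink k).
rewrite /mode_form /Ccoef /Scoef -!torus_intZ// -torus_intD; try exact: cperiodicZ.
apply: eq_torus_int => x; rewrite /mode /Ccoef /Scoef; ring.
Qed.

Lemma L2form_trunc m s g h : cperiodic h ->
  L2form h (trunc m s g) = \sum_(k <- s) m k / vol d * mode_form k g h.
Proof.
move=> ch; rewrite /L2form (@eq_torus_int _ _ _ (fun x => \sum_(k <- s) m k / vol d *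
  (h x * mode g k x))).
  rewrite torus_int_sum; last by move=> k _; apply/cperiodicZ/cperiodicM/cperiodic_mode.
  apply: eq_bigr => k _; rewrite torus_intZ; last by apply/cperiodicM/cperiodic_mode.
  by rewrite -L2form_mode.
by move=> x; rewrite mulr_sumr; apply: eq_bigr => k _; rewrite mulrCA.
Qed.

Section even_symbol.
Variables (m : 'rV[int]_d -> R) (s : seq 'rV[int]_d).
Hypotheses (us : uniq s) (ms : forall k, k \notin s -> m k = 0)
  (mN : forall k, m (- k) = m k).

Let sum_eq_delta_pm (F : 'rV[int]_d -> R) l :
  (forall k, k \notin s -> F k = 0) ->
  \sum_(k <- s) F k * ((l == k)%:R + (l == - k)%:R) = F l + F (- l) /\
  \sum_(k <- s) F k * ((l == k)%:R - (l == - k)%:R) = F l - F (- l).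
Proof.
move=> F0; split.
  under eq_bigr do rewrite mulrDr [l == _]eq_sym [l == - _]eq_sym eqr_oppLR.
  by rewrite big_split/= !sum_eq_delta//; exact: F0.
under eq_bigr do rewrite mulrBr [l == _]eq_sym [l == - _]eq_sym eqr_oppLR.
by rewrite sumrB/= !sum_eq_delta//; exact: F0.
Qed.

Lemma CcoefN g k : Ccoef g (- k) = Ccoef g k.
Proof. by apply: eq_torus_int => x; rewrite /cosk phaseNk cosN. Qed.

Lemma ScoefN g k : cperiodic g -> Scoef g (- k) = - Scoef g k.
Proof.
move=> cg; rewrite /Scoef -torus_intN; last exact/cperiodicM/cperiodic_sink.
by apply: eq_torus_int => x; rewrite /sink phaseNk sinN mulrN.
Qed.

Let vol0 : vol d != 0 :> R. Proof. by rewrite gt_eqF// vol_gt0. Qed.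

Lemma Ccoef_trunc g l : Ccoef (trunc m s g) l = m l * Ccoef g l.
Proof.
rewrite [LHS](ef_sym L2form_energy_form) L2form_trunc; last exact: cperiodic_cosk.
under eq_bigr do rewrite /mode_form Scoef_cosk mulr0 addr0 Ccoef_cosk.
pose F k := m k * Ccoef g k / 2.
transitivity (F l + F (- l)); last by rewrite /F CcoefN mN; field.
rewrite -(sum_eq_delta_pm _ _).1 => [|k /ms mk]; last by rewrite /F mk !mul0r.
by apply: eq_bigr => k _; rewrite /F; field.
Qed.

Lemma Scoef_trunc g l : cperiodic g -> Scoef (trunc m s g) l = m l * Scoef g l.
Proof.
move=> cg.
rewrite [LHS](ef_sym L2form_energy_form) L2form_trunc; last exact: cperiodic_sink.
under eq_bigr do rewrite /mode_form Ccoef_sink mulr0 add0r Scoef_sink.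
pose F k := m k * Scoef g k / 2.
transitivity (F l - F (- l)); last by rewrite /F ScoefN// mN; field.
rewrite -(sum_eq_delta_pm _ _).2 => [|k /ms mk]; last by rewrite /F mk !mul0r.
by apply: eq_bigr => k _; rewrite /F; field.
Qed.

Lemma trunc_cosk l x : trunc m s (cosk l) x = m l * cosk l x.
Proof.
rewrite /trunc; under eq_bigr do rewrite /mode Scoef_cosk mul0r addr0 Ccoef_cosk.
pose F k := m k / 2 * cosk k x.
transitivity (F l + F (- l)); last by rewrite /F mN /cosk phaseNk cosN; field.
rewrite -(sum_eq_delta_pm _ _).1 => [|k /ms mk]; last by rewrite /F mk !mul0r.
by apply: eq_bigr => k _; rewrite /F; field.
Qed.

Lemma trunc_sink l x : trunc m s (sink l) x = m l * sink l x.
Proof.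
rewrite /trunc; under eq_bigr do rewrite /mode Ccoef_sink mul0r add0r Scoef_sink.
pose F k := m k / 2 * sink k x.
transitivity (F l - F (- l)); last by rewrite /F mN /sink phaseNk sinN; field.
rewrite -(sum_eq_delta_pm _ _).2 => [|k /ms mk]; last by rewrite /F mk !mul0r.
by apply: eq_bigr => k _; rewrite /F; field.
Qed.

Lemma L2form_trunc_trunc g h : cperiodic g -> cperiodic h ->
  L2form (trunc m s g) (trunc m s h) = truncform m s g h.
Proof.
move=> cg ch; rewrite L2form_trunc; last exact: cperiodic_trunc.
apply: eq_bigr => k _; rewrite /mode_form Ccoef_trunc Scoef_trunc//.
by rewrite expr2; ring.
Qed.

(** The energy lost by truncation. It is used as a nonnegative quadratic form
    bounded by the L2 energy, so that its square root is a seminorm. *)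
Definition tail g := L2form g g - truncform m s g g.

Hypothesis m01 : forall k, 0 <= m k <= 1.

(** Bessel's inequality for the projection P: |g - P g|^2 >= 0, and
    |P g|^2 <= <g, P g> because the symbol takes values between 0 and 1. *)
Lemma tail_ge0 g : cperiodic g -> 0 <= tail g.
Proof.
move=> cg; have ct := cperiodic_trunc m s g.
have : 0 <= L2form (fun x => g x - trunc m s g x) (fun x => g x - trunc m s g x).
  by apply: torus_int_ge0 => x; rewrite -expr2 sqr_ge0.
have -> : L2form (fun x => g x - trunc m s g x) (fun x => g x - trunc m s g x) =
    L2form g g - 2 * L2form g (trunc m s g) + truncform m s g g.
  rewrite -L2form_trunc_trunc// /L2form.
  rewrite -torus_intZ; last exact: cperiodicM.
  rewrite -torus_intB; [|exact: cperiodicM|exact/cperiodicZ/cperiodicM].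
  rewrite -torus_intD; [|by apply: cperiodicB;
    [exact: cperiodicM|exact/cperiodicZ/cperiodicM]|exact: cperiodicM].
  by apply: eq_torus_int => x; ring.
have : truncform m s g g <= L2form g (trunc m s g).
  rewrite L2form_trunc//; apply: ler_sum => k _.
  apply: ler_wpM2r; first by rewrite /mode_form addr_ge0// -expr2 sqr_ge0.
  apply: ler_wpM2r; first by rewrite invr_ge0 ltW// vol_gt0.
  by have /andP[m0 m1] := m01 k; rewrite expr2 ler_piMl.
by rewrite /tail; lra.
Qed.

Lemma tail_le g : cperiodic g -> tail g <= L2form g g.
Proof.
move=> cg; rewrite /tail lerBlDr lerDl -L2form_trunc_trunc//.
by apply: torus_int_ge0 => x; rewrite -expr2 sqr_ge0.
Qed.

Let tail_form g h := L2form g h - truncform m s g h.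

Let tail_form_lin a g g' h : cperiodic g -> cperiodic g' -> cperiodic h ->
  tail_form (fun x => a * g x + g' x) h = a * tail_form g h + tail_form g' h.
Proof.
move=> cg cg' ch; rewrite /tail_form (ef_lin L2form_energy_form)//.
by rewrite (ef_lin (truncform_energy_form m s))//; ring.
Qed.

Let tail_form_sym g h : tail_form g h = tail_form h g.
Proof.
by rewrite /tail_form (ef_sym L2form_energy_form) (ef_sym (truncform_energy_form m s)).
Qed.

Let tail_lin a g h : cperiodic g -> cperiodic h ->
  tail (fun x => a * g x + h x) = a ^+ 2 * tail g + 2 * a * tail_form g h + tail h.
Proof.
move=> cg ch; have cw : cperiodic (fun x => a * g x + h x) by apply: cperiodicD => //; exact: cperiodicZ.
rewrite -[LHS]/(tail_form _ _) tail_form_lin//.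
rewrite (tail_form_sym g) (tail_form_sym h) !tail_form_lin// (tail_form_sym h).
by rewrite -/(tail_form g g) /tail -/(tail_form h h) -/(tail_form g g); ring.
Qed.

(** The parallelogram identity for a nonnegative quadratic form. *)
Lemma tail_sum a g h : cperiodic g -> cperiodic h ->
  tail (fun x => a * g x + h x) <= 2 * a ^+ 2 * tail g + 2 * tail h.
Proof.
move=> cg ch.
have : 0 <= tail (fun x => - a * g x + h x).
  by apply: tail_ge0; apply: cperiodicD => //; exact: cperiodicZ.
rewrite !tail_lin// sqrrN mulrN; lra.
Qed.

Lemma tail_cosk l : m l = 1 -> tail (cosk l) = 0.
Proof.
move=> ml; rewrite /tail -L2form_trunc_trunc; try exact: cperiodic_cosk.
apply/eqP; rewrite subr_eq0; apply/eqP; apply: eq_torus_int => x.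
by rewrite trunc_cosk ml mul1r.
Qed.

Lemma tail_sink l : m l = 1 -> tail (sink l) = 0.
Proof.
move=> ml; rewrite /tail -L2form_trunc_trunc; try exact: cperiodic_sink.
apply/eqP; rewrite subr_eq0; apply/eqP; apply: eq_torus_int => x.
by rewrite trunc_sink ml mul1r.
Qed.

End even_symbol.
End truncation.

(** * Density of trigonometric polynomials *)

Section kernel.
Context {R : realType} {d : nat}.
Implicit Types (g h : 'rV[R]_d -> R) (k l : 'rV[int]_d) (x y : 'rV[R]_d) (i j : 'I_d).

Local Notation dl i := (delta_mx 0 i : 'rV[int]_d).

Lemma pderivZ i a g g' : pderiv i g g' -> pderiv i (fun x => a * g x) (fun x => a * g' x).
Proof.
move=> [cg cg' dg]; split; [exact: cperiodicZ|exact: cperiodicZ|move=> x].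
exact: is_deriveZ (dg x).
Qed.

Lemma coskB k x y : cosk k (x - y) = cosk k x * cosk k y + sink k x * sink k y.
Proof. by rewrite /cosk /sink phaseD -scaleN1r phaseZ mulN1r cosB. Qed.

Lemma sinkB k x y : sink k (x - y) = sink k x * cosk k y - cosk k x * sink k y.
Proof. by rewrite /cosk /sink phaseD -scaleN1r phaseZ mulN1r sinB. Qed.

Lemma eq_pderiv i g g' h h' : (forall x, g x = h x) -> (forall x, g' x = h' x) ->
  pderiv i g g' -> pderiv i h h'.
Proof. by move=> /funext-> /funext->. Qed.

Lemma cosk0 x : cosk 0 x = 1.
Proof. by rewrite /cosk phase0k cos0. Qed.

Lemma sink0 x : sink 0 x = 0.
Proof. by rewrite /sink phase0k sin0. Qed.

Lemma pderiv_coskB k x j :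
  pderiv j (fun y => cosk k (x - y)) (fun y => (k 0 j)%:~R * sink k (x - y)).
Proof.
apply: eq_pderiv (pderivD (pderivZ (cosk k x) (pderiv_cosk k j))
  (pderivZ (sink k x) (pderiv_sink k j))) => y; first by rewrite coskB.
by rewrite sinkB; ring.
Qed.

Lemma pderiv_sinkB k x j :
  pderiv j (fun y => sink k (x - y)) (fun y => - ((k 0 j)%:~R * cosk k (x - y))).
Proof.
apply: eq_pderiv (pderivD (pderivZ (sink k x) (pderiv_cosk k j))
  (pderivZ (- cosk k x) (pderiv_sink k j))) => y; first by rewrite sinkB mulNr.
by rewrite coskB; ring.
Qed.

(** Repeating every index n times in [s] concentrates the mass at 0 modulo the
    period, while the kernel remains a nonnegative trigonometric polynomial. *)
Definition kernel (s : seq 'I_d) (z : 'rV[R]_d) := \prod_(i <- s) ((1 + cosk (dl i) z) / 2).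

Lemma kernel_cons i s z : kernel (i :: s) z = (1 + cosk (dl i) z) / 2 * kernel s z.
Proof. by rewrite /kernel big_cons. Qed.

Lemma kernel_ge0 s z : 0 <= kernel s z.
Proof.
apply: prodr_ge0 => i _; rewrite divr_ge0//.
by have := cos_geN1 (phase (dl i) z); rewrite /cosk; lra.
Qed.

(** As a function of y, each factor w = (1 + cos (x_j - y_j)) / 2 satisfies
    sin (x_j - y_j) w' = (1 - cos (x_j - y_j)) w, whence the multiplicity of j. *)
Lemma pderiv_kernel s x j : exists2 K', pderiv j (fun y => kernel s (x - y)) K' &
  forall y, sink (dl j) (x - y) * K' y =
    (count_mem j s)%:R * ((1 - cosk (dl j) (x - y)) * kernel s (x - y)).
Proof.
elim: s => [|i s [K' DK' EK']].
  exists (fun=> 0) => [|y]; last by rewrite mul0r mulr0.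
  split; [|exact: cperiodic_cst|move=> y].
    by apply: eq_cperiodic (cperiodic_cst d 1) => y; rewrite /kernel big_nil.
  rewrite (_ : (fun _ => _) = cst 1); first exact: is_derive_cst.
  by apply/funext => z; rewrite /kernel big_nil.
have D1 := pderivZ 2^-1 (pderivD (pderivZ 1 (pderiv_cosk 0 j)) (pderiv_coskB (dl i) x j)).
have D := pderivM D1 DK'.
eexists.
  apply: eq_pderiv D => [y|y].
    by rewrite kernel_cons cosk0; field.
  by [].
move=> y /=.
rewrite kernel_cons /= natrD mulrDl cosk0 sink0 !mulr0 oppr0 mulr0 add0r mulrDr.
have -> : sink (dl j) (x - y) * (2^-1 * (1 * 1 + cosk (dl i) (x - y)) * K' y) =
  2^-1 * (1 + cosk (dl i) (x - y)) * (sink (dl j) (x - y) * K' y) by ring.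
rewrite EK' mxE eqxx/=; case: eqVneq => [->|ij] /=; last first.
  by rewrite !mul0r !mulr0 mul0r mulr0; ring.
have E : sink (dl i) (x - y) * sink (dl i) (x - y) = 1 - cosk (dl i) (x - y) ^+ 2.
  by rewrite -expr2 /sink sin2cos2.
have -> : sink (dl i) (x - y) * (2^-1 * (1%:~R * sink (dl i) (x - y)) * kernel s (x - y)) =
  2^-1 * (1 - cosk (dl i) (x - y) ^+ 2) * kernel s (x - y) by rewrite -E; ring.
by field.
Qed.

Lemma cperiodic_kernel s x : cperiodic (fun y => kernel s (x - y)).
Proof.
elim: s => [|i s IH].
  by apply: eq_cperiodic (cperiodic_cst d 1) => y; rewrite /kernel big_nil.
apply: (@eq_cperiodic _ _ _ (fun y => 2^-1 * (1 + cosk (dl i) (x - y)) * kernel s (x - y))) => [y|].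
  by rewrite kernel_cons; ring.
apply: cperiodicM => //; apply/cperiodicZ/cperiodicD; first exact: cperiodic_cst.
by case: (pderiv_coskB (dl i) x i).
Qed.

(** By [pderiv_kernel] the derivative of sin (x_j - y_j) K, with K the kernel
    and n the multiplicity of j, is (n + 1) (1 - cos (x_j - y_j)) K - K, and its
    integral vanishes. This replaces the computation of the normalising
    constants. *)
Lemma kernel_moment s x j :
  (count_mem j s).+1%:R * torus_int (fun y => (1 - cosk (dl j) (x - y)) * kernel s (x - y)) =
  torus_int (fun y => kernel s (x - y)).
Proof.
have [K' DK EK] := pderiv_kernel s x j.
have cK := cperiodic_kernel s x.
have cc : cperiodic (fun y => cosk (dl j) (x - y)) by case: (pderiv_coskB (dl j) x j).
have c1 : cperiodic (fun y => (1 - cosk (dl j) (x - y)) * kernel s (x - y)).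
  by apply/cperiodicM => //; apply: cperiodicB => //; exact: cperiodic_cst.
have := torus_int_pderiv (pderivM (pderiv_sinkB (dl j) x j) DK).
rewrite (@eq_torus_int _ _ _ (fun y => (count_mem j s).+1%:R *
  ((1 - cosk (dl j) (x - y)) * kernel s (x - y)) - kernel s (x - y))) => [|y].
  rewrite torus_intB//; last exact: cperiodicZ.
  by rewrite torus_intZ// => /eqP; rewrite subr_eq0 => /eqP.
rewrite EK mxE !eqxx /= -[_.+1%:R]natr1; ring.
Qed.

(** An additional factor (1 + cos) / 2 = 1 - (1 - cos) / 2 removes half of a
    first moment, hence at most half of the mass by [kernel_moment]. *)
Lemma kernel_mass_gt0 s x : 0 < torus_int (fun y => kernel s (x - y)).
Proof.
elim: s => [|i s IH].
  rewrite (@eq_torus_int _ _ _ (fun=> 1)) => [|y]; last by rewrite /kernel big_nil.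
  by rewrite torus_int_cst mul1r vol_gt0.
have cK := cperiodic_kernel s x.
have cc : cperiodic (fun y => cosk (dl i) (x - y)) by case: (pderiv_coskB (dl i) x i).
have c1 : cperiodic (fun y => (1 - cosk (dl i) (x - y)) * kernel s (x - y)).
  by apply/cperiodicM => //; apply: cperiodicB => //; exact: cperiodic_cst.
rewrite (@eq_torus_int _ _ _ (fun y => kernel s (x - y) -
  2^-1 * ((1 - cosk (dl i) (x - y)) * kernel s (x - y)))) => [|y]; last first.
  by rewrite kernel_cons; field.
rewrite torus_intB//; last exact: cperiodicZ.
rewrite torus_intZ//; have := kernel_moment s x i.
move: IH; set I := torus_int _; set J := torus_int _ => I0 E.
have n1 : 1 <= (count_mem i s).+1%:R :> R by rewrite ler1n.
have J0 : 0 <= J.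
  apply: torus_int_ge0 => y; rewrite mulr_ge0// ?kernel_ge0// subr_ge0; exact: cos_le1.
have : J <= I by rewrite -E ler_peMl.
by lra.
Qed.

Lemma kernel_trig s : exists L : seq (R * 'rV[int]_d),
  forall z, kernel s z = \sum_(p <- L) p.1 * cosk p.2 z.
Proof.
elim: s => [|i s [L HL]].
  by exists [:: (1, 0)] => z; rewrite /kernel big_nil big_seq1/= /cosk phase0k cos0 mulr1.
exists ([seq (p.1 / 2, p.2) | p <- L] ++ ([seq (p.1 / 4, dl i - p.2) | p <- L] ++
  [seq (p.1 / 4, dl i + p.2) | p <- L])) => z.
rewrite kernel_cons HL !big_cat/= !big_map/= -!big_split/= mulr_sumr.
apply: eq_bigr => p _.
rewrite [LHS](_ : _ = 2^-1 * p.1 * (cosk p.2 z + cosk (dl i) z * cosk p.2 z)); last by field.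
by rewrite cosk_mul; field.
Qed.

(** Convolution with a trigonometric polynomial gives a trigonometric
    polynomial. *)
Lemma kernel_mean_trig s g : cperiodic g -> exists L : seq (R * R * 'rV[int]_d),
  forall x, torus_int (fun y => g y * kernel s (x - y)) =
    \sum_(p <- L) (p.1.1 * cosk p.2 x + p.1.2 * sink p.2 x).
Proof.
move=> cg; have [L HL] := kernel_trig s.
exists [seq ((p.1 * Ccoef g p.2, p.1 * Scoef g p.2), p.2) | p <- L] => x.
rewrite big_map/=.
have c1 k : cperiodic (fun y => cosk k x * (g y * cosk k y))
  by exact/cperiodicZ/cperiodicM/cperiodic_cosk.
have c2 k : cperiodic (fun y => sink k x * (g y * sink k y))
  by exact/cperiodicZ/cperiodicM/cperiodic_sink.
rewrite (@eq_torus_int _ _ _ (fun y => \sum_(p <- L) p.1 *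
    (cosk p.2 x * (g y * cosk p.2 y) + sink p.2 x * (g y * sink p.2 y)))) => [|y].
  rewrite torus_int_sum => [|p _]; last exact/cperiodicZ/cperiodicD.
  apply: eq_bigr => p _; rewrite torus_intZ; last exact: cperiodicD.
  rewrite torus_intD// !torus_intZ; [|exact/cperiodicM/cperiodic_sink|exact/cperiodicM/cperiodic_cosk].
  by rewrite /Ccoef /Scoef; ring.
by rewrite HL mulr_sumr; apply: eq_bigr => p _; rewrite coskB; ring.
Qed.

(** Only the zero frequency contributes to the integral, and it does not see
    the centre. *)
Lemma kernel_mass s x x' :
  torus_int (fun y => kernel s (x - y)) = torus_int (fun y => kernel s (x' - y)).
Proof.
have [L HL] := kernel_trig s.
have cB k z : cperiodic (fun y => cosk k (z - y)).
  apply: (@eq_cperiodic _ _ _ (fun y => cosk k z * cosk k y + sink k z * sink k y)) => [y|].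
    by rewrite coskB.
  by apply: cperiodicD; apply: cperiodicZ; [exact: cperiodic_cosk|exact: cperiodic_sink].
suff E z : torus_int (fun y => kernel s (z - y)) = \sum_(p <- L) p.1 * (vol d * (p.2 == 0)%:R).
  by rewrite !E.
rewrite (@eq_torus_int _ _ _ (fun y => \sum_(p <- L) p.1 * cosk p.2 (z - y))) => [|y//].
rewrite torus_int_sum => [|p _]; last exact: cperiodicZ.
apply: eq_bigr => p _; rewrite torus_intZ//; congr (_ * _).
rewrite (eq_torus_int (coskB p.2 z)) torus_intD;
  [|exact/cperiodicZ/cperiodic_cosk|exact/cperiodicZ/cperiodic_sink].
rewrite !torus_intZ; [|exact: cperiodic_sink|exact: cperiodic_cosk].
rewrite torus_int_coskE torus_int_sink mulr0 addr0.
by case: eqVneq => [->|_]; rewrite ?cosk0 ?mul1r// !mulr0.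
Qed.

Lemma periodic_shift W (h : 'rV[R]_d -> W) c : space_periodic h -> space_periodic (fun v => h (v + c)).
Proof. by move=> ph x i; rewrite addrAC ph. Qed.

(** Heine-Cantor on the box; periodicity moves [x] to the box and carries the
    increment [y - x] along. *)
Lemma cperiodic_unif_continuous g (e : R) : cperiodic g -> 0 < e ->
  exists2 r : R, 0 < r & forall x y, (forall i, `|x 0 i - y 0 i| < r) -> `|g x - g y| < e.
Proof.
move=> [cg pg] e0; have e20 : 0 < e / 2 by rewrite divr_gt0.
have /compact_near_coveringP ncK := @box_compact R d 0 (2 * pi).
have : \forall r \near (0 : R)^'+, [set x : 'rV[R]_d | forall i, 0 <= x 0 i <= 2 * pi] `<=`
    [set x | forall y, ball x r y -> `|g x - g y| < e].
  apply: ncK => x _.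
  have /cvgrPdist_lt/(_ _ e20) := cg x.
  move=> /nbhs_ballP[r /= r0 xr].
  have r20 : 0 < r / 2 by rewrite divr_gt0.
  exists (ball x (r / 2), [set r' : R | r' < r / 2]) => /=.
    by split; [exact: nbhsx_ballx|exact: nbhs_right_lt].
  move=> [x' r'] /= [xx' r'r] y x'y.
  have h1 : `|g x - g x'| < e / 2.
    by apply: xr; apply: le_ball xx'; rewrite ler_pdivrMr// ler_peMr ?ler1n// ltW.
  have h2 : `|g x - g y| < e / 2.
    apply: xr; rewrite (splitr r); apply: ball_triangle xx' _.
    exact: le_ball (ltW r'r) _ x'y.
  rewrite (_ : g x' - g y = (g x - g y) - (g x - g x')); last by ring.
  by rewrite (le_lt_trans (ler_normB _ _))// (splitr e) ltrD.
move=> near_r.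
have [r [r0 rK]] : exists r : R, 0 < r /\
    [set x : 'rV[R]_d | forall i, 0 <= x 0 i <= 2 * pi] `<=`
    [set x | forall y, ball x r y -> `|g x - g y| < e].
  near (0 : R)^'+ => r; exists r; split; first by [].
  by near: r.
exists r => // x y xy.
have [x' x'K Ex] := periodic_box x.
rewrite (Ex _ g pg).
have -> : g y = g (x' + (y - x)).
  have := Ex _ (fun v => g (v + (y - x))) (periodic_shift _ pg).
  by rewrite addrC subrK.
apply: rK => //; rewrite -ball_normE /= opprD addNKr opprB.
rewrite /Num.norm/= mx_normrE; apply: bigmax_lt => //= -[i j] _.
by rewrite !mxE ord1.
Unshelve. all: by end_near. Qed.

(** Either x - y is small modulo the period and uniform continuity applies, or
    some 1 - cos (x_i - y_i) is bounded below and M absorbs the oscillation of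
    g. *)
Lemma cperiodic_modulus g (e : R) : cperiodic g -> 0 < e ->
  exists2 M : R, 0 < M & forall x y,
    `|g x - g y| <= e + M * \sum_i (1 - cosk (dl i) (x - y)).
Proof.
move=> cg e0; have [B B0 gB] := cperiodic_bounded cg.
have [r r0 gr] := cperiodic_unif_continuous cg e0.
(* cos is monotone on [0, pi] only *)
pose r' := Num.min r pi.
have r'0 : 0 < r' by rewrite lt_min r0 pi_gt0.
have r'pi : r' <= pi by rewrite ge_min lexx orbT.
have cr : cos r' < 1.
  by rewrite -cos0 ltr_cos// in_itv/= ?lexx ?pi_ge0// ltW.
have c0 : 0 < 1 - cos r' by rewrite subr_gt0.
exists (2 * B / (1 - cos r')) => [|x y]; first by rewrite divr_gt0// mulr_gt0.
have M0 : 0 < 2 * B / (1 - cos r') by rewrite divr_gt0// mulr_gt0.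
have [w wb Ew] := periodic_box (y - (x - const_mx pi)).
set y' := w + (x - const_mx pi).
have Ey W (h : 'rV[R]_d -> W) : space_periodic h -> h y = h y'.
  by move=> ph; have := Ew _ _ (periodic_shift (x - const_mx pi) ph); rewrite subrK.
have y'b i : `|x 0 i - y' 0 i| <= pi.
  have := wb i; rewrite /y' !mxE => /andP[h1 h2]; rewrite ler_norml; apply/andP; split; lra.
rewrite (Ey _ g (proj2 cg)).
rewrite (eq_bigr (fun i => 1 - cosk (dl i) (x - y'))) => [|i _]; last first.
  congr (_ - _); apply: (Ey _ (fun v => cosk (dl i) (x - v))).
  by case: (pderiv_coskB (dl i) x i) => -[].
have c1 i : 0 <= 1 - cosk (dl i) (x - y') by rewrite subr_ge0 cos_le1.
have [H|] := pselect (forall i, `|x 0 i - y' 0 i| < r).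
  apply: (le_trans (ltW (gr _ _ H))); rewrite lerDl mulr_ge0 ?(ltW M0)//.
  exact: sumr_ge0.
move=> /existsNP[i /negP]; rewrite -leNgt => ri.
apply: (@le_trans _ _ (2 * B)).
  by rewrite (le_trans (ler_normB _ _))// mulr_natl mulr2n lerD.
apply: (@le_trans _ _ (2 * B / (1 - cos r') * \sum_i (1 - cosk (dl i) (x - y')))); last first.
  by rewrite lerDr ltW.
rewrite mulrAC ler_pdivlMr// ler_pM2l ?mulr_gt0//.
apply: (@le_trans _ _ (1 - cosk (dl i) (x - y'))); last first.
  by rewrite (bigD1 i)//= lerDl sumr_ge0.
rewrite lerD2l lerN2 /cosk phase_deltak.
have -> : (x - y') 0 i = x 0 i - y' 0 i by rewrite !mxE.
rewrite -cos_norm leNgt ltr_cos ?in_itv/= ?normr_ge0 ?(ltW r'0)//.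
  by rewrite -leNgt ge_min ri.
exact: y'b.
Qed.

(** Korovkin's argument: the mean of g against the kernel centred at x is a
    trigonometric polynomial in x, and [cperiodic_modulus] bounds its distance to
    g x by the first moments, which are 1 / (n + 1) of the mass. *)
Lemma trig_approx g (e : R) : cperiodic g -> 0 < e -> exists L : seq (R * R * 'rV[int]_d),
  forall x, `|g x - \sum_(p <- L) (p.1.1 * cosk p.2 x + p.1.2 * sink p.2 x)| <= e.
Proof.
move=> cg e0; have e20 : 0 < e / 2 by rewrite divr_gt0.
have [M M0 gM] := cperiodic_modulus cg e20.
(* the d moments contribute M * d / (n + 1) *)
have [n nM] : exists n : nat, M * d%:R / (e / 2) <= n.+1%:R.
  exists (Num.truncn (M * d%:R / (e / 2))); apply/ltW/truncnS_gt.
pose s := flatten (nseq n (enum 'I_d)).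
have sc j : count_mem j s = n.
  rewrite /s; elim: n {nM s} => [|n IH]//=.
  by rewrite count_cat IH count_uniq_mem ?enum_uniq// mem_enum add1n.
have [L HL] := kernel_mean_trig s cg.
pose Z := torus_int (fun y => kernel s (0 - y)).
have Z0 : 0 < Z by exact: kernel_mass_gt0.
exists [seq ((p.1.1 / Z, p.1.2 / Z), p.2) | p <- L] => x; rewrite big_map/=.
have cK := cperiodic_kernel s x.
have cc j : cperiodic (fun y => cosk (dl j) (x - y)) by case: (pderiv_coskB (dl j) x j).
have c1 j : cperiodic (fun y => (1 - cosk (dl j) (x - y)) * kernel s (x - y)).
  by apply/cperiodicM => //; apply: cperiodicB => //; exact: cperiodic_cst.
have cd : cperiodic (fun y => (g x - g y) * kernel s (x - y)).
  by apply/cperiodicM => //; apply: cperiodicB => //; exact: cperiodic_cst.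
have ZE : torus_int (fun y => kernel s (x - y)) = Z by exact: kernel_mass.
have E : Z * (g x - \sum_(p <- L) (p.1.1 / Z * cosk p.2 x + p.1.2 / Z * sink p.2 x)) =
    torus_int (fun y => (g x - g y) * kernel s (x - y)).
  rewrite (@eq_torus_int _ _ _ (fun y => g x * kernel s (x - y) - g y * kernel s (x - y))) => [|y].
    rewrite torus_intB; [|exact: cperiodicZ|exact: cperiodicM].
    rewrite torus_intZ// ZE mulrBr mulrC; congr (_ - _).
    rewrite HL mulr_sumr; apply: eq_bigr => p _; field.
    exact: lt0r_neq0.
  by rewrite mulrBl.
have B1 : torus_int (fun y => (e / 2) * kernel s (x - y) +
    M * \sum_i ((1 - cosk (dl i) (x - y)) * kernel s (x - y))) <= e * Z.
  rewrite torus_intD; [|exact: cperiodicZ|exact/cperiodicZ/cperiodic_sum].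
  rewrite !torus_intZ//; last exact: cperiodic_sum.
  rewrite torus_int_sum// ZE.
  have n0 : 0 < n.+1%:R :> R by [].
  have -> : \sum_i torus_int (fun y => (1 - cosk (dl i) (x - y)) * kernel s (x - y)) =
      d%:R * (Z / n.+1%:R).
    rewrite (eq_bigr (fun=> Z / n.+1%:R)) => [|i _].
      by rewrite sumr_const card_ord mulr_natl.
    have := kernel_moment s x i; rewrite sc ZE => <-.
    by rewrite mulrAC mulfV ?mul1r// lt0r_neq0.
  rewrite ler_pdivrMr// in nM.
  have : M * (d%:R * (Z / n.+1%:R)) <= e / 2 * Z.
    rewrite [leLHS](_ : _ = (M * d%:R / n.+1%:R) * Z); last by rewrite !mulrA [RHS]mulrAC.
    by apply: ler_wpM2r; [exact: ltW|rewrite ler_pdivrMr// [leRHS]mulrC].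
  by rewrite [e * Z](_ : _ = e / 2 * Z + e / 2 * Z) ?lerD2l//; field.
have mono y : `|(g x - g y) * kernel s (x - y)| <= (e / 2) * kernel s (x - y) +
    M * \sum_i ((1 - cosk (dl i) (x - y)) * kernel s (x - y)).
  rewrite -mulr_suml mulrA -mulrDl normrM (ger0_norm (kernel_ge0 _ _)).
  by apply: ler_wpM2r; [exact: kernel_ge0|exact: gM].
have cr : cperiodic (fun y => (e / 2) * kernel s (x - y) +
    M * \sum_i ((1 - cosk (dl i) (x - y)) * kernel s (x - y))).
  by apply: cperiodicD; apply: cperiodicZ => //; exact: cperiodic_sum.
rewrite -(ler_pM2l Z0) -[X in X * _](gtr0_norm Z0) -normrM E [leRHS]mulrC (le_trans _ B1)//.
rewrite ler_norml; apply/andP; split.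
  rewrite -torus_intN//; apply: le_torus_int => // [|y]; first exact: cperiodicN.
  by rewrite lerNl (le_trans _ (mono y))// -normrN ler_norm.
by apply: le_torus_int => // y; exact: le_trans (ler_norm _) (mono y).
Qed.

End kernel.

Section completeness.
Context {R : realType} {d : nat}.
Variables (m : nat -> 'rV[int]_d -> R) (s : nat -> seq 'rV[int]_d).
Hypotheses (us : forall q, uniq (s q)) (ms : forall q k, k \notin s q -> m q k = 0)
  (mN : forall q k, m q (- k) = m q k) (m01 : forall q k, 0 <= m q k <= 1)
  (m1 : forall k, \forall q \near \oo, m q k = 1).

Lemma tail_trig0 (L : seq (R * R * 'rV[int]_d)) :
  \forall q \near \oo, tail (m q) (s q)
    (fun x => \sum_(p <- L) (p.1.1 * cosk p.2 x + p.1.2 * sink p.2 x)) = 0.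
Proof.
elim: L => [|p L IH].
  apply: nearW => q; have c0 := @cperiodic_cst R d 0.
  have -> : (fun x => \sum_(p <- [::]) (p.1.1 * cosk p.2 x + p.1.2 * sink p.2 x)) =
      (fun=> 0) :> ('rV[R]_d -> R) by apply/funext => x; rewrite big_nil.
  apply/eqP; rewrite eq_le; apply/andP; split; last exact: (tail_ge0 (us q) (ms (q := q)) (mN q)
    (m01 q) c0).
  apply: (le_trans (tail_le (us q) (ms (q := q)) (mN q) c0)).
  by rewrite /L2form (@eq_torus_int _ _ _ (fun=> 0)) ?torus_int0// => x; rewrite mul0r.
near=> q.
have mp : m q p.2 = 1 by near: q; exact: m1.
have tL : tail (m q) (s q)
    (fun x => \sum_(p <- L) (p.1.1 * cosk p.2 x + p.1.2 * sink p.2 x)) = 0 by near: q.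
set F := (fun x => \sum_(p <- L) (p.1.1 * cosk p.2 x + p.1.2 * sink p.2 x)) in tL.
have cF : cperiodic F.
  by apply: cperiodic_sum => j _; apply: cperiodicD; apply: cperiodicZ;
    [exact: cperiodic_cosk|exact: cperiodic_sink].
apply/eqP; rewrite eq_le; apply/andP; split; last first.
  apply: (tail_ge0 (us q) (ms (q := q)) (mN q) (m01 q)).
  by apply: cperiodic_sum => j _; apply: cperiodicD; apply: cperiodicZ;
    [exact: cperiodic_cosk|exact: cperiodic_sink].
have -> : (fun x => \sum_(p <- p :: L) (p.1.1 * cosk p.2 x + p.1.2 * sink p.2 x)) =
    fun x => p.1.1 * cosk p.2 x + (p.1.2 * sink p.2 x + F x).
  by apply/funext => x; rewrite big_cons addrA.
have c1 : cperiodic (fun x => p.1.2 * sink p.2 x + F x).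
  by apply: cperiodicD => //; apply: cperiodicZ; exact: cperiodic_sink.
apply: (le_trans (tail_sum (us q) (ms (q := q)) (mN q) (m01 q) _ (cperiodic_cosk p.2) c1)).
have := tail_sum (us q) (ms (q := q)) (mN q) (m01 q) p.1.2 (cperiodic_sink p.2) cF.
have tc := tail_cosk (us q) (ms (q := q)) (mN q) mp.
have ts := tail_sink (us q) (ms (q := q)) (mN q) mp.
rewrite tL ts tc; lra.
Unshelve. all: by end_near. Qed.

(** For a trigonometric polynomial F near g, the loss of F is eventually 0, so
    the loss of g is at most twice that of g - F, hence at most 2 |g - F|^2. *)
Lemma tail_cvg0 (g : 'rV[R]_d -> R) : cperiodic g -> tail (m q) (s q) g @[q --> \oo] --> (0 : R).
Proof.
move=> cg; apply/cvgrPdist_lt => e e0.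
(* chosen so that 2 * eps ^ 2 * vol d <= e / 2 *)
pose eps := Num.min 1 (e / (4 * vol d)).
have V0 := @vol_gt0 R d.
have eps0 : 0 < eps by rewrite lt_min ltr01 divr_gt0// mulr_gt0.
have [L HL] := trig_approx cg eps0.
pose F x := \sum_(p <- L) (p.1.1 * cosk p.2 x + p.1.2 * sink p.2 x).
have cF : cperiodic F.
  by apply: cperiodic_sum => j _; apply: cperiodicD; apply: cperiodicZ;
    [exact: cperiodic_cosk|exact: cperiodic_sink].
near=> q.
have tF : tail (m q) (s q) F = 0 by near: q; exact: tail_trig0.
have cd : cperiodic (fun x => g x - F x) by exact: cperiodicB.
have t1 : tail (m q) (s q) g <= 2 * tail (m q) (s q) (fun x => g x - F x).
  have := tail_sum (us q) (ms (q := q)) (mN q) (m01 q) 1 cF cd.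
  rewrite tF mulr0 add0r.
  by rewrite (_ : (fun x => 1 * F x + (g x - F x)) = g)//; apply/funext => x; ring.
have t2 : tail (m q) (s q) (fun x => g x - F x) <= eps ^+ 2 * vol d.
  apply: (le_trans (tail_le (us q) (ms (q := q)) (mN q) cd)).
  rewrite -torus_int_cst; apply: le_torus_int => [||x]; [exact: cperiodicM|exact: cperiodic_cst|].
  by rewrite -expr2 -[leLHS]real_normK ?num_real// ler_sqr ?nnegrE ?(ltW eps0)//; exact: HL.
rewrite sub0r normrN ger0_norm; last exact: (tail_ge0 (us q) (ms (q := q)) (mN q) (m01 q)).
apply: (le_lt_trans t1).
have e1 : eps ^+ 2 <= eps by rewrite expr2 ler_piMl ?(ltW eps0)// ge_min lexx.
have e2 : eps * vol d <= e / 4.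
  have : eps <= e / (4 * vol d) by rewrite ge_min lexx orbT.
  by rewrite ler_pdivlMr ?mulr_gt0// => H; rewrite ler_pdivlMr//; lra.
have e3 : eps ^+ 2 * vol d <= eps * vol d by apply: ler_wpM2r => //; exact: ltW.
lra.
Unshelve. all: by end_near. Qed.

End completeness.

(** * The Littlewood-Paley cutoff as a Fourier truncation *)

Section littlewood_paley.
Context {R : realType} {d : nat}.
Implicit Types (k l : 'rV[int]_d) (xi : 'rV[R]_d).

Definition freqbox (N : nat) : seq 'rV[int]_d :=
  [seq \row_i ((f i : nat)%:Z - N%:Z) | f : {ffun 'I_d -> 'I_(N + N).+1}].

Lemma freqbox_uniq N : uniq (freqbox N).
Proof.
rewrite map_inj_uniq ?enum_uniq// => f g /rowP fg; apply/ffunP => i; apply/val_inj => /=.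
by have := fg i; rewrite !mxE => /addIr[].
Qed.

Lemma freqbox_out N k : k \notin freqbox N -> exists i, (N < `|k 0%R i|)%N.
Proof.
move=> kN; apply/existsP; move: kN; apply: contraNT; rewrite negb_exists => /forallP H.
apply/mapP; exists [ffun i => inord (absz (k 0 i + N%:Z))]; first by rewrite mem_enum.
apply/rowP => i; rewrite mxE ffunE.
have : `|k 0 i| <= N%:Z by rewrite -abszE lez_nat leqNgt; exact: H.
rewrite ler_norml => /andP[k1 k2].
have k0 : 0 <= k 0 i + N%:Z by rewrite -lerBlDr sub0r.
by rewrite inordK ?gez0_abs ?addrK// ltnS -lez_nat gez0_abs// PoszD lerD2r.
Qed.

Lemma euclidean_normZ (a : R) xi : 0 <= a -> euclidean_norm (a *: xi) = a * euclidean_norm xi.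
Proof.
move=> a0; rewrite /euclidean_norm -{2}(ger0_norm a0) -sqrtr_sqr -sqrtrM ?sqr_ge0//.
by congr Num.sqrt; rewrite mulr_sumr; apply: eq_bigr => i _; rewrite mxE exprMn.
Qed.

Lemma euclidean_norm_ge0 xi : 0 <= euclidean_norm xi.
Proof. exact: sqrtr_ge0. Qed.

Lemma euclidean_normN xi : euclidean_norm (- xi) = euclidean_norm xi.
Proof.
by congr Num.sqrt; apply: eq_bigr => i _; rewrite mxE sqrrN.
Qed.

Lemma le_euclidean_norm xi i : `|xi 0 i| <= euclidean_norm xi.
Proof.
rewrite -sqrtr_sqr ler_sqrt ?sumr_ge0// => [|j _]; last exact: sqr_ge0.
by rewrite (bigD1 i)//= lerDl sumr_ge0// => j _; exact: sqr_ge0.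
Qed.

Lemma frequencyN k : frequency (- k) = - frequency k :> 'rV[R]_d.
Proof. by apply/rowP => i; rewrite !mxE intrN. Qed.

Variable chi : 'rV[R]_d -> R.
Hypotheses (d0 : (0 < d)%N) (chiP : lp_cutoff chi).

Definition lp_symbol (q : nat) k := chi (2 ^- q.+1 *: frequency k).
Definition lp_support (q : nat) := freqbox (2 ^ q.+1).

Let two_gt0 q : 0 < 2 ^- q.+1 :> R.
Proof. by rewrite invr_gt0 exprn_gt0. Qed.

Lemma chi_even xi : chi (- xi) = chi xi.
Proof.
case: chiP => _ chile _ _; apply/eqP.
by rewrite eq_le !chile ?euclidean_normN.
Qed.

Lemma chi01 xi : 0 <= chi xi <= 1.
Proof.
case: chiP => _ chile chi1 chi0.
have n0 : euclidean_norm (0 : 'rV[R]_d) = 0.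
  by rewrite -(scale0r (0 : 'rV[R]_d)) euclidean_normZ// mul0r.
apply/andP; split; last first.
  by rewrite -(chi1 0) ?n0 ?invr_ge0// chile// n0 euclidean_norm_ge0.
have [/chi0->//|x1] := leP 1 (euclidean_norm xi).
pose eta : 'rV[R]_d := delta_mx 0 (Ordinal d0).
have eta1 : 1 <= euclidean_norm eta.
  by apply: le_trans (le_euclidean_norm eta (Ordinal d0)); rewrite mxE !eqxx normr1.
by rewrite -(chi0 _ eta1) chile// (le_trans (ltW x1)).
Qed.

Lemma lp_symbol01 q k : 0 <= lp_symbol q k <= 1.
Proof. exact: chi01. Qed.

Lemma lp_symbolN q k : lp_symbol q (- k) = lp_symbol q k.
Proof. by rewrite /lp_symbol frequencyN scalerN chi_even. Qed.

Lemma lp_symbol_out q k : k \notin lp_support q -> lp_symbol q k = 0.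
Proof.
case: chiP => _ _ _ chi0 /freqbox_out[i ki].
apply: chi0; rewrite euclidean_normZ; last exact: ltW.
rewrite mulrC ler_pdivlMr ?mul1r ?exprn_gt0//.
apply: le_trans (le_euclidean_norm _ i); rewrite mxE -intr_norm -natrX.
by rewrite pmulrn ler_int -abszE lez_nat ltnW.
Qed.

Lemma lp_symbol_near1 k : \forall q \near \oo, lp_symbol q k = 1.
Proof.
case: chiP => _ _ chi1 _.
near=> q; apply: chi1; rewrite euclidean_normZ; last exact: ltW.
rewrite mulrC ler_pdivrMr ?exprn_gt0// exprS mulKf//.
apply: (@le_trans _ _ q%:R).
  by near: q; exact: nbhs_infty_ger.
by rewrite -natrX ler_nat ltnW// ltn_expl.
Unshelve. all: by end_near. Qed.

(** Taking real parts termwise is what turns the complex series into [trunc]. *)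
Lemma lp_scalarE q (g : 'rV[R]_d -> R) x :
  lp_scalar chi q g x = trunc (lp_symbol q) (lp_support q) g x.
Proof.
rewrite /lp_scalar (@fsbigE _ _ _ _ _ (lp_support q)) ?freqbox_uniq//; last first.
  by move=> k _ /lp_symbol_out; rewrite /lp_symbol => ->; rewrite !mul0r.
rewrite big_mkcond/= (_ : complex.Re _ = \sum_(k <- lp_support q) complex.Re (
    (lp_symbol q k)%:C * fourier_coef g k * expi (phase k x))%C).
  apply: eq_bigr => k _; rewrite /fourier_coef /expi /mode /Ccoef /Scoef /=.
  by rewrite /cosk /sink -/(vol d); ring.
have ReD (a b : R[i]) : complex.Re (a + b) = complex.Re a + complex.Re b by case: a; case: b.
elim: (lp_support q) => [|k s IH]; first by rewrite !big_nil.
by rewrite !big_cons -IH in_setT ReD.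
Qed.

Lemma lpE q (v : 'rV[R]_d -> 'rV[R]_d) x i :
  lp chi q v x 0 i = trunc (lp_symbol q) (lp_support q) (fun y => v y 0 i) x.
Proof. by rewrite /lp mxE lp_scalarE. Qed.

End littlewood_paley.

(** * Smooth fields on the space-time cylinder *)

Section form_theory.
Context {R : realType} {d : nat} (B : ('rV[R]_d -> R) -> ('rV[R]_d -> R) -> R).
Hypothesis EB : energy_form B.
Implicit Types g h : 'rV[R]_d -> R.

Lemma ef0l h : cperiodic h -> B (fun=> 0) h = 0.
Proof.
move=> ch; have := ef_lin EB (-1) (cperiodic_cst d 0) (cperiodic_cst d 0) ch.
rewrite (_ : (fun x => -1 * 0 + 0) = fun=> 0); last by apply/funext => x; rewrite mulr0 addr0.
by rewrite mulN1r addNr.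
Qed.

Lemma efDl g g' h : cperiodic g -> cperiodic g' -> cperiodic h ->
  B (fun x => g x + g' x) h = B g h + B g' h.
Proof.
move=> cg cg' ch; have := ef_lin EB 1 cg cg' ch; rewrite mul1r => <-.
by congr (B _ h); apply/funext => x; rewrite mul1r.
Qed.

Lemma efBl g g' h : cperiodic g -> cperiodic g' -> cperiodic h ->
  B (fun x => g x - g' x) h = B g h - B g' h.
Proof.
move=> cg cg' ch; have := ef_lin EB (-1) cg' cg ch; rewrite mulN1r addrC => <-.
by congr (B _ h); apply/funext => x; rewrite mulN1r addrC.
Qed.

Lemma ef_suml I (r : seq I) (g : I -> 'rV[R]_d -> R) h : (forall i, cperiodic (g i)) -> cperiodic h ->
  B (fun x => \sum_(i <- r) g i x) h = \sum_(i <- r) B (g i) h.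
Proof.
move=> cg ch; elim: r => [|i r IH].
  rewrite big_nil -[RHS](ef0l ch); congr (B _ h); apply/funext => x; by rewrite big_nil.
rewrite big_cons -IH -efDl//; last exact: cperiodic_sum.
by congr (B _ h); apply/funext => x; rewrite big_cons.
Qed.

End form_theory.

Section regular_fields.
Context {R : realType} {d : nat}.
Implicit Types (T t s : R).

Lemma smooth_derive (V W : normedModType R) (D : set V) (g : V -> W) (v : V) : smooth D g ->
  (forall x, D x -> derivable g x v) /\ smooth D ('D_v g).
Proof.
move=> sg; split=> [x Dx|k].
  by have [_ /(_ v)[+ _]] := sg 1%N; exact.
by have [_ /(_ v)[_ +]] := sg k.+1; exact.
Qed.

Lemma smooth_continuous (V W : normedModType R) (D : set V) (g : V -> W) : smooth D g ->
  forall x, D x -> {for x, continuous g}.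
Proof. by move=> /(_ 0%N)[]. Qed.

Definition regular (W : normedModType R) T (u : R -> 'rV[R]_d -> W) :=
  (forall t, 0 < t < T -> space_periodic (u t)) /\
  smooth (cylinder T) (fun z => u z.1 z.2).

Lemma spaceD (W : normedModType R) (u : R -> 'rV[R]_d -> W) v z :
  'D_(0, v) (fun z => u z.1 z.2) z = 'D_v (u z.1) z.2.
Proof.
by apply: eq_derive_at => r; rewrite /= scaler0 add0r.
Qed.

Lemma timeD (W : normedModType R) (u : R -> 'rV[R]_d -> W) z :
  'D_(1, 0) (fun z => u z.1 z.2) z = derive1 (fun s => u s z.2) z.1.
Proof.
by rewrite derive1E; apply: eq_derive_at => r; rewrite /= scaler0 add0r.
Qed.

Lemma regular_partial (W : normedModType R) T (u : R -> 'rV[R]_d -> W) j : regular T u ->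
  regular T (fun t => partial j (u t)).
Proof.
move=> [pu su]; split=> [t tT|]; first exact/periodic_derive/pu.
have [_] := smooth_derive ((0 : R), delta_mx 0 j) su.
by congr smooth; apply/funext => z; rewrite spaceD.
Qed.

Lemma regular_time (W : normedModType R) T (u : R -> 'rV[R]_d -> W) : regular T u ->
  regular T (fun t x => derive1 (fun s => u s x) t).
Proof.
move=> [pu su]; split=> [t tT x i|].
  rewrite !derive1E; apply: near_eq_derive.
  have : t \in `]0, T[ by rewrite in_itv.
  by move=> /near_in_itvoo; apply: filterS => s; rewrite in_itv/= => sT; rewrite pu.
have [_] := smooth_derive ((1 : R), (0 : 'rV[R]_d)) su.
by congr smooth; apply/funext => z; rewrite timeD.
Qed.

Lemma regular_derivable (W : normedModType R) T (u : R -> 'rV[R]_d -> W) t x v :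
  regular T u -> 0 < t < T -> derivable (u t) x v.
Proof.
move=> [pu su] tT; have [+ _] := smooth_derive ((0 : R), v) su.
move=> /(_ (t, x) tT); apply: eq_derivable_at => r.
by rewrite /= scaler0 add0r.
Qed.

Lemma regular_time_derive (W : normedModType R) T (u : R -> 'rV[R]_d -> W) t x :
  regular T u -> 0 < t < T -> is_derive t 1 (fun s => u s x) (derive1 (fun s => u s x) t).
Proof.
move=> [pu su] tT; apply: DeriveDef; last by rewrite derive1E.
have [+ _] := smooth_derive ((1 : R), (0 : 'rV[R]_d)) su.
move=> /(_ (t, x) tT); apply: eq_derivable_at => r.
by rewrite /= scaler0 add0r.
Qed.

Lemma regular_cperiodic_on T (u : R -> 'rV[R]_d -> R) : regular T u -> cperiodic_on T u.
Proof. by move=> [pu su]; split=> // z zT; exact: smooth_continuous su _ zT. Qed.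

Lemma regular_cperiodic_on_coord T (u : R -> 'rV[R]_d -> 'rV[R]_d) i : regular T u ->
  cperiodic_on T (fun t x => u t x 0 i).
Proof.
move=> [pu su]; split=> [t tT x j|z zT]; first by rewrite pu.
apply: (@continuous_comp _ _ _ (fun z => u z.1 z.2) (fun v : 'rV[R]_d => v 0 i)).
  exact: smooth_continuous su _ zT.
exact: coord_continuous.
Qed.

Lemma regular_pderiv T (p : R -> 'rV[R]_d -> R) t j : regular T p -> 0 < t < T ->
  pderiv j (p t) (partial j (p t)).
Proof.
move=> rp tT; split.
- exact: cperiodic_on_slice (regular_cperiodic_on rp) tT.
- exact: cperiodic_on_slice (regular_cperiodic_on (regular_partial j rp)) tT.
- by move=> x; apply: DeriveDef => //; exact: regular_derivable rp tT.
Qed.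

Lemma regular_pderiv_coord T (u : R -> 'rV[R]_d -> 'rV[R]_d) t i j : regular T u -> 0 < t < T ->
  pderiv j (fun x => u t x 0 i) (fun x => partial j (u t) x 0 i).
Proof.
move=> ru tT; split.
- exact: cperiodic_on_slice (regular_cperiodic_on_coord i ru) tT.
- exact: cperiodic_on_slice (regular_cperiodic_on_coord i (regular_partial j ru)) tT.
- move=> x; have dux : derivable (u t) x (delta_mx 0 j) := regular_derivable ru tT.
  apply: DeriveDef; first by move/derivable_mxP : dux; exact.
  by rewrite /partial (derive_mx dux) mxE.
Qed.

Lemma regular_time_coord T (u : R -> 'rV[R]_d -> 'rV[R]_d) t x i : regular T u -> 0 < t < T ->
  is_derive t 1 (fun s => u s x 0 i) (derive1 (fun s => u s x) t 0 i).
Proof.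
move=> ru tT; have [dux _] : is_derive t 1 (fun s => u s x)
  (derive1 (fun s => u s x) t) := regular_time_derive x ru tT.
apply: DeriveDef; first by move/derivable_mxP : dux; exact.
by rewrite derive1E (derive_mx dux) mxE.
Qed.

End regular_fields.

(** * Energy balances for the Navier-Stokes equations *)

Section balance.
Context {R : realType} {d : nat}.
Implicit Types (T t s : R) (u f : R -> 'rV[R]_d -> 'rV[R]_d) (v w : 'rV[R]_d -> 'rV[R]_d)
  (B : ('rV[R]_d -> R) -> ('rV[R]_d -> R) -> R).

Lemma pderiv_sum I (r : seq I) (g g' : I -> 'rV[R]_d -> R) j :
  (forall i, pderiv j (g i) (g' i)) ->
  pderiv j (fun x => \sum_(i <- r) g i x) (fun x => \sum_(i <- r) g' i x).
Proof.
move=> Dg; elim: r => [|i r IH].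
  apply: eq_pderiv (pderivZ 0 (pderiv_cosk 0 j)) => x; by rewrite big_nil mul0r.
by apply: eq_pderiv (pderivD (Dg i) IH) => x; rewrite big_cons.
Qed.

Definition vecform B v w := \sum_i B (fun x => v x 0 i) (fun x => w x 0 i).

Definition gradform B v := \sum_j vecform B (partial j v) (partial j v).

Definition vcperiodic v := forall i, cperiodic (fun x => v x 0 i).

Definition vcperiodic_on T u := forall i, cperiodic_on T (fun t x => u t x 0 i).

Lemma vcperiodic_on_slice T u t : vcperiodic_on T u -> 0 < t < T -> vcperiodic (u t).
Proof. by move=> tu tT i; exact: cperiodic_on_slice (tu i) tT. Qed.

Lemma regular_vcperiodic_on T u : regular T u -> vcperiodic_on T u.
Proof. by move=> ru i; exact: regular_cperiodic_on_coord. Qed.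

Lemma innerE v w : vcperiodic v -> vcperiodic w -> inner v w = vecform L2form v w.
Proof.
move=> cv cw; rewrite /inner torus_int_sum// => i _; exact: cperiodicM.
Qed.

Lemma innerC v w : inner v w = inner w v.
Proof.
by apply: eq_torus_int => x; apply: eq_bigr => i _; rewrite mulrC.
Qed.

Lemma vecformC B v w : energy_form B -> vecform B v w = vecform B w v.
Proof. by move=> EB; apply: eq_bigr => i _; rewrite (ef_sym EB). Qed.

Lemma grad_norm_sqE T u t : regular T u -> 0 < t < T ->
  grad_norm_sq (u t) = gradform L2form (u t).
Proof.
move=> ru tT; rewrite /grad_norm_sq /gradform /vecform exchange_big/=.
have cd i j : cperiodic (fun x => partial j (u t) x 0 i).
  exact: vcperiodic_on_slice (regular_vcperiodic_on (regular_partial j ru)) tT _.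
have cd2 i j : cperiodic (fun x => partial j (u t) x 0 i ^+ 2) by exact: cperiodicM.
rewrite torus_int_sum => [|i _]; last exact: cperiodic_sum.
apply: eq_bigr => i _; rewrite torus_int_sum//.
Qed.

Lemma vecform_continuous B T u f t : energy_form B -> vcperiodic_on T u -> vcperiodic_on T f ->
  0 < t < T ->
  {for t, continuous (fun s => vecform B (u s) (f s))}.
Proof.
move=> EB tu tf tT.
apply: (@cvg_sumr R _ (nbhs t) (nbhs_filter t) _ _
  (fun i s => B (fun x => u s x 0 i) (fun x => f s x 0 i))) => i.
exact: (ef_cont EB (tu i) (tf i) tT).
Qed.

Lemma gradform_continuous B T u t : energy_form B -> regular T u -> 0 < t < T ->
  {for t, continuous (fun s => gradform B (u s))}.
Proof.
move=> EB ru tT.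
apply: (@cvg_sumr R _ (nbhs t) (nbhs_filter t) _ _
  (fun j s => vecform B (partial j (u s)) (partial j (u s)))) => j.
have := regular_vcperiodic_on (regular_partial j ru) => tj.
exact: (vecform_continuous EB tj tj tT).
Qed.

Lemma advectionE v x i : advection v x 0 i = \sum_j v x 0 j * partial j v x 0 i.
Proof. by rewrite /advection summxE; apply: eq_bigr => j _; rewrite mxE. Qed.

Lemma advection_vcperiodic_on T u : regular T u -> vcperiodic_on T (fun t => advection (u t)).
Proof.
move=> ru i; apply: (@eq_cperiodic_on _ _ _ _ (fun t x =>
  \sum_j u t x 0 j * partial j (u t) x 0 i)) => [t x|].
  by rewrite advectionE.
apply: cperiodic_on_sum => j; apply: cperiodic_onM; first exact: regular_vcperiodic_on.
exact: (regular_vcperiodic_on (regular_partial j ru)).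
Qed.

Lemma divergenceE T u t x : regular T u -> 0 < t < T ->
  divergence (u t) x = \sum_i partial i (u t) x 0 i.
Proof.
move=> ru tT; apply: eq_bigr => i _.
by have [_ _ /(_ x)dx] := regular_pderiv_coord i i ru tT; rewrite {1}/partial derive_val.
Qed.

Variables (T : R) (u f : R -> 'rV[R]_d -> 'rV[R]_d) (p : R -> 'rV[R]_d -> R).
Hypotheses (ru : regular T u) (rf : regular T f) (rp : regular T p) (nse : NSE T u f p).

Lemma div_free t x : 0 < t < T -> \sum_i partial i (u t) x 0 i = 0.
Proof. by move=> tT; have [_] := nse x tT; rewrite (divergenceE x ru tT). Qed.

Lemma div_tensorE t x i : 0 < t < T -> div_tensor (u t) x 0 i = advection (u t) x 0 i.
Proof.
move=> tT; rewrite mxE advectionE.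
transitivity (\sum_j (u t x 0 j * partial j (u t) x 0 i + u t x 0 i * partial j (u t) x 0 j)).
  apply: eq_bigr => j _.
  have D := pderivM (regular_pderiv_coord i j ru tT) (regular_pderiv_coord j j ru tT).
  case: D => _ _ /(_ x) D; rewrite {1}/partial (@derive_val _ _ _ _ _ _ _ D).
  by congr (_ + _); rewrite mulrC.
by rewrite big_split/= -mulr_sumr div_free// mulr0 addr0.
Qed.

Lemma momentum t x i : 0 < t < T ->
  derive1 (fun s => u s x) t 0 i = \sum_j partial j (partial j (u t)) x 0 i
    - advection (u t) x 0 i - partial i (p t) x + f t x 0 i.
Proof.
move=> tT; have [H _] := nse x tT; rewrite -H -div_tensorE//.
rewrite /laplacian ![in RHS]mxE summxE; ring.
Qed.

(** The pressure disappears because derivatives are skew for [B] and u is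
    divergence free, and the Laplacian gives minus the gradient form. The
    transport term stays: truncation does not commute with products. *)
Lemma energy_balance B t : energy_form B -> 0 < t < T ->
  is_derive t 1 (fun s => vecform B (u s) (u s))
    (2 * (vecform B (f t) (u t) - gradform B (u t) - vecform B (advection (u t)) (u t))).
Proof.
move=> EB tT.
have rt := regular_time ru.
have D i : is_derive t 1 (fun s => B (fun x => u s x 0 i) (fun x => u s x 0 i))
    (2 * B (fun x => derive1 (fun s => u s x) t 0 i) (fun x => u t x 0 i)).
  apply: (ef_deriv EB (regular_vcperiodic_on ru i) (regular_vcperiodic_on rt i)) => // s x sT.
  exact: regular_time_coord ru sT.
have cu := vcperiodic_on_slice (regular_vcperiodic_on ru) tT.
have cf := vcperiodic_on_slice (regular_vcperiodic_on rf) tT.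
have ca := vcperiodic_on_slice (advection_vcperiodic_on ru) tT.
have cp i : cperiodic (partial i (p t)).
  exact: cperiodic_on_slice (regular_cperiodic_on (regular_partial i rp)) tT.
have cdd i j : cperiodic (fun x => partial j (partial j (u t)) x 0 i).
  exact: vcperiodic_on_slice (regular_vcperiodic_on (regular_partial j (regular_partial j ru))) tT i.
have E i : B (fun x => derive1 (fun s => u s x) t 0 i) (fun x => u t x 0 i) =
    - (\sum_j B (fun x => partial j (u t) x 0 i) (fun x => partial j (u t) x 0 i))
    - B (fun x => advection (u t) x 0 i) (fun x => u t x 0 i)
    + B (p t) (fun x => partial i (u t) x 0 i)
    + B (fun x => f t x 0 i) (fun x => u t x 0 i).
  pose F x := (\sum_j partial j (partial j (u t)) x 0 i - advection (u t) x 0 i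
    - partial i (p t) x) + f t x 0 i.
  transitivity (B F (fun x => u t x 0 i)).
    by congr (B _ _); apply/funext => x; exact: momentum.
  rewrite /F {F}.
  have cs : cperiodic (fun x => \sum_j partial j (partial j (u t)) x 0 i) by exact: cperiodic_sum.
  rewrite (efDl EB (cperiodicB (cperiodicB cs (ca i)) (cp i)) (cf i) (cu i)).
  rewrite (efBl EB (cperiodicB cs (ca i)) (cp i) (cu i)).
  rewrite (efBl EB cs (ca i) (cu i)) (ef_suml EB _ (cdd i) (cu i)).
  have -> : B (partial i (p t)) (fun x => u t x 0 i) = - B (p t) (fun x => partial i (u t) x 0 i).
    exact: (ef_skew EB (regular_pderiv i rp tT) (regular_pderiv_coord i i ru tT)).
  rewrite opprK; congr (_ + _); congr (_ + _); congr (_ + _).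
  rewrite -sumrN; apply: eq_bigr => j _.
  exact: (ef_skew EB (regular_pderiv_coord i j (regular_partial j ru) tT)
    (regular_pderiv_coord i j ru tT)).
have P0 : \sum_i B (p t) (fun x => partial i (u t) x 0 i) = 0.
  have cdu i : cperiodic (fun x => partial i (u t) x 0 i).
    by case: (regular_pderiv_coord i i ru tT).
  have cpt : cperiodic (p t) := cperiodic_on_slice (regular_cperiodic_on rp) tT.
  transitivity (B (fun x => \sum_i partial i (u t) x 0 i) (p t)).
    rewrite (ef_suml EB _ cdu cpt); apply: eq_bigr => i _; exact: (ef_sym EB).
  rewrite (_ : (fun x => _) = fun=> 0); last by apply/funext => x; rewrite div_free.
  exact: (ef0l EB cpt).
have S (r : seq 'I_d) : is_derive t 1
    (fun s => \sum_(i <- r) B (fun x => u s x 0 i) (fun x => u s x 0 i))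
    (\sum_(i <- r) (2 * B (fun x => derive1 (fun s => u s x) t 0 i) (fun x => u t x 0 i))).
  elim: r => [|i r IH].
    rewrite big_nil (_ : (fun _ => _) = cst 0); last by apply/funext => s; rewrite big_nil.
    exact: is_derive_cst.
  have := is_deriveD (D i) IH; rewrite big_cons.
  rewrite (_ : (fun s => \sum_(i0 <- i :: r) _) =
    (fun s => B (fun x => u s x 0 i) (fun x => u s x 0 i)) +
    (fun s => \sum_(i <- r) B (fun x => u s x 0 i) (fun x => u s x 0 i)))//.
  by apply/funext => s; rewrite big_cons.
apply: is_derive_eq (S (index_enum 'I_d)) _.
rewrite -mulr_sumr; congr (_ * _).
rewrite (eq_bigr _ (fun i _ => E i)) !big_split/= P0 !sumrN addr0 exchange_big/=.
by rewrite /gradform /vecform; ring.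
Qed.

(** For the full L2 product, transport preserves the energy: (u . grad u) . u is
    the divergence of u |u|^2 / 2. *)
Lemma advection_energy0 t : 0 < t < T -> vecform L2form (advection (u t)) (u t) = 0.
Proof.
move=> tT.
have ca := vcperiodic_on_slice (advection_vcperiodic_on ru) tT.
have cu := vcperiodic_on_slice (regular_vcperiodic_on ru) tT.
rewrite -innerE//.
(* the derivatives of u_j * N along j sum to twice the integrand *)
pose N x := \sum_i u t x 0 i * u t x 0 i.
pose N' j x := \sum_i 2 * (partial j (u t) x 0 i * u t x 0 i).
have DN j : pderiv j N (N' j).
  apply: pderiv_sum => i.
  apply: eq_pderiv (pderivM (regular_pderiv_coord i j ru tT) (regular_pderiv_coord i j ru tT)) => x//.
  by ring.
have DN2 j := pderivM (regular_pderiv_coord j j ru tT) (DN j).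
have cD j : cperiodic (fun x => partial j (u t) x 0 j * N x + u t x 0 j * N' j x).
  by have [] := DN2 j.
rewrite /inner (@eq_torus_int _ _ _ (fun x => 2^-1 *
    \sum_j (partial j (u t) x 0 j * N x + u t x 0 j * N' j x))) => [|x].
  rewrite torus_intZ; last exact: cperiodic_sum.
  rewrite torus_int_sum// big1 ?mulr0// => j _; exact: torus_int_pderiv (DN2 j).
rewrite big_split/= -mulr_suml div_free// mul0r add0r mulr_sumr.
transitivity (\sum_i \sum_j u t x 0 j * partial j (u t) x 0 i * u t x 0 i).
  by apply: eq_bigr => i _; rewrite advectionE mulr_suml.
rewrite exchange_big/=; apply: eq_bigr => j _; rewrite /N' !mulr_sumr.
by apply: eq_bigr => i _; field.
Qed.

End balance.

(** * Integrals over time intervals *)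

Section time_integrals.
Context {R : realType}.
Local Notation mu := (@lebesgue_measure R).
Variable T : R.
Implicit Types (g h G H K : R -> R) (a b c s t : R).

Definition time_continuous g := forall t, 0 < t < T -> {for t, continuous g}.

Definition itv_int g a b := int_between g (a, b).

Lemma time_continuousB g h : time_continuous g -> time_continuous h ->
  time_continuous (fun t => g t - h t).
Proof. by move=> cg ch t tT; apply: cvgB; [exact: cg|exact: ch]. Qed.

Lemma time_continuousD g h : time_continuous g -> time_continuous h ->
  time_continuous (fun t => g t + h t).
Proof. by move=> cg ch t tT; apply: cvgD; [exact: cg|exact: ch]. Qed.

Lemma time_continuous_within g a b : time_continuous g -> 0 < a -> b < T ->
  {within `[a, b], continuous g}.
Proof.
move=> cg a0 bT; apply: continuous_in_subspaceT => t /set_mem/=; rewrite in_itv/= => /andP[at_ tb].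
by apply: cg; rewrite (lt_le_trans a0)//= (le_lt_trans tb).
Qed.

Lemma time_continuous_integrable g a b : time_continuous g -> 0 < a -> b < T ->
  mu.-integrable `[a, b] (EFin \o g).
Proof.
move=> cg a0 bT; apply: continuous_compact_integrable; first exact: segment_compact.
exact: time_continuous_within.
Qed.

Lemma itv_int_chasles g a b c : time_continuous g -> 0 < a -> a <= b -> b <= c -> c < T ->
  itv_int g a c = itv_int g a b + itv_int g b c.
Proof.
move=> cg a0 ab bc cT; rewrite /itv_int /int_between/=.
have E := @Rintegral_itvB R g (BLeft a) (BRight c) b (time_continuous_integrable cg a0 cT).
apply/eqP; rewrite addrC -subr_eq; apply/eqP; rewrite E ?bnd_simp//.
apply: Rintegral_itv_obnd_cbnd.
apply: integrableS (time_continuous_integrable cg a0 cT) => //.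
by apply: subset_itv; rewrite bnd_simp.
Qed.

Lemma itv_int_empty g a b : b < a -> itv_int g a b = 0.
Proof. by move=> ba; rewrite /itv_int /int_between/= set_itv_ge ?Rintegral_set0// bnd_simp -ltNge. Qed.

Lemma itv_int_same g a : itv_int g a a = 0.
Proof. by rewrite /itv_int /int_between/= set_itv1 Rintegral_set1. Qed.

(** The integral from c to t for either order of c and t, as one of the two
    intervals is empty or a point. *)
Definition primitive g c t := itv_int g c t - itv_int g t c.

Lemma itv_int_primitive g c a b : time_continuous g -> 0 < c < T -> 0 < a -> a <= b -> b < T ->
  itv_int g a b = primitive g c b - primitive g c a.
Proof.
move=> cg /andP[c0 cT] a0 ab bT; rewrite /primitive.
have [ac|ca] := leP a c; have [bc|cb] := leP b c.
- rewrite (itv_int_chasles cg a0 ab bc cT).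
  have [ac'|] := ltP a c; last first.
    move=> ca; have -> : a = c by apply/le_anti; rewrite ac.
    have -> : b = c by apply/le_anti; rewrite bc (le_trans ca ab).
    by rewrite !itv_int_same; ring.
  rewrite (itv_int_empty g ac').
  have [bc'|cb] := ltP b c; first by rewrite (itv_int_empty g bc'); ring.
  have -> : b = c by apply/le_anti; rewrite bc.
  by rewrite !itv_int_same; ring.
- rewrite (itv_int_chasles cg a0 ac (ltW cb) bT) (itv_int_empty g cb).
  have [ac'|ca] := ltP a c; first by rewrite (itv_int_empty g ac'); ring.
  have -> : a = c by apply/le_anti; rewrite ac.
  by rewrite !itv_int_same; ring.
- by have := lt_le_trans ca ab; rewrite ltNge bc.
- rewrite (itv_int_chasles cg c0 (ltW ca) ab bT) (itv_int_empty g ca) (itv_int_empty g cb); ring.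
Qed.

Lemma itv_intB g h a b : time_continuous g -> time_continuous h -> 0 < a -> b < T ->
  itv_int (fun t => g t - h t) a b = itv_int g a b - itv_int h a b.
Proof.
move=> cg ch a0 bT; apply: RintegralB => //; exact: time_continuous_integrable.
Qed.

Lemma le_itv_int g h a b : time_continuous g -> time_continuous h -> 0 < a -> b < T ->
  (forall t, a <= t <= b -> g t <= h t) -> itv_int g a b <= itv_int h a b.
Proof.
move=> cg ch a0 bT gh; apply: le_Rintegral => //; try exact: time_continuous_integrable.
Qed.

Lemma itv_int_cst (M : R) a b : a <= b -> itv_int (fun=> M) a b = M * (b - a).
Proof.
move=> ab; rewrite /itv_int /int_between/= Rintegral_cst//; congr (_ * _).
transitivity (fine (if (a%:E < b%:E)%E then (b%:E - a%:E)%E else 0%E)).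
  by congr fine; exact: lebesgue_measure_itv.
by rewrite lte_fin; case: ltgtP ab => // -> _; rewrite subrr.
Qed.

Lemma norm_itv_int_le g a b (M : R) : time_continuous g -> 0 < a -> a <= b -> b < T ->
  (forall t, a <= t <= b -> `|g t| <= M) -> `|itv_int g a b| <= M * (b - a).
Proof.
move=> cg a0 ab bT gM.
have cM (m : R) : time_continuous (fun=> m) by move=> t _; exact: cst_continuous.
rewrite ler_norml; apply/andP; split.
  rewrite -mulNr -itv_int_cst//; apply: le_itv_int => // t /gM; rewrite ler_norml => /andP[]//.
by rewrite -itv_int_cst//; apply: le_itv_int => // t /gM; rewrite ler_norml => /andP[].
Qed.

Lemma itv_int_ge0 g a b : time_continuous g -> 0 < a -> b < T -> (forall t, a <= t <= b -> 0 <= g t) ->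
  0 <= itv_int g a b.
Proof.
move=> cg a0 bT g0; rewrite (le_trans _ (@le_itv_int (fun=> 0) g a b _ cg a0 bT g0))//.
  by rewrite /itv_int /int_between Rintegral_cst// mul0r.
by move=> t _; exact: cst_continuous.
Qed.

Lemma itv_int_derive H h a b : time_continuous h -> (forall t, 0 < t < T -> is_derive t 1 H (h t)) ->
  0 < a -> a <= b -> b < T -> itv_int h a b = H b - H a.
Proof.
move=> ch dH a0; rewrite le_eqVlt => /predU1P[<- _|ab bT]; first by rewrite itv_int_same subrr.
have I t : a <= t <= b -> 0 < t < T.
  by move=> /andP[at_ tb]; rewrite (lt_le_trans a0)//= (le_lt_trans tb).
have cH t : a <= t <= b -> {for t, continuous H}.
  move=> /I tT; apply/differentiable_continuous/derivable1_diffP.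
  exact: (@ex_derive _ _ _ _ _ _ _ (dH t tT)).
have FTC := @continuous_FTC2 R h H a b ab (time_continuous_within ch a0 bT).
rewrite /itv_int /int_between /Rintegral /= FTC//.
- split.
  + move=> t; rewrite in_itv/= => /andP[at_ tb].
    apply: (@ex_derive _ _ _ _ _ _ _ (dH t _)); apply: I; by rewrite !ltW.
  + by apply: cvg_at_right_filter; apply: cH; rewrite lexx ltW.
  + by apply: cvg_at_left_filter; apply: cH; rewrite lexx ltW.
- move=> t; rewrite in_itv/= => /andP[at_ tb].
  rewrite derive1E; apply: (@derive_val _ _ _ _ _ _ _ (dH t _)).
  by apply: I; rewrite !ltW.
Qed.

Lemma time_continuous_bounded g a b : time_continuous g -> 0 < a -> b < T ->
  exists2 M : R, 0 < M & forall t, a <= t <= b -> `|g t| <= M.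
Proof.
move=> cg a0 bT.
have /compact_bounded[M [_ HM]] :=
  continuous_compact (time_continuous_within cg a0 bT) (@segment_compact _ a b).
exists (`|M| + 1) => [|t tab]; first by rewrite ltr_pwDr.
apply: (HM (`|M| + 1) _ (g t)); last by exists t => //=; rewrite in_itv.
by rewrite (le_lt_trans (ler_norm _))// ltrDl.
Qed.

Lemma norm_primitive_le g c a b (M : R) : time_continuous g -> 0 < c < T -> 0 < a -> a <= b -> b < T ->
  (forall t, a <= t <= b -> `|g t| <= M) -> `|primitive g c b - primitive g c a| <= M * (b - a).
Proof. by move=> cg cT a0 ab bT gM; rewrite -(itv_int_primitive cg cT)//; exact: norm_itv_int_le. Qed.

Lemma primitive_time_continuous g c : time_continuous g -> 0 < c < T -> time_continuous (primitive g c).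
Proof.
move=> cg cT t /andP[t0 tT].
have [M M0 gM] := @time_continuous_bounded g (t / 2) ((t + T) / 2) cg ltac:(lra) ltac:(lra).
have t2 : 0 < t / 2 by lra.
have tT2 : (t + T) / 2 < T by lra.
have L r s : t / 2 <= r -> r <= s -> s <= (t + T) / 2 ->
    `|primitive g c s - primitive g c r| <= M * (s - r).
  move=> tr rs sT; apply: (norm_primitive_le cg cT (lt_le_trans t2 tr) rs (le_lt_trans sT tT2)).
  by move=> q /andP[rq qs]; apply: gM; rewrite (le_trans tr rq) (le_trans qs sT).
have [tt1 tt2] : t / 2 <= t /\ t <= (t + T) / 2 by split; lra.
apply/cvgrPdist_lt => e e0; near=> s.
have s1 : t / 2 <= s by apply: ltW; near: s; apply: lt_nbhsr; lra.
have s2 : s <= (t + T) / 2 by apply: ltW; near: s; apply: lt_nbhsl; lra.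
have st : `|t - s| < e / M by near: s; apply/nbhs_ballP; exists (e / M) => //=; rewrite divr_gt0.
have B : `|primitive g c t - primitive g c s| <= M * `|t - s|.
  have [ts|/ltW st'] := leP t s.
    by rewrite distrC (distrC t) (ger0_norm (_ : 0 <= s - t)) ?subr_ge0//; exact: L.
  by rewrite (ger0_norm (_ : 0 <= t - s)) ?subr_ge0//; exact: L.
by apply: (le_lt_trans B); rewrite mulrC -ltr_pdivlMr.
Unshelve. all: by end_near. Qed.

Lemma int_between_cvg g K a b (la lb : R) : a < b ->
  (forall s t, a < s -> s <= t -> t < b -> itv_int g s t = K t - K s) ->
  K s @[s --> a^'+] --> la -> K s @[s --> b^'-] --> lb ->
  int_between g ab @[ab --> filter_prod a^'+ b^'-] --> lb - la.
Proof.
move=> ab gK Kla Klb.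
have Km : K ab.2 - K ab.1 @[ab --> filter_prod a^'+ b^'-] --> lb - la.
  apply: cvgB; first exact: cvg_comp cvg_snd Klb.
  exact: cvg_comp cvg_fst Kla.
apply: cvg_trans Km; apply: near_eq_cvg.
pose m := (a + b) / 2.
have am : a < m by rewrite /m; lra.
have mb : m < b by rewrite /m; lra.
have nA : \forall s \near a^'+, a < s < m.
  by near=> s; apply/andP; split=> //; near: s; exact: nbhs_right_lt am.
have nB : \forall s \near b^'-, m < s < b.
  by near=> s; apply/andP; split=> //; near: s; exact: nbhs_left_gt mb.
exists ([set s | a < s < m], [set t | m < t < b]); first by split.
move=> [s t]/= [/andP[as_ sm] /andP[mt tb]].
by rewrite -gK// ltW// (lt_trans sm).
Unshelve. all: by end_near. Qed.

Lemma improper_intE g K a b (la lb : R) : a < b ->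
  (forall s t, a < s -> s <= t -> t < b -> itv_int g s t = K t - K s) ->
  K s @[s --> a^'+] --> la -> K s @[s --> b^'-] --> lb ->
  improper_int g a b = lb - la.
Proof. by move=> ab gK Kla Klb; apply: cvg_lim => //; exact: int_between_cvg gK Kla Klb. Qed.

Lemma improper_int_same g a : improper_int g a a = 0.
Proof.
apply: cvg_lim => //; apply: cvg_near_cst.
exists ([set s | a < s], [set t | t < a]); first by split; [exact: nbhs_right_gt|exact: nbhs_left_lt].
by move=> [s t]/= [as_ ta]; rewrite -[RHS](@itv_int_empty g s t)// (lt_trans ta).
Qed.

Lemma cauchy_at (F : set_system R) (FF : ProperFilter F) K :
  (forall e : R, 0 < e -> exists c, \forall s \near F, `|K s - c| <= e) ->
  cvg (K s @[s --> F]).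
Proof.
move=> H; apply/cauchy_cvgP; apply: cauchy_exP => e e0.
have e20 : 0 < e / 2 by rewrite divr_gt0.
have [c Hc] := H _ e20; exists c; apply: filterS Hc => s sc.
by rewrite -ball_normE/= distrC (le_lt_trans sc)// ltr_pdivrMr// ltr_pMr// ltr1n.
Qed.

Hypothesis T0 : 0 < T.

(** Fixing one end point in the joint limit leaves a Cauchy condition at the
    other. *)
Lemma in_calL_primitive g c : time_continuous g -> in_calL T g -> 0 < c < T ->
  cvg (primitive g c s @[s --> 0^'+]) /\ cvg (primitive g c s @[s --> T^'-]).
Proof.
move=> cg [_ [l /cvgrPdist_le gl]] cT.
have T20 : 0 < T / 2 by rewrite divr_gt0.
split; apply: cauchy_at => e e0.
- have [[A B]/= [A0 BT] AB] := gl _ e0.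
  have [b [Bb b1 b2]] : exists b, [/\ B b, T / 2 < b & b < T].
    near T^'- => b; exists b; split; first by near: b.
    + by near: b; apply: nbhs_left_gt; lra.
    + by [].
  exists (primitive g c b - l).
  near=> a.
  have a0 : 0 < a by near: a; exact: nbhs_right_gt.
  have ab : a < T / 2 by near: a; exact: nbhs_right_lt.
  have Aa : A a by near: a.
  have := AB (a, b) (conj Aa Bb); rewrite /= -/(itv_int g a b) (itv_int_primitive cg cT)//; last first.
    by rewrite ltW// (lt_trans ab).
  by congr (`|_| <= _); ring.
- have [[A B]/= [A0 BT] AB] := gl _ e0.
  have [a [Aa a1 a2]] : exists a, [/\ A a, 0 < a & a < T / 2].
    near (0 : R)^'+ => a; exists a; split; first by near: a.
    + by [].
    + by near: a; exact: nbhs_right_lt.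
  exists (primitive g c a + l).
  near=> b.
  have b1 : T / 2 < b by near: b; apply: nbhs_left_gt; lra.
  have bT : b < T by near: b; exact: nbhs_left_lt.
  have Bb : B b by near: b.
  have := AB (a, b) (conj Aa Bb); rewrite /= -/(itv_int g a b) (itv_int_primitive cg cT)//; last first.
    by rewrite ltW// (lt_trans a2).
  by rewrite -normrN; congr (`|_| <= _); ring.
Unshelve. all: by end_near. Qed.

(** Near T the integrand is bounded, so the primitive is Lipschitz there. *)
Lemma primitive_cvg_left g c (l : R) : time_continuous g -> 0 < c < T -> g s @[s --> T^'-] --> l ->
  cvg (primitive g c s @[s --> T^'-]).
Proof.
move=> cg cT gl; apply: cauchy_at => e e0.
have M0 : 0 < `|l| + 1 by rewrite ltr_pwDr.
have [t0 [t0c t0T Ht]] : exists t0, [/\ c < t0, t0 < T &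
    (`|l| + 1) * (T - t0) <= e /\ forall t, t0 <= t < T -> `|g t| <= `|l| + 1].
  have : \forall t \near T^'-, `|g t| <= `|l| + 1.
    move/cvgrPdist_lt : gl => /(_ 1 ltr01); apply: filterS => t lt1.
    rewrite -(subrK l (g t)) (le_trans (ler_normD _ _))// addrC lerD2l ltW//.
    by rewrite distrC.
  move=> /nbhs_ballP[r /= r0 Hr].
  have er : 0 < e / (`|l| + 1) by rewrite divr_gt0.
  case/andP: (cT) => _ c1.
  pose t0 := Num.max (Num.max ((c + T) / 2) (T - r / 2)) (T - e / (`|l| + 1)).
  have h1 : (c + T) / 2 <= t0 by rewrite !le_max lexx.
  have h2 : T - r / 2 <= t0 by rewrite !le_max lexx orbT.
  have h3 : T - e / (`|l| + 1) <= t0 by rewrite !le_max lexx orbT.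
  have t0T : t0 < T by rewrite !gt_max; apply/andP; split; [apply/andP; split|]; lra.
  exists t0; split => //; first lra.
  split; first by rewrite mulrC -ler_pdivlMr//; lra.
  move=> t /andP[tt tT]; apply: Hr => //=.
  rewrite -ball_normE/= ger0_norm ?subr_ge0 ?(ltW tT)//; lra.
exists (primitive g c t0).
case: Ht => He Hg.
near=> s.
have st : t0 <= s by apply: ltW; near: s; exact: nbhs_left_gt.
have sT : s < T by near: s; exact: nbhs_left_lt.
case/andP: (cT) => c0 _.
apply: (le_trans (norm_primitive_le cg cT (lt_trans c0 t0c) st sT _)).
  by move=> t /andP[t1 t2]; apply: Hg; rewrite t1 (le_lt_trans t2).
by apply: le_trans He; rewrite ler_pM2l// lerD2r ltW.
Unshelve. all: by end_near. Qed.

Definition is_primitive_on g K a b (la lb : R) :=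
  [/\ forall s t, a < s -> s <= t -> t < b -> itv_int g s t = K t - K s,
     K s @[s --> a^'+] --> la & K s @[s --> b^'-] --> lb].

Lemma time_continuous_measurable g a b : time_continuous g -> 0 <= a -> b <= T ->
  measurable_fun (`]a, b[%classic : set R) g.
Proof.
move=> cg a0 bT; apply: open_continuous_measurable_fun.
  exact: interval_open.
move=> t /set_mem/=; rewrite in_itv/= => /andP[at_ tb].
by apply: cg; rewrite (le_lt_trans a0)//= (lt_le_trans tb).
Qed.

(** Monotone convergence along an exhaustion by compact intervals. *)
Lemma integral_oo G K a b (la lb : R) : time_continuous G -> (forall t, 0 < t < T -> 0 <= G t) ->
  0 <= a -> a < b -> b <= T -> is_primitive_on G K a b la lb ->
  (\int[mu]_(t in `]a, b[) (G t)%:E)%E = (lb - la)%:E.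
Proof.
move=> cG G0 a0 ab bT [GK Kla Klb].
pose r (n : nat) : R := (b - a) / n.+3%:R.
have r0 n : 0 < r n by rewrite divr_gt0// subr_gt0.
have rh n : r n < (b - a) / 2.
  by rewrite ltr_pM2l ?subr_gt0// ltf_pV2 ?posrE// ltr_nat.
have rle n m : (n <= m)%N -> r m <= r n.
  by move=> nm; rewrite ler_pM2l ?subr_gt0// lef_pV2 ?posrE// ler_nat.
have rcvg : r n @[n --> \oo] --> 0.
  rewrite -(mulr0 (b - a)); apply: cvgM; first exact: cvg_cst.
  have := @cvg_harmonic R; rewrite -(cvg_shiftn 2) /harmonic.
  by apply: cvg_trans; apply: near_eq_cvg; apply: nearW => n /=; rewrite addn2.
pose F (n : nat) : set R := `[a + r n, b - r n]%classic.
have FU : \bigcup_n F n = `]a, b[%classic.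
  apply/seteqP; split => [t [n _]|t]; rewrite /F /= !in_itv/= => /andP[t1 t2].
    by have rn := r0 n; apply/andP; split; lra.
  have m0 : 0 < Num.min (t - a) (b - t) by rewrite lt_min !subr_gt0 t1.
  have [n _ Hn] : \forall n \near \oo, r n < Num.min (t - a) (b - t).
    by move/cvgr_lt : rcvg; apply.
  exists n => //; have := Hn n (leqnn n); rewrite /= in_itv/= lt_min => /andP[h1 h2].
  by apply/andP; split; lra.
have Fi n t : F n t -> 0 < t < T.
  by rewrite /F/= in_itv/= => /andP[t1 t2]; have rn := r0 n; apply/andP; split; lra.
have F1 : (\int[mu]_(x in F n) (G x)%:E)%E @[n --> \oo] -->
    (\int[mu]_(x in \bigcup_n F n) (G x)%:E)%E.
  apply: ge0_nondecreasing_set_cvg_integral.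
  - move=> n m nm; apply/subsetPset; apply: subset_itv; rewrite bnd_simp.
      by rewrite lerD2l rle.
    by rewrite lerD2l lerN2 rle.
  - move=> n; exact: measurable_itv.
  - move=> n; apply/measurable_EFinP.
    apply: (measurable_funS (E := `]a, b[%classic)) => //; last exact: time_continuous_measurable.
    by rewrite -FU; exact: bigcup_sup.
  - by move=> n t /Fi tT; rewrite lee_fin G0.
have F2 : (\int[mu]_(x in F n) (G x)%:E)%E @[n --> \oo] --> (lb - la)%:E.
  have E n : (\int[mu]_(x in F n) (G x)%:E)%E = (K (b - r n) - K (a + r n))%:E.
    have rn1 := r0 n; have rn2 := rh n.
    rewrite -GK; [|lra..].
    rewrite /itv_int /int_between/= /Rintegral fineK//.
    have := integrable_fin_num _ (@time_continuous_integrable G (a + r n) (b - r n) cG _ _).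
    by apply; [exact: measurable_itv|lra..].
  rewrite (_ : (fun n => _) = (fun n => (K (b - r n) - K (a + r n))%:E)); last exact/funext.
  apply/fine_cvgP; split; first exact: nearW.
  apply: cvgB.
  - move/cvg_at_leftP : Klb; apply; split=> [n|]; first by rewrite gtrBl.
    by rewrite -[X in _ --> X]subr0; apply: cvgB => //; exact: cvg_cst.
  - move/cvg_at_rightP : Kla; apply; split=> [n|]; first by rewrite ltrDl.
    by rewrite -[X in _ --> X]addr0; apply: cvgD => //; exact: cvg_cst.
by rewrite -FU; apply: (cvg_unique _ F1 F2).
Qed.

(** The dominating function has a primitive with finite limits, hence is
    integrable by [integral_oo]. *)
Lemma integral_oo_dominated G K a b (la lb : R) (h L : nat -> R -> R) (la' lb' : nat -> R) :
  time_continuous G -> 0 <= a -> a < b -> b <= T -> is_primitive_on G K a b la lb ->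
  (forall q, time_continuous (h q)) -> (forall q t, 0 < t < T -> 0 <= h q t <= G t) ->
  (forall t, 0 < t < T -> h q t @[q --> \oo] --> (0 : R)) ->
  (forall q, is_primitive_on (h q) (L q) a b (la' q) (lb' q)) ->
  lb' q - la' q @[q --> \oo] --> (0 : R).
Proof.
move=> cG a0 ab bT GK ch hG h0 hL.
have I t : t \in `]a, b[ -> 0 < t < T.
  by rewrite in_itv/= => /andP[at_ tb]; rewrite (le_lt_trans a0)//= (lt_le_trans tb).
have G0 t : 0 < t < T -> 0 <= G t.
  by move=> tT; have /andP[h1 h2] := hG 0%N t tT; exact: le_trans h1 h2.
have mG : measurable_fun (`]a, b[%classic : set R) (fun t => (G t)%:E).
  by apply/measurable_EFinP; exact: time_continuous_measurable.
have iG : mu.-integrable `]a, b[ (fun t => (G t)%:E).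
  apply/integrableP; split => //.
  apply: (@le_lt_trans _ _ (\int[mu]_(t in `]a, b[) (G t)%:E)%E).
    rewrite le_eqVlt; apply/orP; left; apply/eqP/eq_integral => t /set_mem/= /I tT.
    by rewrite ger0_norm// G0.
  by rewrite (integral_oo cG G0 a0 ab bT GK) ltry.
have D : (\int[mu]_(t in `]a, b[) (h q t)%:E)%E @[q --> \oo] --> (\int[mu]_(t in `]a, b[) 0)%E.
  apply: (@dominated_cvg _ (measurableTypeR R) R mu `]a, b[%classic (measurable_itv _)
    (fun q t => (h q t)%:E) (fun=> 0%E) (fun t => (G t)%:E)) => //.
  - by move=> q; apply/measurable_EFinP; exact: time_continuous_measurable.
  - by move=> t /= /I tT; apply/fine_cvgP; split; [exact: nearW|exact: h0].
  - move=> q t /= /I tT; have /andP[h1 h2] := hG q t tT.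
    by rewrite lee_fin ger0_norm.
move: D; rewrite integral0.
rewrite (_ : (fun q => _) = (fun q => (lb' q - la' q)%:E)); last first.
  apply/funext => q; apply: (integral_oo (ch q) _ a0 ab bT (hL q)) => t tT.
  by have /andP[] := hG q t tT.
by move=> /fine_cvgP[_].
Qed.

End time_integrals.

(** * Square-integrable fields *)

Section L2.
Context {R : realType} {d : nat}.
Implicit Types (v w z : 'rV[R]_d -> 'rV[R]_d).
Local Notation tm := (torus_measure d : {finite_measure set (d.-tuple (measurableTypeR R)) -> \bar R}).

Definition square_integrable v := forall i, (fun x => v (row_of_tuple x) 0 i) \in Lfun tm 2%:E.

Lemma inL2_square_integrable v : inL2 v -> square_integrable v.
Proof. by case. Qed.

Lemma vcperiodic_square_integrable v : vcperiodic v -> square_integrable v.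
Proof.
move=> cv i; rewrite inE/=; apply/andP; split; rewrite inE/=.
  exact: measurable_continuous_row (proj1 (cv i)).
rewrite /finite_norm unlock poweR_lty//=.
have := integrable_lty measurableT (cperiodic_integrable (cperiodicM (cv i) (cv i))).
apply: le_lt_trans; rewrite le_eqVlt; apply/orP; left; apply/eqP/eq_integral => x _ /=.
by rewrite -expr2 powR_mulrn// real_normK// num_real.
Qed.

Lemma vcperiodic_inL2 v : vcperiodic v -> inL2 v.
Proof.
move=> cv; split; last exact: vcperiodic_square_integrable.
by move=> x i; apply/rowP => j; rewrite (proj2 (cv j)).
Qed.

Lemma square_integrable_lin a v w : square_integrable v -> square_integrable w ->
  square_integrable (fun x => a *: v x + w x).
Proof.
move=> sv sw i.
have -> : (fun x => (a *: v (row_of_tuple x) + w (row_of_tuple x)) 0 i) =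
  ((a \o* (fun x => v (row_of_tuple x) 0 i)) \+ (fun x => w (row_of_tuple x) 0 i)).
  by apply/funext => x /=; rewrite !mxE mulrC.
have H2 : (1 <= 2%:E :> \bar R)%E by rewrite lee_fin ler1n.
have [_ H] := @Lfun_addr_closed _ _ _ tm 2%:E H2.
apply: H; last exact: sw.
apply: Lfun_scale; last exact: sv.
by rewrite ler1n.
Qed.

Lemma square_integrable_inner v w : square_integrable v -> square_integrable w ->
  tm.-integrable setT (EFin \o (fun x => \sum_i v (row_of_tuple x) 0 i * w (row_of_tuple x) 0 i)).
Proof.
move=> sv sw.
apply: (eq_integrable measurableT (fun x => (\sum_i (v (row_of_tuple x) 0 i * w
  (row_of_tuple x) 0 i)%:E)%E)).
  by move=> x _ /=; rewrite sumEFin.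
apply: integrable_sum => // i _.
by apply/Lfun1_integrable; exact: Lfun2_mul_Lfun1.
Qed.

Lemma inner_linl a v w z : square_integrable v -> square_integrable w -> square_integrable z ->
  inner (fun x => a *: v x + w x) z = a * inner v z + inner w z.
Proof.
move=> sv sw sz; rewrite /inner /torus_int.
have iv := square_integrable_inner sv sz; have iw := square_integrable_inner sw sz.
have iav : tm.-integrable setT (EFin \o (fun x => a *
    \sum_i v (row_of_tuple x) 0 i * z (row_of_tuple x) 0 i)).
  by apply: eq_integrable (integrableZl measurableT a iv) => // x _ /=; rewrite EFinM.
rewrite -RintegralZl// -RintegralD//.
apply: eq_Rintegral => x _; rewrite mulr_sumr -big_split/=.
by apply: eq_bigr => i _; rewrite !mxE; ring.
Qed.

Lemma inner_ge0 v : 0 <= inner v v.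
Proof.
by apply: torus_int_ge0 => x; apply: sumr_ge0 => i _; rewrite -expr2 sqr_ge0.
Qed.

Lemma L2norm_sqr v : L2norm v ^+ 2 = inner v v.
Proof. by rewrite sqr_sqrtr// inner_ge0. Qed.

Lemma inner_lin2 a v w : square_integrable v -> square_integrable w ->
  inner (fun x => a *: v x + w x) (fun x => a *: v x + w x) =
  a ^+ 2 * inner v v + 2 * a * inner v w + inner w w.
Proof.
move=> sv sw; have s := square_integrable_lin a sv sw.
have E y : square_integrable y -> inner y (fun x => a *: v x + w x) = a * inner y v + inner y w.
  by move=> sy; rewrite innerC inner_linl// (innerC v) (innerC w).
by rewrite inner_linl// !E// (innerC w v); ring.
Qed.

(** The quadratic polynomial a |-> |a v + w|^2 is nonnegative at its minimum. *)
Lemma cauchy_schwarz v w : square_integrable v -> square_integrable w ->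
  `|inner v w| <= L2norm v * L2norm w.
Proof.
move=> sv sw; rewrite -sqrtrM ?inner_ge0// -sqrtr_sqr ler_sqrt ?mulr_ge0 ?inner_ge0//.
have H a : 0 <= a ^+ 2 * inner v v + 2 * a * inner v w + inner w w.
  by rewrite -inner_lin2// inner_ge0.
have := inner_ge0 v; rewrite le_eqVlt => /predU1P[v0|v0].
  rewrite -v0 mul0r; have [->|b0] := eqVneq (inner v w) 0; first by rewrite expr0n.
  have := H (- (inner w w + 1) / (2 * inner v w)).
  rewrite -v0 mulr0 add0r.
  have -> : 2 * (- (inner w w + 1) / (2 * inner v w)) * inner v w = - (inner w w + 1) by field.
  by rewrite opprD addrAC addNr add0r oppr_ge0 ler10.
have := H (- inner v w / inner v v).
have -> : (- inner v w / inner v v) ^+ 2 * inner v v + 2 * (- inner v w / inner v v) * inner v w +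
   inner w w = (inner v v * inner w w - inner v w ^+ 2) / inner v v by field; rewrite lt0r_neq0.
by rewrite pmulr_lge0 ?invr_gt0// subr_ge0.
Qed.

End L2.

(** * Primitives up to the ends of the time interval *)

Section closed_interval.
Context {R : realType} (T : R).
Hypothesis T0 : 0 < T.
Local Notation mu := (@lebesgue_measure R).
Implicit Types (g h K : R -> R) (a b t : R).

Lemma eq_time_continuous g h : (forall t, 0 < t < T -> g t = h t) -> time_continuous T h ->
  time_continuous T g.
Proof.
move=> gh ch t tT; rewrite /prop_for /continuous_at gh//.
apply: cvg_trans (ch t tT); apply: near_eq_cvg.
have : t \in `]0, T[ by rewrite in_itv.
by move=> /near_in_itvoo; apply: filterS => s; rewrite in_itv/= => sT; rewrite gh.
Qed.

Lemma closed_cvg_right K h a : (forall t, 0 < t < T -> K t = h t) -> time_continuous T h ->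
  h s @[s --> 0^'+] --> K 0 -> 0 <= a < T -> K s @[s --> a^'+] --> K a.
Proof.
move=> Kh ch h0 /andP[a0 aT].
have E : \forall s \near a^'+, h s = K s.
  near=> s; rewrite Kh//; apply/andP; split.
    by apply: le_lt_trans a0 _; near: s; exact: nbhs_right_gt.
  by near: s; exact: nbhs_right_lt.
move: E a0; have [<- E _|aN E a0] := eqVneq 0 a.
  by apply: cvg_trans h0; exact: near_eq_cvg.
have {}a0 : 0 < a by rewrite lt_neqAle aN.
rewrite Kh ?a0//; apply: cvg_trans (cvg_at_right_filter (ch a _)); last by rewrite a0.
exact: near_eq_cvg.
Unshelve. all: by end_near. Qed.

Lemma closed_cvg_left K h b : (forall t, 0 < t < T -> K t = h t) -> time_continuous T h ->
  h s @[s --> T^'-] --> K T -> 0 < b <= T -> K s @[s --> b^'-] --> K b.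
Proof.
move=> Kh ch hT /andP[b0 bT].
have E : \forall s \near b^'-, h s = K s.
  near=> s; rewrite Kh//; apply/andP; split.
    by near: s; exact: nbhs_left_gt.
  by apply: lt_le_trans bT; near: s; exact: nbhs_left_lt.
move: E bT; have [-> E _|bN E bT] := eqVneq b T.
  by apply: cvg_trans hT; exact: near_eq_cvg.
have {}bT : b < T by rewrite lt_neqAle bN.
rewrite Kh ?b0//; apply: cvg_trans (cvg_at_left_filter (ch b _)); last by rewrite b0.
exact: near_eq_cvg.
Unshelve. all: by end_near. Qed.

Lemma closed_primitive g K h : (forall t, 0 < t < T -> K t = h t) -> time_continuous T h ->
  h s @[s --> 0^'+] --> K 0 -> h s @[s --> T^'-] --> K T ->
  (forall s t, 0 < s -> s <= t -> t < T -> itv_int g s t = h t - h s) ->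
  forall a b, 0 <= a -> a < b -> b <= T -> is_primitive_on g K a b (K a) (K b).
Proof.
move=> Kh ch h0 hT gh a b a0 ab bT; split.
- move=> s t as_ st tb; rewrite gh ?(le_lt_trans a0)//; last exact: lt_le_trans bT.
  rewrite !Kh//; apply/andP; split; first exact: le_lt_trans as_.
  + by rewrite (le_lt_trans st)// (lt_le_trans tb).
  + by rewrite (le_lt_trans a0)// (lt_le_trans as_).
  + exact: lt_le_trans bT.
- by apply: closed_cvg_right h0 _ => //; rewrite a0 (lt_le_trans ab).
- by apply: closed_cvg_left hT _ => //; rewrite (le_lt_trans a0).
Qed.

Definition extend h (l0 lT : R) t := if t == 0 then l0 else if t == T then lT else h t.

Lemma extend_in h l0 lT t : 0 < t < T -> extend h l0 lT t = h t.
Proof.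
by move=> /andP[t0 tT]; rewrite /extend gt_eqF// lt_eqF.
Qed.

Lemma extend0 h l0 lT : extend h l0 lT 0 = l0.
Proof. by rewrite /extend eqxx. Qed.

Lemma extendT h l0 lT : extend h l0 lT T = lT.
Proof. by rewrite /extend eqxx gt_eqF. Qed.

Lemma primitive_nondecreasing g c : time_continuous T g -> (forall t, 0 < t < T -> 0 <= g t) ->
  0 < c < T ->
  {in `]0, T[ &, {homo primitive g c : x y / x <= y}}.
Proof.
move=> cg g0 cT s t; rewrite !in_itv/= => /andP[s0 sT] /andP[t0 tT] st.
rewrite -subr_ge0 -(itv_int_primitive cg cT)//; apply: (itv_int_ge0 cg) => // r /andP[sr rt].
by apply: g0; rewrite (lt_le_trans s0)//= (le_lt_trans rt).
Qed.

Lemma itv_int_le_integral g s t a b (A : R) : time_continuous T g -> (forall t, 0 < t < T -> 0 <= g t) ->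
  0 <= a -> a < s -> t < b -> b <= T ->
  (\int[mu]_(r in `]a, b[) (g r)%:E)%E = A%:E -> itv_int g s t <= A.
Proof.
move=> cg g0 a0 as_ tb bT EA.
have I : mu.-integrable `[s, t] (EFin \o g).
  by apply: time_continuous_integrable; [exact: cg|exact: le_lt_trans as_|exact: lt_le_trans bT].
rewrite -lee_fin -EA /itv_int /int_between/= /Rintegral fineK; last first.
  by have := integrable_fin_num _ I; apply; exact: measurable_itv.
apply: ge0_subset_integral => //=.
- by apply/measurable_EFinP; apply: time_continuous_measurable cg _ _.
- move=> r; rewrite in_itv/= => /andP[ar rb]; rewrite lee_fin; apply: g0.
  by rewrite (le_lt_trans a0)//= (lt_le_trans rb).
- by apply: subset_itv; rewrite bnd_simp.
Qed.

(** The primitive of a nonnegative function is monotone, and the finite integral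
    bounds it. *)
Lemma primitive_cvg_right_ge0 g c b (A : R) : time_continuous T g -> (forall t, 0 < t < T -> 0 <= g t) ->
  0 < c < b -> b <= T -> (\int[mu]_(r in `]0%R, b[) (g r)%:E)%E = A%:E ->
  cvg (primitive g c s @[s --> 0^'+]).
Proof.
move=> cg g0 /andP[c0 cb] bT EA.
have cT : 0 < c < T by rewrite c0 (lt_le_trans cb).
apply: nondecreasing_at_right_is_cvgr.
  near=> x => s t; rewrite !in_itv/= => /andP[s0 sx] /andP[t0 tx].
  have xT : x <= T by near: x; exact: nbhs_right_le.
  apply: (primitive_nondecreasing cg g0 cT); rewrite in_itv/= ?s0 ?t0 ?(lt_le_trans sx)//.
  by rewrite (lt_le_trans tx).
(* on ]0, c] the primitive is minus the integral up to c *)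
near=> x; exists (- A) => _ /= [s + <-]; rewrite in_itv/= => /andP[s0 sx].
have sc : s <= c.
  by rewrite ltW// (lt_le_trans sx)//; near: x; apply: nbhs_right_le.
have := @itv_int_le_integral g s c 0 b A cg g0 (lexx _) s0 cb bT EA.
case/andP: cT => _ c1.
rewrite (itv_int_primitive cg (_ : 0 < c < T))// ?c0// {1}/primitive !itv_int_same; lra.
Unshelve. all: by end_near. Qed.

Lemma primitive_cvg_left_ge0 g c a (A : R) : time_continuous T g -> (forall t, 0 < t < T -> 0 <= g t) ->
  0 <= a -> a < c < T -> (\int[mu]_(r in `]a, T[) (g r)%:E)%E = A%:E ->
  cvg (primitive g c s @[s --> T^'-]).
Proof.
move=> cg g0 a0 /andP[ac c1] EA.
have cT : 0 < c < T by rewrite (le_lt_trans a0).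
apply: nondecreasing_at_left_is_cvgr.
  near=> x => s t; rewrite !in_itv/= => /andP[xs sT] /andP[xt tT].
  have x0 : 0 <= x by near: x; exact: nbhs_left_ge.
  by apply: (primitive_nondecreasing cg g0 cT); rewrite in_itv/= ?sT ?tT ?(le_lt_trans x0).
near=> x; exists A => _ /= [s + <-]; rewrite in_itv/= => /andP[xs sT].
have cs : c <= s.
  by rewrite ltW// (le_lt_trans _ xs)//; near: x; apply: nbhs_left_ge.
have := @itv_int_le_integral g c s a T A cg g0 a0 ac sT (lexx _) EA.
case/andP: (cT) => c0 _.
rewrite (itv_int_primitive cg cT)// {2}/primitive !itv_int_same; lra.
Unshelve. all: by end_near. Qed.

End closed_interval.

(** * The energy equality and the limits of the energy *)

Section equivalence.
Context {R : realType} {d : nat} (T : R) (u f : R -> 'rV[R]_d -> 'rV[R]_d) (p : R -> 'rV[R]_d -> R).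
Hypotheses (T0 : 0 < T) (ru : regular T u) (rf : regular T f) (rp : regular T p)
  (nse : NSE T u f p) (Wint : in_calL T (fun t => inner (u t) (f t))).
Local Notation mu := (@lebesgue_measure R).
Local Notation U := (closed_traj T u).
Implicit Types (a b t s : R).

Definition work t := inner (u t) (f t).
Definition dissip t := grad_norm_sq (u t).
Definition energy t := 2^-1 * L2norm (u t) ^+ 2.
Definition closed_energy t := 2^-1 * L2norm (U t) ^+ 2.

Let tu : vcperiodic_on T u. Proof. exact: regular_vcperiodic_on. Qed.
Let tf : vcperiodic_on T f. Proof. exact: regular_vcperiodic_on. Qed.

Lemma closed_traj_in t : 0 < t < T -> U t = u t.
Proof. by move=> /andP[t0 tT]; rewrite /closed_traj gt_eqF// lt_eqF. Qed.

Lemma workE t : 0 < t < T -> work t = vecform L2form (u t) (f t).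
Proof. by move=> tT; rewrite /work innerE//; apply: vcperiodic_on_slice tT. Qed.

Lemma energyE t : 0 < t < T -> energy t = 2^-1 * vecform L2form (u t) (u t).
Proof. by move=> tT; rewrite /energy L2norm_sqr innerE//; apply: vcperiodic_on_slice tT. Qed.

Lemma work_continuous : time_continuous T work.
Proof.
apply: eq_time_continuous workE _ => t tT.
exact: (vecform_continuous L2form_energy_form tu tf tT).
Qed.

Lemma dissip_continuous : time_continuous T dissip.
Proof.
apply: (eq_time_continuous (h := fun t => gradform L2form (u t))) => [t tT|t tT].
  exact: grad_norm_sqE ru tT.
exact: (gradform_continuous L2form_energy_form ru tT).
Qed.

Lemma dissip_ge0 t : 0 <= dissip t.
Proof.
apply: torus_int_ge0 => x; apply: sumr_ge0 => i _; apply: sumr_ge0 => j _; exact: sqr_ge0.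
Qed.

Lemma is_derive_half (h : R -> R) t (dh : R) :
  is_derive t 1 h (2 * dh) -> is_derive t 1 (fun s => 2^-1 * h s) dh.
Proof.
move=> H; have := is_deriveZ (2^-1 : R) H.
by move=> /is_derive_eq; apply; rewrite /GRing.scale/= mulKf.
Qed.

Lemma energy_increment a b : 0 < a -> a <= b -> b < T ->
  itv_int work a b - itv_int dissip a b = energy b - energy a.
Proof.
move=> a0 ab bT; have cW := work_continuous; have cD := dissip_continuous.
rewrite -(itv_intB cW cD)//.
have aT : 0 < a < T by rewrite a0 (le_lt_trans ab).
have bT' : 0 < b < T by rewrite (lt_le_trans a0).
rewrite (energyE aT) (energyE bT').
apply: (itv_int_derive (time_continuousB cW cD)
  (H := fun t => 2^-1 * vecform L2form (u t) (u t))) => // t tT.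
apply: is_derive_half.
have := energy_balance ru rf rp nse L2form_energy_form tT.
rewrite (advection_energy0 ru nse tT) subr0 -(grad_norm_sqE ru tT).
by rewrite (vecformC _ _ L2form_energy_form) -workE.
Qed.

Lemma energy_time_continuous : time_continuous T energy.
Proof.
apply: eq_time_continuous energyE _ => t tT; apply: cvgM; first exact: cvg_cst.
exact: (vecform_continuous L2form_energy_form tu tu tT).
Qed.

Variable c : R.
Hypothesis cT : 0 < c < T.

Let lW0 := lim (primitive work c s @[s --> 0^'+]).
Let lWT := lim (primitive work c s @[s --> T^'-]).

Definition total_work := extend T (primitive work c) lW0 lWT.

Let W0 : primitive work c s @[s --> 0^'+] --> total_work 0.
Proof. by rewrite /total_work extend0; exact: (in_calL_primitive T0 work_continuous Wint cT).1. Qed.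

Let WT : primitive work c s @[s --> T^'-] --> total_work T.
Proof. by rewrite /total_work extendT//; exact: (in_calL_primitive T0 work_continuous Wint cT).2. Qed.

Lemma total_work_primitive a b : 0 <= a -> a < b -> b <= T ->
  is_primitive_on work total_work a b (total_work a) (total_work b).
Proof.
apply: (closed_primitive (h := primitive work c) _ _ W0 WT).
- by move=> t tT; exact: extend_in.
- exact: primitive_time_continuous work_continuous cT.
- by move=> s t s0 st tT; exact: (itv_int_primitive work_continuous cT s0 st tT).
Qed.

Lemma improper_work a b : 0 <= a -> a <= b -> b <= T ->
  improper_int work a b = total_work b - total_work a.
Proof.
move=> a0; rewrite le_eqVlt => /predU1P[<- _|ab bT].
  by rewrite improper_int_same subrr.
have [h1 h2 h3] := total_work_primitive a0 ab bT.
exact: improper_intE h1 h2 h3.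
Qed.

Definition energy_endpoints :=
  energy s @[s --> 0^'+] --> closed_energy 0 /\ energy s @[s --> T^'-] --> closed_energy T.

Lemma closed_energy_in t : 0 < t < T -> closed_energy t = energy t.
Proof. by move=> tT; rewrite /closed_energy closed_traj_in. Qed.

Definition total_dissip t := total_work t - closed_energy t.

Lemma total_dissip_primitive a b : energy_endpoints -> 0 <= a -> a < b -> b <= T ->
  is_primitive_on dissip total_dissip a b (total_dissip a) (total_dissip b).
Proof.
move=> [E0 ET]; apply: (closed_primitive (h := fun t => primitive work c t - energy t) _ _
  (cvgB W0 E0) (cvgB WT ET)).
- by move=> t tT; rewrite /total_dissip closed_energy_in// /total_work extend_in.
- apply: time_continuousB; [exact: primitive_time_continuous work_continuous cT|
    exact: energy_time_continuous].
- move=> s t s0 st tT; have := energy_increment s0 st tT.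
  rewrite (itv_int_primitive work_continuous cT s0 st tT).
  by move: (primitive _ _ _) (primitive _ _ _) (itv_int _ _ _) (energy _) (energy _) => A B C D F; lra.
Qed.

(** The increments of the dissipation are those of the work minus those of the
    energy, both of which have limits at the end points; so the balance extends
    from compact intervals to [0, T]. *)
Lemma endpoints_energy_equality : energy_endpoints -> energy_equality T u f.
Proof.
move=> EE.
have I a b : 0 <= a -> a <= b -> b <= T ->
    (\int[mu]_(t in `]a, b[) (grad_norm_sq (u t))%:E)%E = (total_dissip b - total_dissip a)%:E.
  move=> a0; rewrite le_eqVlt => /predU1P[<- _|ab bT].
    by rewrite set_itvoo0 ?bnd_simp ?ltxx// integral_set0 subrr.
  apply: (integral_oo dissip_continuous _ a0 ab bT (total_dissip_primitive EE a0 ab bT)) => t _.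
  exact: dissip_ge0.
move=> t0 t1 /andP[t00 t0T] /andP[t10 t1T].
rewrite -/(closed_energy t0) -/(closed_energy t1) /oriented.
have [t01|t10'] := leP t0 t1.
  rewrite I// -[improper_int _ _ _]/(improper_int work t0 t1) improper_work// -EFinD.
  by congr EFin; rewrite /total_dissip; ring.
rewrite I ?(ltW t10')// -[improper_int _ _ _]/(improper_int work t1 t0).
rewrite improper_work ?(ltW t10')// -EFinN -EFinD -EFinN.
by congr EFin; rewrite /total_dissip; ring.
Qed.

(** The equality makes the dissipation integrable up to 0, so that over ]0, t[ it
    tends to 0 with t, as does the work; what is left of the equality is the
    convergence of the energy. Symmetrically at T. *)
Lemma energy_equality_endpoints : energy_equality T u f -> energy_endpoints.
Proof.
move=> EQ.
have eq a b : 0 <= a -> a <= b -> b <= T ->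
    (\int[mu]_(t in `]a, b[) (dissip t)%:E)%E =
    (total_work b - total_work a - (closed_energy b - closed_energy a))%:E.
  move=> a0 ab bT; have := EQ a b; rewrite a0 bT (le_trans ab bT) (le_trans a0 ab).
  move=> /(_ isT isT); rewrite /oriented ab.
  rewrite -/(closed_energy a) -/(closed_energy b).
  rewrite -[improper_int _ _ _]/(improper_int work a b) improper_work//.
  rewrite -[X in (_ + X)%E]/(\int[mu]_(t in `]a, b[) (dissip t)%:E)%E.
  case: (\int[mu]_(t in `]a, b[) (dissip t)%:E)%E => [r|//|//].
  by rewrite -EFinD => -[<-]; congr EFin; ring.
have D0 t : 0 < t < T -> 0 <= dissip t by move=> _; exact: dissip_ge0.
have [c1 c2] := andP cT.
have [c3 c4] : c < (c + T) / 2 /\ (c + T) / 2 < T by split; lra.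
split.
- have cv0 : cvg (primitive dissip c s @[s --> 0^'+]).
    apply: (primitive_cvg_right_ge0 T0 dissip_continuous D0 _ (ltW c4) (eq _ _ (lexx _) _ (ltW c4))).
    + by rewrite c1.
    + by rewrite ltW// (lt_trans c1).
  move: (lim _) cv0 => l cv0.
  have E t : 0 < t < T -> energy t = closed_energy 0 + (primitive work c t - total_work 0)
      - (primitive dissip c t - l).
    move=> /andP[t0 tT].
    have P : is_primitive_on dissip (primitive dissip c) 0 t l (primitive dissip c t).
      split => //; last first.
        by apply: cvg_at_left_filter; apply: (primitive_time_continuous dissip_continuous cT);
          rewrite t0.
      move=> s r s0 sr rt; apply: (itv_int_primitive dissip_continuous cT s0 sr).
      exact: lt_trans tT.
    have := integral_oo dissip_continuous D0 (lexx _) t0 (ltW tT) P.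
    rewrite eq ?(ltW t0) ?(ltW tT)// => -[].
    have tT' : 0 < t < T by rewrite t0.
    have -> : total_work t = primitive work c t by exact: extend_in.
    rewrite closed_energy_in//.
    move: (total_work 0) (closed_energy 0) (energy t) (primitive work c t) (primitive dissip c t).
    by move=> A B C D F; lra.
  have L : closed_energy 0 + (primitive work c s - total_work 0) - (primitive dissip c s - l)
      @[s --> 0^'+] --> closed_energy 0 + (total_work 0 - total_work 0) - (l - l).
    exact: (cvgB (cvgD (cvg_cst _) (cvgB W0 (cvg_cst _))) (cvgB cv0 (cvg_cst _))).
  move: L; rewrite !subrr addr0 subr0; apply: cvg_trans.
  apply: near_eq_cvg; have : \forall t \near (0 : R)^'+, 0 < t < T.
    by near=> t; apply/andP; split=> //; near: t; exact: nbhs_right_lt.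
  by apply: filterS => t tT; rewrite E.
- have cv0 : cvg (primitive dissip c s @[s --> T^'-]).
    have h1 : 0 <= c / 2 by lra.
    have h2 : c / 2 <= T by lra.
    have h3 : c / 2 < c < T by apply/andP; split; lra.
    exact: (primitive_cvg_left_ge0 T0 dissip_continuous D0 h1 h3 (eq _ _ h1 h2 (lexx _))).
  move: (lim _) cv0 => l cv0.
  have E t : 0 < t < T -> energy t = closed_energy T - (total_work T - primitive work c t)
      + (l - primitive dissip c t).
    move=> /andP[t0 tT].
    have P : is_primitive_on dissip (primitive dissip c) t T (primitive dissip c t) l.
      split => //; last first.
        by apply: cvg_at_right_filter; apply: (primitive_time_continuous dissip_continuous cT);
          rewrite t0.
      move=> s r s0 sr rt; apply: (itv_int_primitive dissip_continuous cT _ sr rt).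
      exact: lt_trans s0.
    have := integral_oo dissip_continuous D0 (ltW t0) tT (lexx _) P.
    rewrite eq ?(ltW t0) ?(ltW tT)// => -[].
    have tT' : 0 < t < T by rewrite t0.
    have -> : total_work t = primitive work c t by exact: extend_in.
    rewrite (closed_energy_in tT').
    move: (total_work T) (closed_energy T) (energy t) (primitive work c t) (primitive dissip c t).
    by move=> A B C D F; lra.
  have L : closed_energy T - (total_work T - primitive work c s) + (l - primitive dissip c s)
      @[s --> T^'-] --> closed_energy T - (total_work T - total_work T) + (l - l).
    exact: (cvgD (cvgB (cvg_cst _) (cvgB (cvg_cst _) WT)) (cvgB (cvg_cst _) cv0)).
  move: L; rewrite !subrr subr0 addr0; apply: cvg_trans.
  apply: near_eq_cvg; have : \forall t \near T^'-, 0 < t < T.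
    by near=> t; apply/andP; split=> //; near: t; exact: nbhs_left_gt.
  by apply: filterS => t tT; rewrite E.
Unshelve. all: by end_near. Qed.

End equivalence.

(** * Strong continuity in time *)

Section strong_convergence.
Context {R : realType} {d : nat}.
Implicit Types (v w z : 'rV[R]_d -> 'rV[R]_d) (V : R -> 'rV[R]_d -> 'rV[R]_d) (F : set_system R).

Let subE v w : v \- w = (fun x => -1 *: w x + v x).
Proof. by apply/funext => x /=; rewrite scaleN1r addrC. Qed.

Lemma square_integrableB v w : square_integrable v -> square_integrable w -> square_integrable (v \- w).
Proof. by move=> sv sw; rewrite subE; exact: square_integrable_lin. Qed.

Lemma inner_subl v w z : square_integrable v -> square_integrable w -> square_integrable z ->
  inner (v \- w) z = inner v z - inner w z.
Proof. by move=> sv sw sz; rewrite subE inner_linl// mulN1r addrC. Qed.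

Lemma inner_sub2 v w : square_integrable v -> square_integrable w ->
  inner (v \- w) (v \- w) = inner v v - 2 * inner v w + inner w w.
Proof. by move=> sv sw; rewrite subE inner_lin2// (innerC w v); ring. Qed.

Lemma L2norm_ge0 v : 0 <= L2norm v.
Proof. exact: sqrtr_ge0. Qed.

Lemma strong_weak_cvg F {FF : ProperFilter F} V v z :
  (\forall s \near F, square_integrable (V s)) -> square_integrable v -> square_integrable z ->
  L2norm (V s \- v) @[s --> F] --> (0 : R) -> inner (V s) z @[s --> F] --> inner v z.
Proof.
move=> sV sv sz Vv; apply/cvgrPdist_lt => e e0.
have z0 : 0 < L2norm z + 1 by rewrite ltr_wpDl// L2norm_ge0.
have d0 : 0 < e / (L2norm z + 1) by rewrite divr_gt0.
move/cvgrPdist_lt : Vv => /(_ _ d0) Vv.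
near=> s.
have sVs : square_integrable (V s) by near: s.
rewrite distrC -inner_subl// (le_lt_trans (cauchy_schwarz _ _))//; first exact: square_integrableB.
have : `|0 - L2norm (V s \- v)| < e / (L2norm z + 1) by near: s.
rewrite sub0r normrN ger0_norm ?L2norm_ge0// ltr_pdivlMr//; apply: le_lt_trans.
by rewrite ler_wpM2l ?L2norm_ge0// lerDl.
Unshelve. all: by end_near. Qed.

Lemma strong_norm_cvg F {FF : ProperFilter F} V v : (\forall s \near F, square_integrable (V s)) ->
  square_integrable v ->
  L2norm (V s \- v) @[s --> F] --> (0 : R) -> L2norm (V s) ^+ 2 @[s --> F] --> L2norm v ^+ 2.
Proof.
move=> sV sv Vv; have W := strong_weak_cvg sV sv sv Vv.
have L : L2norm (V s \- v) ^+ 2 + 2 * inner (V s) v - inner v v @[s --> F] -->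
    0 ^+ 2 + 2 * inner v v - inner v v.
  apply: cvgB; last exact: cvg_cst.
  apply: cvgD; first by apply: cvgM; exact: Vv.
  by apply: cvgM; [exact: cvg_cst|exact: W].
have E : 0 ^+ 2 + 2 * inner v v - inner v v = L2norm v ^+ 2 by rewrite L2norm_sqr; ring.
rewrite -E; apply: cvg_trans L; apply: near_eq_cvg; apply: filterS sV => s sVs.
by rewrite !L2norm_sqr inner_sub2//; ring.
Qed.

(** Expand |V - v|^2 = |V|^2 - 2 <V, v> + |v|^2. *)
Lemma weak_norm_strong_cvg F {FF : ProperFilter F} V v :
  (\forall s \near F, square_integrable (V s)) -> square_integrable v ->
  inner (V s) v @[s --> F] --> inner v v -> L2norm (V s) ^+ 2 @[s --> F] --> L2norm v ^+ 2 ->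
  L2norm (V s \- v) @[s --> F] --> (0 : R).
Proof.
move=> sV sv Vw Vn.
have L : Num.sqrt (L2norm (V s) ^+ 2 - 2 * inner (V s) v + inner v v) @[s --> F] --> Num.sqrt 0.
  apply: (@cvg_comp _ _ _ _ Num.sqrt); last exact: sqrt_continuous.
  have -> : 0 = L2norm v ^+ 2 - 2 * inner v v + inner v v by rewrite L2norm_sqr; ring.
  apply: cvgD; last exact: cvg_cst.
  apply: cvgB; first exact: Vn.
  by apply: cvgM; [exact: cvg_cst|exact: Vw].
move: L; rewrite sqrtr0; apply: cvg_trans; apply: near_eq_cvg; apply: filterS sV => s sVs.
by rewrite L2norm_sqr /L2norm inner_sub2.
Qed.

Lemma inner_sub_triangle v w z : square_integrable v -> square_integrable w -> square_integrable z ->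
  inner (v \- w) (v \- w) <= 2 * inner (v \- z) (v \- z) + 2 * inner (w \- z) (w \- z).
Proof.
move=> sv sw sz; have svz := square_integrableB sv sz; have swz := square_integrableB sw sz.
have -> : v \- w = (v \- z) \- (w \- z).
  by apply/funext => x /=; rewrite opprB addrA subrK.
rewrite inner_sub2//.
have := inner_ge0 (fun x => 1 *: (v \- z) x + (w \- z) x).
rewrite (inner_lin2 1 svz swz).
by move: (inner _ _) (inner _ _) (inner _ _) => A B' C; lra.
Qed.

End strong_convergence.

Section continuity.
Context {R : realType} {d : nat} (T : R) (u : R -> 'rV[R]_d -> 'rV[R]_d).
Hypotheses (T0 : 0 < T) (ru : regular T u).
Local Notation U := (closed_traj T u).

Let square_integrable_in t : 0 < t < T -> square_integrable (u t).
Proof. by move=> tT; exact: vcperiodic_square_integrable (vcperiodic_on_slice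
  (regular_vcperiodic_on ru) tT). Qed.

Let near0 : \forall t \near (0 : R)^'+, 0 < t < T.
Proof.
by near=> t; apply/andP; split=> //; near: t; exact: nbhs_right_lt.
Unshelve. all: by end_near. Qed.

Let nearT : \forall t \near T^'-, 0 < t < T.
Proof.
by near=> t; apply/andP; split=> //; near: t; exact: nbhs_left_gt.
Unshelve. all: by end_near. Qed.

Lemma closed_traj0 : U 0 = weak_lim 0^'+ u.
Proof. by rewrite /closed_traj eqxx. Qed.

Lemma closed_trajT : U T = weak_lim T^'- u.
Proof. by rewrite /closed_traj eqxx gt_eqF. Qed.

Lemma energy_continuous0 : energy_continuous T u ->
  square_integrable (U 0) /\ L2norm (u s \- U 0) @[s --> 0^'+] --> (0 : R).
Proof.
move=> [iU cU]; have T00 : 0 <= (0 : R) <= T by apply/andP; split=> //; exact: ltW.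
split; first exact: inL2_square_integrable (iU _ T00).
apply/cvgrPdist_lt => e e0; move/cvgrPdist_lt : (cU _ T00) => /(_ _ e0) H.
have {}H : \forall s \near nbhs (0 : R), s \in `[0, T] -> `|0 - L2norm (U s \- U 0)| < e.
  exact: H.
near=> s.
have sT : 0 < s < T by near: s.
rewrite -(closed_traj_in u sT).
have : s \in `[0, T] by case/andP : sT => s0 sT; rewrite in_itv/= !ltW.
near: s; apply: cvg_within; exact: H.
Unshelve. all: by end_near. Qed.

Lemma energy_continuousT : energy_continuous T u ->
  square_integrable (U T) /\ L2norm (u s \- U T) @[s --> T^'-] --> (0 : R).
Proof.
move=> [iU cU]; have T00 : 0 <= T <= T by apply/andP; split=> //; exact: ltW.
split; first exact: inL2_square_integrable (iU _ T00).
apply/cvgrPdist_lt => e e0; move/cvgrPdist_lt : (cU _ T00) => /(_ _ e0) H.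
have {}H : \forall s \near nbhs (T : R), s \in `[0, T] -> `|0 - L2norm (U s \- U T)| < e.
  exact: H.
near=> s.
have sT : 0 < s < T by near: s.
rewrite -(closed_traj_in u sT).
have : s \in `[0, T] by case/andP : sT => s0 sT; rewrite in_itv/= !ltW.
near: s; apply: cvg_within; exact: H.
Unshelve. all: by end_near. Qed.

Lemma continuous_endpoints : energy_continuous T u -> energy_endpoints T u.
Proof.
move=> H; have [s0 c0] := energy_continuous0 H; have [sT cT] := energy_continuousT H.
split; apply: cvgM; try exact: cvg_cst.
- by apply: strong_norm_cvg s0 c0; apply: filterS near0 => s; exact: square_integrable_in.
- by apply: strong_norm_cvg sT cT; apply: filterS nearT => s; exact: square_integrable_in.
Qed.

(** If a weak limit exists this is [weak_norm_strong_cvg]. Otherwise [weak_lim]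
    is 0, and norms that converge to 0 give strong convergence by themselves. *)
Lemma weak_lim_strong_cvg (F : set_system R) {FF : ProperFilter F} :
  (\forall s \near F, square_integrable (u s)) ->
  inL2 (weak_lim F u) /\
  (L2norm (u s) ^+ 2 @[s --> F] --> L2norm (weak_lim F u) ^+ 2 ->
   L2norm (u s \- weak_lim F u) @[s --> F] --> (0 : R)).
Proof.
move=> su; rewrite /weak_lim; case: xgetP => [v _ [iv Wv]|noweak].
  split=> // Nv; apply: weak_norm_strong_cvg => //; first exact: inL2_square_integrable.
  exact: Wv.
have c0 : vcperiodic (fun=> 0 : 'rV[R]_d).
  by move=> i; apply: eq_cperiodic (cperiodic_cst d 0) => x; rewrite mxE.
split=> [|N0]; first exact: vcperiodic_inL2.
apply: weak_norm_strong_cvg => //; first exact: vcperiodic_square_integrable.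
rewrite (_ : (fun s => inner (u s) (fun=> 0)) = cst (inner (fun=> 0) (fun=> 0 : 'rV[R]_d))).
  exact: cvg_cst.
apply/funext => s; apply: eq_torus_int => x; apply: eq_bigr => i _.
by rewrite mxE !mulr0.
Qed.

Let norm0 (v : 'rV[R]_d -> 'rV[R]_d) : L2norm (v \- v) = 0.
Proof.
rewrite /L2norm /inner (@eq_torus_int _ _ _ (fun=> 0)) ?torus_int0 ?sqrtr0// => x.
by rewrite big1// => i _; rewrite /= subrr mxE mul0r.
Qed.

Lemma endpoints_continuous : energy_endpoints T u -> energy_continuous T u.
Proof.
move=> [E0 ET].
have two (F : set_system R) (FF : ProperFilter F) (l : R) :
    energy u s @[s --> F] --> 2^-1 * l -> L2norm (u s) ^+ 2 @[s --> F] --> l.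
  move=> H.
  have L : 2 * energy u s @[s --> F] --> 2 * (2^-1 * l).
    by apply: cvgM; [exact: cvg_cst|exact: H].
  move: L; rewrite mulVKf// => L; apply: cvg_trans L; apply: near_eq_cvg; apply: nearW => s.
  by rewrite /energy mulVKf.
have [i0 S0] := @weak_lim_strong_cvg _ (at_right_proper_filter 0) (filterS square_integrable_in near0).
have [iT ST] := @weak_lim_strong_cvg _ (at_left_proper_filter T) (filterS square_integrable_in nearT).
have {}S0 : L2norm (u s \- U 0) @[s --> 0^'+] --> (0 : R).
  by rewrite closed_traj0; apply: S0; apply: two; move: E0; rewrite /closed_energy closed_traj0.
have {}ST : L2norm (u s \- U T) @[s --> T^'-] --> (0 : R).
  by rewrite closed_trajT; apply: ST; apply: two; move: ET; rewrite /closed_energy closed_trajT.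
split=> t /andP[t0 tT].
  move: t0 tT; rewrite !le_eqVlt => /predU1P[<- _|t0 /predU1P[->|tT]].
  - by rewrite closed_traj0.
  - by rewrite closed_trajT.
  - rewrite closed_traj_in ?t0//; apply: vcperiodic_inL2.
    by apply: vcperiodic_on_slice (regular_vcperiodic_on ru) _; rewrite t0.
apply/cvgrPdist_lt => e e0.
suff : \forall s \near nbhs t, s \in `[0, T] -> `|0 - L2norm (U s \- U t)| < e by [].
move: t0 tT; rewrite !le_eqVlt => /predU1P[<- _|t0 /predU1P[->|tT]].
- have : \forall s \near nbhs (0 : R), 0 < s -> `|0 - L2norm (u s \- U 0)| < e.
    by move/cvgrPdist_lt : S0 => /(_ _ e0).
  have : \forall s \near nbhs (0 : R), s < T by exact: lt_nbhsl.
  apply: filterS2 => s sT Hs; rewrite in_itv/= => /andP[].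
  rewrite le_eqVlt => /predU1P[<- _|s0 _]; first by rewrite norm0 subrr normr0.
  by rewrite closed_traj_in ?s0//; exact: Hs.
- have : \forall s \near nbhs T, s < T -> `|0 - L2norm (u s \- U T)| < e.
    by move/cvgrPdist_lt : ST => /(_ _ e0).
  have : \forall s \near nbhs T, 0 < s by exact: lt_nbhsr.
  apply: filterS2 => s s0 Hs; rewrite in_itv/= => /andP[_].
  rewrite le_eqVlt => /predU1P[->|sT]; first by rewrite norm0 subrr normr0.
  by rewrite closed_traj_in ?s0//; exact: Hs.
- have tT' : 0 < t < T by rewrite t0.
  have tW : vcperiodic_on T (fun s => u s \- u t).
    move=> i; apply: (@eq_cperiodic_on _ _ _ _ (fun s x => u s x 0 i + - (u t x 0 i))) => [s x|].
      by rewrite /= !mxE.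
    apply: cperiodic_onD; first exact: regular_vcperiodic_on.
    apply: cperiodic_on_cst; apply: cperiodicN; exact: vcperiodic_on_slice
      (regular_vcperiodic_on ru) tT' i.
  have C : {for t, continuous (fun s => L2norm (u s \- u t))}.
    apply: (@eq_time_continuous _ T _ (fun s => Num.sqrt (vecform L2form (u s \- u t)
      (u s \- u t)))) => //.
      by move=> s sT; rewrite /L2norm innerE//; exact: vcperiodic_on_slice tW sT.
    move=> s sT; apply: continuous_comp; last exact: sqrt_continuous.
    exact: (vecform_continuous L2form_energy_form tW tW sT).
  move/cvgrPdist_lt : C => /(_ _ e0) C.
  have : \forall s \near nbhs t, 0 < s < T.
    have : t \in `]0, T[ by rewrite in_itv.
    by move=> /near_in_itvoo; apply: filterS => s; rewrite in_itv.
  apply: filterS2 C => s Hs sT _.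
  by rewrite !closed_traj_in//; move: Hs; rewrite norm0.
Qed.

End continuity.

(** * Limits superior and trigonometric test fields *)

Section limsup.
Context {R : realType}.

Lemma limn_esup_le_close (a b : nat -> R) : a q - b q @[q --> \oo] --> (0 : R) ->
  (limn_esup (fun q => `|a q|%:E) <= limn_esup (fun q => `|b q|%:E))%E.
Proof.
move=> ab; apply/lee_addgt0Pr => e e0.
rewrite -leeBlDr//; apply/ereal_infP => _ [V FV <-].
rewrite leeBlDr//.
move/cvgrPdist_lt : ab => /(_ _ e0) near_ab.
apply: (@le_trans _ _ (ereal_sup [set `|a q|%:E | q in
    V `&` [set q | `|0 - (a q - b q)| < e]])).
  apply: ereal_inf_lbound => /=; eexists; last by [].
  exact: filterI FV near_ab.
apply/ereal_supP => _ [q [Vq /= abq] <-].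
rewrite sub0r normrN in abq.
apply: (@le_trans _ _ (`|b q|%:E + e%:E)%E).
  rewrite -EFinD lee_fin -(subrK (b q) (a q)) (le_trans (ler_normD _ _))// addrC lerD2l.
  exact: ltW.
by apply: leeD => //; apply: ereal_sup_ubound; exists q.
Qed.

Lemma limn_esup_close (a b : nat -> R) : a q - b q @[q --> \oo] --> (0 : R) ->
  limn_esup (fun q => `|a q|%:E) = limn_esup (fun q => `|b q|%:E).
Proof.
move=> ab; apply/le_anti/andP; split; apply: limn_esup_le_close => //.
have -> : (fun q => b q - a q) = - (fun q => a q - b q).
  by apply/funext => q; rewrite fctE opprB.
by rewrite -oppr0; exact: cvgN.
Qed.

End limsup.

Section test_fields.
Context {R : realType} {d : nat}.

Definition mode_field (w : 'rV[R]_d -> R) (i : 'I_d) : 'rV[R]_d -> 'rV[R]_d :=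
  fun x => w x *: delta_mx 0 i.

Lemma inner_mode_field (v : 'rV[R]_d -> 'rV[R]_d) w i :
  inner v (mode_field w i) = torus_int (fun x => v x 0 i * w x).
Proof.
apply: eq_torus_int => x; rewrite (bigD1 i)//= big1 => [|j ji]; last first.
  by rewrite !mxE eqxx (negbTE ji) !mulr0.
by rewrite !mxE !eqxx mulr1 addr0.
Qed.

Lemma mode_field_vcperiodic w i : cperiodic w -> vcperiodic (mode_field w i).
Proof.
move=> cw j; apply: (@eq_cperiodic _ _ _ (fun x => (j == i)%:R * w x)) => [x|]; last exact: cperiodicZ.
by rewrite !mxE eqxx mulrC.
Qed.

Lemma trig_derive (k : 'rV[int]_d) (a b : R) (x v : 'rV[R]_d) :
  is_derive x v (fun y => a * cosk k y + b * sink k y)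
    (phase k v * b * cosk k x + (- phase k v * a) * sink k x).
Proof.
apply: is_derive_line; rewrite /cosk /sink.
rewrite (_ : (fun t : R => a * cos (phase k (x + t *: v)) + b * sin (phase k (x + t *: v))) =
    (fun t : R => a * cos (phase k x + t * phase k v) + b * sin (phase k x + t * phase k v)));
      last first.
  by apply/funext => t; rewrite phaseD phaseZ.
apply: is_derive_eq.
rewrite !(mul0r, addr0, scaler0, add0r, mul1r) /GRing.scale/=.
ring.
Qed.

Lemma mode_field_derive (k : 'rV[int]_d) (a b : R) i (x v : 'rV[R]_d) :
  is_derive x v (mode_field (fun y => a * cosk k y + b * sink k y) i)
    (mode_field (fun y => phase k v * b * cosk k y + (- phase k v * a) * sink k y) i x).
Proof.
have D j : is_derive x v (fun y => mode_field (fun y => a * cosk k y + b * sink k y) i y 0 j)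
    (mode_field (fun y => phase k v * b * cosk k y + (- phase k v * a) * sink k y) i x 0 j).
  have -> : (fun y => mode_field (fun y => a * cosk k y + b * sink k y) i y 0 j) =
      (j == i)%:R \*: (fun y : 'rV[R]_d => a * cosk k y + b * sink k y).
    by apply/funext => y; rewrite !mxE eqxx mulrC.
  have := is_deriveZ (j == i)%:R (trig_derive k a b x v).
  by move=> /is_derive_eq; apply; rewrite !mxE eqxx /GRing.scale/= mulrC.
have dm : derivable (mode_field (fun y => a * cosk k y + b * sink k y) i) x v.
  by apply/derivable_mxP => j l; rewrite !ord1; exact: (@ex_derive _ _ _ _ _ _ _ (D l)).
apply: DeriveDef => //; rewrite (derive_mx dm); apply/matrixP => j l.
by rewrite !ord1 mxE; exact: (@derive_val _ _ _ _ _ _ _ (D l)).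
Qed.

(** Combinations of cos (k . x) and sin (k . x) with k fixed are closed under
    directional derivatives, so one induction gives all orders. *)
Lemma mode_field_smooth (k : 'rV[int]_d) (a b : R) i :
  smooth setT (mode_field (fun y => a * cosk k y + b * sink k y) i).
Proof.
have cont (a' b' : R) : continuous (mode_field (fun y => a' * cosk k y + b' * sink k y) i).
  have [cs _] : cperiodic (fun y : 'rV[R]_d => a' * cosk k y + b' * sink k y).
    by apply: cperiodicD; apply: cperiodicZ; [exact: cperiodic_cosk|exact: cperiodic_sink].
  move=> x; apply: (@cvgZ _ _ _ (nbhs x) (nbhs_filter x)); first exact: cs.
  exact: cvg_cst.
move=> n; elim: n a b => [|n IH] a b.
  by split; [move=> x _; exact: cont|exact: I].
split; first by move=> x _; exact: cont.
move=> v; split=> [x _|].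
  exact: (@ex_derive _ _ _ _ _ _ _ (mode_field_derive k a b i x v)).
rewrite (_ : 'D_v _ = mode_field (fun y => phase k v * b * cosk k y + (- phase k v * a) * sink k y) i).
  exact: IH.
apply/funext => x; exact: (@derive_val _ _ _ _ _ _ _ (mode_field_derive k a b i x v)).
Qed.

Lemma mode_field_test (k : 'rV[int]_d) (a b : R) i :
  test_field (mode_field (fun y => a * cosk k y + b * sink k y) i).
Proof.
split; last exact: mode_field_smooth.
apply: (vcperiodic_inL2 (mode_field_vcperiodic i _)).1.
by apply: cperiodicD; apply: cperiodicZ; [exact: cperiodic_cosk|exact: cperiodic_sink].
Qed.

End test_fields.

(** * Anomalous dissipation and anomalous work *)

Section anomalous.
Context {R : realType} {d : nat} (T : R) (u f : R -> 'rV[R]_d -> 'rV[R]_d) (p : R -> 'rV[R]_d -> R).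
Hypotheses (T0 : 0 < T) (ru : regular T u) (rf : regular T f) (rp : regular T p)
  (nse : NSE T u f p) (Wint : in_calL T (fun t => inner (u t) (f t))).
Hypothesis fT : has_distr_limit T^'- f.
Variable chi : 'rV[R]_d -> R.
Hypotheses (d0 : (0 < d)%N) (chiP : lp_cutoff chi).
Hypotheses (EE : energy_endpoints T u).
Local Notation mu := (@lebesgue_measure R).
Local Notation U := (closed_traj T u).
Implicit Types (a b t s : R) (q : nat).
Local Notation m := (lp_symbol chi).
Local Notation S := (@lp_support d).
Local Notation B q := (truncform (m q) (S q)).

Let us q : uniq (S q). Proof. exact: freqbox_uniq. Qed.
Let ms q k : k \notin S q -> m q k = 0. Proof. exact: lp_symbol_out. Qed.
Let mN q k : m q (- k) = m q k. Proof. exact: lp_symbolN. Qed.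
Let m01 q k : 0 <= m q k <= 1. Proof. exact: lp_symbol01. Qed.
Let m1 k : \forall q \near \oo, m q k = 1. Proof. exact: lp_symbol_near1. Qed.

Let tu : vcperiodic_on T u. Proof. exact: regular_vcperiodic_on. Qed.
Let tf : vcperiodic_on T f. Proof. exact: regular_vcperiodic_on. Qed.
Let ta : vcperiodic_on T (fun t => advection (u t)). Proof. exact: advection_vcperiodic_on. Qed.

Lemma lp_inner q v w : vcperiodic v -> vcperiodic w ->
  inner (lp chi q v) (lp chi q w) = vecform (B q) v w.
Proof.
have E z i : (fun x => lp chi q z x 0 i) = trunc (m q) (S q) (fun x => z x 0 i).
  by apply/funext => x; rewrite lpE.
move=> cv cw; rewrite innerE => [|i|i]; [|rewrite E; exact: cperiodic_trunc..].
apply: eq_bigr => i _; rewrite !E.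
exact: (L2form_trunc_trunc (us q) (@ms q) (@mN q) (cv i) (cw i)).
Qed.

Let EB q : energy_form (B q). Proof. exact: truncform_energy_form. Qed.

Definition lp_work q t := vecform (B q) (u t) (f t).
Definition lp_flux q t := vecform (B q) (advection (u t)) (u t).
Definition lp_dissip q t := gradform (B q) (u t).
Definition lp_energy q t := 2^-1 * vecform (B q) (u t) (u t).

Lemma eq_itv_int g h a b : (forall t, 0 < t < T -> g t = h t) -> 0 < a -> b < T ->
  itv_int g a b = itv_int h a b.
Proof.
move=> gh a0 bT; apply: eq_Rintegral => t; rewrite inE/= in_itv/= => /andP[at_ tb].
by apply: gh; rewrite (lt_le_trans a0)//= (le_lt_trans tb).
Qed.

Lemma lp_work_continuous : forall q, time_continuous T (lp_work q).
Proof. by move=> q t tT; exact: (vecform_continuous (EB q) tu tf tT). Qed.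

Lemma lp_flux_continuous : forall q, time_continuous T (lp_flux q).
Proof. by move=> q t tT; exact: (vecform_continuous (EB q) ta tu tT). Qed.

Lemma lp_dissip_continuous : forall q, time_continuous T (lp_dissip q).
Proof. by move=> q t tT; exact: (gradform_continuous (EB q) ru tT). Qed.

Lemma lp_energy_increment q a b : 0 < a -> a <= b -> b < T ->
  itv_int (lp_work q) a b - itv_int (lp_dissip q) a b - itv_int (lp_flux q) a b =
    lp_energy q b - lp_energy q a.
Proof.
move=> a0 ab bT.
have cw := @lp_work_continuous q; have cn := @lp_flux_continuous q; have cg := @lp_dissip_continuous q.
rewrite -(itv_intB cw cg)// -(itv_intB (time_continuousB cw cg) cn)//.
apply: (itv_int_derive (time_continuousB (time_continuousB cw cg) cn) (H := lp_energy q)) => // t tT.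
apply: is_derive_half.
have := energy_balance ru rf rp nse (EB q) tT.
by rewrite (vecformC (f t) (u t) (EB q)).
Qed.

Definition dissip_loss q t := dissip u t - lp_dissip q t.
Definition energy_loss q t := energy u t - lp_energy q t.
Definition work_defect q t := lp_work q t - work u f t.

Lemma dissip_loss_continuous : forall q, time_continuous T (dissip_loss q).
Proof. by move=> q; exact: time_continuousB (dissip_continuous ru) (@lp_dissip_continuous q). Qed.

Lemma work_defect_continuous : forall q, time_continuous T (work_defect q).
Proof. by move=> q; exact: time_continuousB (@lp_work_continuous q) (work_continuous ru rf). Qed.

(** The difference of the balance for the full energy and the balance for the
    truncated energy. Everything on the right except the defect of the work is a
    loss by truncation. *)
Lemma flux_work_identity q a b : 0 < a -> a <= b -> b < T ->
  itv_int (lp_flux q) a b = itv_int (work_defect q) a b + itv_int (dissip_loss q) a b +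
    (energy_loss q b - energy_loss q a).
Proof.
move=> a0 ab bT.
have E1 := lp_energy_increment q a0 ab bT.
have E2 := energy_increment ru rf rp nse a0 ab bT.
rewrite (itv_intB (@lp_work_continuous q) (work_continuous ru rf))//
  (itv_intB (dissip_continuous ru) (@lp_dissip_continuous q))//.
rewrite /energy_loss; move: E1 E2.
move: (itv_int (lp_work q) a b) (itv_int (lp_dissip q) a b) (itv_int (lp_flux q) a b)
  (itv_int (work u f) a b)
  (itv_int (dissip u) a b) (lp_energy q a) (lp_energy q b) (energy u a) (energy u b) => *; lra.
Qed.

Let cDu t j : 0 < t < T -> vcperiodic (partial j (u t)).
Proof. by move=> tT; exact: vcperiodic_on_slice (regular_vcperiodic_on (regular_partial j ru)) tT. Qed.

Lemma dissip_lossE q t : 0 < t < T ->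
  dissip_loss q t = \sum_j \sum_i tail (m q) (S q) (fun x => partial j (u t) x 0 i).
Proof.
move=> tT; rewrite /dissip_loss /dissip (grad_norm_sqE ru tT) /lp_dissip /gradform -sumrB.
by apply: eq_bigr => j _; rewrite /vecform -sumrB.
Qed.

Lemma dissip_loss_bounds q t : 0 < t < T -> 0 <= dissip_loss q t <= dissip u t.
Proof.
move=> tT; rewrite dissip_lossE//; apply/andP; split.
  apply: sumr_ge0 => j _; apply: sumr_ge0 => i _.
  exact: (tail_ge0 (us q) (@ms q) (@mN q) (m01 q) (cDu j tT i)).
rewrite /dissip (grad_norm_sqE ru tT); apply: ler_sum => j _; apply: ler_sum => i _.
exact: (tail_le (us q) (@ms q) (@mN q) (cDu j tT i)).
Qed.

Lemma dissip_loss_cvg0 t : 0 < t < T -> dissip_loss q t @[q --> \oo] --> (0 : R).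
Proof.
move=> tT; rewrite (_ : (fun q => dissip_loss q t) =
  fun q => \sum_j \sum_i tail (m q) (S q) (fun x => partial j (u t) x 0 i)); last first.
  by apply/funext => q; rewrite dissip_lossE.
have L : \sum_j \sum_i tail (m q) (S q) (fun x => partial j (u t) x 0 i) @[q --> \oo] -->
    \sum_(j < d) \sum_(i < d) (0 : R).
  apply: (@cvg_sumr R nat \oo eventually_filter _ _ (fun j q =>
    \sum_i tail (m q) (S q) (fun x => partial j (u t) x 0 i))) => j.
  apply: (@cvg_sumr R nat \oo eventually_filter _ _ (fun i q =>
    tail (m q) (S q) (fun x => partial j (u t) x 0 i))) => i.
  exact: (tail_cvg0 us ms mN m01 m1 (cDu j tT i)).
move: L; rewrite (_ : \sum_(j < d) \sum_(i < d) 0 = 0)//.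
by rewrite big1// => j _; rewrite big1.
Qed.

Definition vtail q (v : 'rV[R]_d -> 'rV[R]_d) := \sum_i tail (m q) (S q) (fun x => v x 0 i).

Lemma energy_lossE q t : 0 < t < T -> energy_loss q t = 2^-1 * vtail q (u t).
Proof.
by move=> tT; rewrite /energy_loss (energyE ru tT) /lp_energy -mulrBr; congr (_ * _);
  rewrite /vecform -sumrB.
Qed.

Lemma vtail_ge0 q v : vcperiodic v -> 0 <= vtail q v.
Proof.
by move=> cv; apply: sumr_ge0 => i _; exact: (tail_ge0 (us q) (@ms q) (@mN q) (m01 q) (cv i)).
Qed.

Lemma vtail_cvg0 v : vcperiodic v -> vtail q v @[q --> \oo] --> (0 : R).
Proof.
move=> cv.
have L : vtail q v @[q --> \oo] --> \sum_(i < d) (0 : R).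
  apply: (@cvg_sumr R nat \oo eventually_filter _ _ (fun i q =>
    tail (m q) (S q) (fun x => v x 0 i))) => i.
  exact: (tail_cvg0 us ms mN m01 m1 (cv i)).
by move: L; rewrite big1.
Qed.

(** The square root of [vtail] is a seminorm dominated by the L2 norm. *)
Lemma vtail_close q v w : vcperiodic v -> vcperiodic w ->
  vtail q v <= 2 * vtail q w + 2 * inner (v \- w) (v \- w).
Proof.
move=> cv cw.
have cd : vcperiodic (v \- w).
  move=> i; apply: (@eq_cperiodic _ _ _ (fun x => v x 0 i - w x 0 i)); last exact: cperiodicB.
  by move=> x; rewrite /= !mxE.
rewrite innerE// /vecform !mulr_sumr -big_split/=; apply: ler_sum => i _.
have := tail_sum (us q) (@ms q) (@mN q) (m01 q) 1 (cw i) (cd i).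
rewrite (_ : (fun x => 1 * w x 0 i + (v \- w) x 0 i) = (fun x => v x 0 i)); last first.
  by apply/funext => x; rewrite /= !mxE; ring.
have := tail_le (us q) (@ms q) (@mN q) (cd i).
move: (tail _ _ _) (tail _ _ _) (tail _ _ _) (L2form _ _) => A B' C D; lra.
Qed.

Variable c : R.
Hypothesis cT : 0 < c < T.
Hypotheses (sUT : square_integrable (U T)) (cUT : L2norm (u s \- U T) @[s --> T^'-] --> (0 : R)).

Let nearT : \forall t \near T^'-, 0 < t < T.
Proof.
by near=> t; apply/andP; split=> //; near: t; exact: nbhs_left_gt.
Unshelve. all: by end_near. Qed.

Let su : \forall s \near T^'-, square_integrable (u s).
Proof. by apply: filterS nearT => s sT; exact: vcperiodic_square_integrable
  (vcperiodic_on_slice tu sT). Qed.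

Lemma coef_u_cvg w i : cperiodic w -> cvg (torus_int (fun x => u s x 0 i * w x) @[s --> T^'-]).
Proof.
move=> cw; apply/cvg_ex; exists (inner (U T) (mode_field w i)).
rewrite (_ : (fun s => _) = fun s => inner (u s) (mode_field w i)); last first.
  by apply/funext => s; rewrite inner_mode_field.
apply: strong_weak_cvg => //; exact: vcperiodic_square_integrable (mode_field_vcperiodic i cw).
Qed.

(** Trigonometric fields are test fields, so the distributional limit of [f] at T
    applies. *)
Lemma coef_f_cvg (a b : R) k i :
  cvg (torus_int (fun x => f s x 0 i * (a * cosk k x + b * sink k x)) @[s --> T^'-]).
Proof.
have [L [_ HL]] := fT; apply/cvg_ex.
exists (L (mode_field (fun x => a * cosk k x + b * sink k x) i)).
rewrite (_ : (fun s => _) =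
    fun s => inner (f s) (mode_field (fun x => a * cosk k x + b * sink k x) i)); last first.
  by apply/funext => s; rewrite inner_mode_field.
exact: HL (mode_field_test k a b i).
Qed.

Lemma cvg_sum_ex I (r : seq I) (g : I -> R -> R) (F : set_system R) {FF : ProperFilter F} :
  (forall i, cvg (g i s @[s --> F])) -> cvg (\sum_(i <- r) g i s @[s --> F]).
Proof.
move=> cg; apply/cvg_ex; exists (\sum_(i <- r) lim (g i s @[s --> F])).
by apply: (@cvg_sumr R R F _ _ r g (fun i => lim (g i s @[s --> F]))) => i; exact: cg.
Qed.

Lemma form_cvg q (g h : R -> 'rV[R]_d -> 'rV[R]_d) :
  (forall k i, cvg (Ccoef (fun x => g s x 0 i) k @[s --> T^'-])) ->
  (forall k i, cvg (Scoef (fun x => g s x 0 i) k @[s --> T^'-])) ->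
  (forall k i, cvg (Ccoef (fun x => h s x 0 i) k @[s --> T^'-])) ->
  (forall k i, cvg (Scoef (fun x => h s x 0 i) k @[s --> T^'-])) ->
  cvg (vecform (B q) (g s) (h s) @[s --> T^'-]).
Proof.
move=> gC gS hC hS; apply: (@cvg_sum_ex _ _ (fun i s => B q (fun x => g s x 0 i)
  (fun x => h s x 0 i))) => i.
apply: (@cvg_sum_ex _ _ (fun k s => m q k ^+ 2 / vol d *
  mode_form k (fun x => g s x 0 i) (fun x => h s x 0 i))) => k.
apply: is_cvgM; first exact: is_cvg_cst.
by apply: is_cvgD; apply: is_cvgM.
Qed.

Let uC k i : cvg (Ccoef (fun x => u s x 0 i) k @[s --> T^'-]).
Proof. exact: coef_u_cvg (cperiodic_cosk k). Qed.

Let uS k i : cvg (Scoef (fun x => u s x 0 i) k @[s --> T^'-]).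
Proof. exact: coef_u_cvg (cperiodic_sink k). Qed.

Let fC k i : cvg (Ccoef (fun x => f s x 0 i) k @[s --> T^'-]).
Proof.
have -> : (fun s => Ccoef (fun x => f s x 0 i) k) =
    (fun s => torus_int (fun x => f s x 0 i * (1 * cosk k x + 0 * sink k x))).
  by apply/funext => s; apply: eq_torus_int => x; rewrite mul1r mul0r addr0.
exact: coef_f_cvg.
Qed.

Let fS k i : cvg (Scoef (fun x => f s x 0 i) k @[s --> T^'-]).
Proof.
have -> : (fun s => Scoef (fun x => f s x 0 i) k) =
    (fun s => torus_int (fun x => f s x 0 i * (0 * cosk k x + 1 * sink k x))).
  by apply/funext => s; apply: eq_torus_int => x; rewrite mul1r mul0r add0r.
exact: coef_f_cvg.
Qed.

Lemma lp_work_cvg q : cvg (lp_work q s @[s --> T^'-]).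
Proof. exact: form_cvg. Qed.

Lemma energy_loss_cvg q : cvg (energy_loss q s @[s --> T^'-]).
Proof.
apply: is_cvgB; first by apply/cvg_ex; exists (closed_energy T u T); exact: EE.2.
by apply: is_cvgM; [exact: is_cvg_cst|exact: form_cvg].
Qed.

Lemma primitive_work_defect_cvg q : cvg (primitive (work_defect q) c s @[s --> T^'-]).
Proof.
have [_ cW] := in_calL_primitive T0 (work_continuous ru rf) Wint cT.
have cw := primitive_cvg_left (@lp_work_continuous q) cT (lp_work_cvg (q := q)).
have L : cvg (primitive (lp_work q) c s - primitive (work u f) c s @[s --> T^'-]).
  exact: (is_cvgB cw cW).
apply/cvg_ex; exists (lim (primitive (lp_work q) c s - primitive (work u f) c s @[s --> T^'-])).
apply: cvg_trans L; apply: near_eq_cvg; apply: filterS nearT => s /andP[s0 sT].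
have [c0 c1] := andP cT.
by rewrite /primitive !(itv_intB (@lp_work_continuous q) (work_continuous ru rf))//; ring.
Qed.

Let dissip_primitive a b : 0 <= a -> a < b -> b <= T -> is_primitive_on (dissip u)
  (total_dissip T u f c) a b (total_dissip T u f c a) (total_dissip T u f c b).
Proof. exact: (total_dissip_primitive T0 ru rf rp nse Wint cT EE). Qed.

Let c0T : [/\ 0 <= c, c < T & T <= T].
Proof. by case/andP: cT => h1 h2; split => //; exact: ltW. Qed.

Lemma primitive_dissip_loss_cvg q : cvg (primitive (dissip_loss q) c s @[s --> T^'-]).
Proof.
have [c0 c1] := andP cT.
have h1 : 0 <= c / 2 by lra.
have h2 : c / 2 < T by lra.
have h3 : c / 2 < c < T by apply/andP; split; lra.
have P := dissip_primitive h1 h2 (lexx T).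
have D0 t : 0 < t < T -> 0 <= dissip u t by move=> _; exact: dissip_ge0.
have H0 t : 0 < t < T -> 0 <= dissip_loss q t by move=> tT; have /andP[] := dissip_loss_bounds q tT.
have E := integral_oo (dissip_continuous ru) D0 h1 h2 (lexx T) P.
have fin : (\int[mu]_(r in `](c / 2)%R, T[) (dissip_loss q r)%:E \is a fin_num)%E.
  rewrite ge0_fin_numE; last first.
    apply: integral_ge0 => t; rewrite /= in_itv/= => /andP[t0 t1].
    by rewrite lee_fin; apply: H0; rewrite (le_lt_trans h1 t0).
  apply: (@le_lt_trans _ _ (\int[mu]_(r in `](c / 2)%R, T[) (dissip u r)%:E)%E); last first.
    by rewrite E ltry.
  apply: ge0_le_integral => //=.
  - move=> t; rewrite in_itv/= => /andP[t0 t1].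
    by rewrite lee_fin; apply: H0; rewrite (le_lt_trans h1 t0).
  - by apply/measurable_EFinP; apply: time_continuous_measurable (@dissip_loss_continuous q) _ _.
  - by apply/measurable_EFinP; apply: time_continuous_measurable (dissip_continuous ru) _ _.
  - move=> t; rewrite in_itv/= => /andP[t0 t1]; rewrite lee_fin.
    have tT : 0 < t < T by rewrite (le_lt_trans h1 t0).
    by have /andP[] := dissip_loss_bounds q tT.
exact: (primitive_cvg_left_ge0 T0 (@dissip_loss_continuous q) H0 h1 h3 (esym (fineK fin))).
Qed.

Let total_loss q := lim (primitive (dissip_loss q) c s @[s --> T^'-]).
Let final_loss q := lim (energy_loss q s @[s --> T^'-]).
Let total_defect q := lim (primitive (work_defect q) c s @[s --> T^'-]).

Let primitive_base g : primitive g c c = 0.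
Proof. by rewrite /primitive subrr. Qed.

Let cvg_at_c g : time_continuous T g -> g s @[s --> c^'+] --> g c.
Proof. by move=> cg; apply: cvg_at_right_filter; exact: cg. Qed.

Lemma energy_loss_continuous q : time_continuous T (energy_loss q).
Proof.
apply: time_continuousB; first exact: energy_time_continuous.
by move=> t tT; apply: cvgM; [exact: cvg_cst|exact: (vecform_continuous (EB q) tu tu tT)].
Qed.

Lemma improper_work_defect q :
  improper_int (fun t => inner (lp chi q (u t)) (lp chi q (f t)) - inner (u t) (f t)) c T =
    total_defect q.
Proof.
have [c0 c1] := andP cT.
rewrite (@improper_intE R _ (primitive (work_defect q) c) c T 0 (total_defect q) c1).
- by rewrite subr0.
- move=> s t cs st tT; rewrite -(itv_int_primitive (@work_defect_continuous q) cT)//;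
    last exact: lt_trans cs.
  apply: eq_itv_int => //; last exact: lt_trans cs.
  by move=> r rT; rewrite /work_defect lp_inner//; exact: vcperiodic_on_slice rT.
- by rewrite -(primitive_base (work_defect q)); apply: cvg_at_c;
    apply: primitive_time_continuous => //; exact: work_defect_continuous.
- exact: primitive_work_defect_cvg.
Qed.

Lemma improper_lp_flux q :
  improper_int (fun t => inner (lp chi q (advection (u t))) (lp chi q (u t))) c T =
  total_defect q + total_loss q + (final_loss q - energy_loss q c).
Proof.
have [c0 c1] := andP cT.
pose K t := primitive (work_defect q) c t + primitive (dissip_loss q) c t + energy_loss q t.
rewrite (@improper_intE R _ K c T (energy_loss q c) (total_defect q + total_loss q + final_loss q) c1).
- by rewrite addrA.
- move=> s t cs st tT.
  have s0 : 0 < s by exact: lt_trans cs.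
  rewrite (@eq_itv_int _ (lp_flux q))//; last first.
    by move=> r rT; rewrite lp_inner; [|exact: (vcperiodic_on_slice ta rT)|exact:
      (vcperiodic_on_slice tu rT)].
  rewrite flux_work_identity// (itv_int_primitive (@work_defect_continuous q) cT)//
    (itv_int_primitive (@dissip_loss_continuous q) cT)//.
  by rewrite /K; ring.
- have -> : energy_loss q c = primitive (work_defect q) c c +
    primitive (dissip_loss q) c c + energy_loss q c by rewrite !primitive_base !add0r.
  apply: cvg_at_c; apply: time_continuousD; last exact: energy_loss_continuous.
  by apply: time_continuousD; apply: primitive_time_continuous => //;
    [exact: work_defect_continuous|exact: dissip_loss_continuous].
- apply: cvgD; last exact: energy_loss_cvg.
  by apply: cvgD; [exact: primitive_work_defect_cvg|exact: primitive_dissip_loss_cvg].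
Qed.

(** The losses are dominated by the dissipation, which is integrable up to T
    because the energy has a limit there. *)
Lemma total_loss_cvg0 : total_loss q @[q --> \oo] --> (0 : R).
Proof.
have [c0 c1 TT] := c0T.
have H := @integral_oo_dominated R T (dissip u) _ c T _ _ dissip_loss
  (fun q => primitive (dissip_loss q) c)
  (fun=> 0) total_loss (dissip_continuous ru) c0 c1 TT (dissip_primitive c0 c1 TT)
    (@dissip_loss_continuous) dissip_loss_bounds dissip_loss_cvg0.
have {}H : total_loss q - 0 @[q --> \oo] --> (0 : R).
  apply: H => q; split.
  - move=> s t cs st tT; rewrite (itv_int_primitive (@dissip_loss_continuous q) cT)//;
      exact: le_lt_trans cs.
  - by rewrite -(primitive_base (dissip_loss q)); apply: cvg_at_c;
      apply: primitive_time_continuous => //; exact: dissip_loss_continuous.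
  - exact: primitive_dissip_loss_cvg.
by move: H; under eq_fun do rewrite subr0.
Qed.

Lemma energy_loss_cvg0 : energy_loss q c @[q --> \oo] --> (0 : R).
Proof.
have L : 2^-1 * vtail q (u c) @[q --> \oo] --> 2^-1 * (0 : R).
  apply: cvgM; first exact: cvg_cst.
  exact: vtail_cvg0 (vcperiodic_on_slice tu cT).
by move: L; rewrite mulr0; under eq_fun do rewrite -energy_lossE//.
Qed.

(** The loss at a fixed field u(b) tends to 0, and near T the field u(t) is close
    to u(b) in L2, uniformly in the truncation. *)
Lemma final_loss_cvg0 : final_loss q @[q --> \oo] --> (0 : R).
Proof.
apply/cvgrPdist_lt => e e0.
have e4 : 0 < e / 8 by rewrite divr_gt0.
have [b [bT sb Hb]] : exists b, [/\ 0 < b < T, square_integrable (u b) &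
    \forall s \near T^'-, inner (u s \- u b) (u s \- u b) <= e / 2].
  have N2 : \forall s \near T^'-, inner (u s \- U T) (u s \- U T) < e / 8.
    have L : L2norm (u s \- U T) ^+ 2 @[s --> T^'-] --> (0 : R) ^+ 2.
      by apply: cvgM; exact: cUT.
    move/cvgrPdist_lt : L => /(_ _ e4); apply: filterS => s.
    by rewrite expr0n/= sub0r normrN L2norm_sqr ger0_norm// inner_ge0.
  have [b [b1 b2 b3]] : exists b, [/\ 0 < b < T, square_integrable (u b) &
      inner (u b \- U T) (u b \- U T) < e / 8].
    near T^'- => b; exists b; split; near: b; [exact: nearT|exact: su|exact: N2].
  exists b; split=> //; near=> s.
  have ss : square_integrable (u s) by near: s; exact: su.
  apply: (le_trans (inner_sub_triangle ss b2 sUT)).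
  have : inner (u s \- U T) (u s \- U T) < e / 8 by near: s; exact: N2.
  move: b3; move: (inner _ _) (inner _ _) => A B'; lra.
have V0 : \forall q \near \oo, `|0 - vtail q (u b)| < e / 4.
  have h4 : 0 < e / 4 by rewrite divr_gt0.
  by move/cvgrPdist_lt : (vtail_cvg0 (vcperiodic_on_slice tu bT)) => /(_ _ h4).
near=> q.
have vq : vtail q (u b) < e / 4.
  have : `|0 - vtail q (u b)| < e / 4 by near: q.
  by rewrite sub0r normrN; apply: le_lt_trans; exact: ler_norm.
have l0 : 0 <= final_loss q.
  apply: limr_ge; first exact: energy_loss_cvg.
  apply: filterS nearT => s sT; rewrite energy_lossE// mulr_ge0// vtail_ge0//.
  exact: vcperiodic_on_slice sT.
have l1 : final_loss q <= vtail q (u b) + e / 2.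
  apply: limr_le; first exact: energy_loss_cvg.
  near=> s.
  have sT : 0 < s < T by near: s; exact: nearT.
  rewrite energy_lossE//.
  have := @vtail_close q (u s) (u b) (vcperiodic_on_slice tu sT) (vcperiodic_on_slice tu bT).
  have : inner (u s \- u b) (u s \- u b) <= e / 2 by near: s; exact: Hb.
  move: (vtail _ _) (vtail _ _) (inner _ _) => A B' C; lra.
rewrite sub0r normrN ger0_norm//; move: l1 vq; move: (final_loss q) (vtail _ _) => A B'; lra.
Unshelve. all: by end_near. Qed.

Lemma anomalous_equality :
  limn_esup (fun q => `| improper_int (fun t =>
    inner (lp chi q (advection (u t))) (lp chi q (u t))) c T |%:E) =
  limn_esup (fun q => `| improper_int (fun t =>
    inner (lp chi q (u t)) (lp chi q (f t)) - inner (u t) (f t)) c T |%:E).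
Proof.
apply: limn_esup_close.
rewrite (_ : (fun q => _) = fun q => total_loss q + (final_loss q - energy_loss q c)); last first.
  by apply/funext => q; rewrite improper_work_defect improper_lp_flux; ring.
have L : total_loss q + (final_loss q - energy_loss q c) @[q --> \oo] --> (0 + (0 - 0) : R).
  apply: cvgD; first exact: total_loss_cvg0.
  by apply: cvgB; [exact: final_loss_cvg0|exact: energy_loss_cvg0].
by move: L; rewrite subr0 addr0.
Qed.

End anomalous.

Theorem theorem1p1 (R : realType) (d : nat) (T : R) (chi : 'rV[R]_d -> R)
    (u f : R -> 'rV[R]_d -> 'rV[R]_d) :
  (3 <= d)%N -> 0 < T -> lp_cutoff chi -> class_N T u f ->
  (energy_continuous T u <-> energy_equality T u f) /\
  (energy_continuous T u \/ energy_equality T u f ->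
   anomalous_dissipation chi T u = anomalous_work chi T u f).
Proof.
move=> d3 T0 chiP [uP uS _ fP fS [p [pP pS nse]] Wint _ fT].
have d0 : (0 < d)%N by exact: leq_trans d3.
have ru : regular T u by split.
have rf : regular T f by split.
have rp : regular T p by split.
have cT : 0 < T / 2 < T by apply/andP; split; lra.
have eqv1 : energy_continuous T u -> energy_equality T u f.
  move=> /(continuous_endpoints T0 ru) EE.
  exact: (endpoints_energy_equality T0 ru rf rp nse Wint cT EE).
have eqv2 : energy_equality T u f -> energy_continuous T u.
  move=> EQ; apply: (endpoints_continuous T0 ru).
  exact: (energy_equality_endpoints T0 ru rf Wint cT EQ).
split; first by split.
move=> H; have EC : energy_continuous T u by case: H => // /eqv2.
have EE := continuous_endpoints T0 ru EC.
have [sUT cUT] := energy_continuousT T0 EC.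
exact: (anomalous_equality T0 ru rf rp nse Wint fT d0 chiP EE cT sUT cUT).
Qed.
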